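(* Let $a\in\mathbb{C}$ with $\operatorname{Re} a>0$. Then: (i) for $n=0,1,2,\ldots$, $$\zeta(-n,a)=\frac{n!}{2\pi i}\int_L\frac{z^{-(n+1)}}{1-e^z}\,e^{az}\,dz;$$ (ii) for $n=1,2,\ldots$, $$\zeta(n+1,a)=\frac{(-1)^{n+1}}{2\pi i\,n!}\int_L\frac{z^n\operatorname{Log} z}{1-e^z}\,e^{az}\,dz;$$ (iii) for all $s\in\mathbb{C}$ with $s\ne 1,2,\ldots$, $$\zeta'(s,a)+\psi(1-s)\,\zeta(s,a)=\frac{\Gamma(1-s)}{2\pi i}\int_L\frac{z^{s-1}e^{az}\operatorname{Log} z}{1-e^z}\,dz;$$ (iv) in particular, for $n=0,1,2,\ldots$, $$\zeta'(-n,a)+\psi(n+1)\,\zeta(-n,a)=\frac{n!}{2\pi i}\int_L\frac{z^{-n-1}e^{az}\operatorname{Log} z}{1-e^z}\,dz.$$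
   Context: $\zeta(s,a)$ is the Hurwitz zeta function: $\zeta(s,a)=\sum_{n=0}^\infty (n+a)^{-s}$ for $\operatorname{Re} s>1$ (principal powers), extended analytically in $s$ to $\mathbb{C}\setminus\{1\}$; $\zeta'(s,a)=\partial_s\zeta(s,a)$. $\psi=\Gamma'/\Gamma$ is the digamma function. $L=L_-\cup L_\epsilon\cup L_+$ is the Hankel contour, with small $\epsilon$ ($0<\epsilon<2\pi$): $L_-$ is the lower side ($\arg z=-\pi$) of the ray $(-\infty,-\epsilon)$ traced left to right; $L_\epsilon=\{\epsilon e^{i\theta}:-\pi\le\theta\le\pi\}$ is traced counterclockwise; $L_+$ is the upper side ($\arg z=\pi$) of the ray traced right to left. $\operatorname{Log} z=\ln|z|+i\arg z$ with $\arg z=-\pi$ on $L_-$, $\arg z=\theta$ on $L_\epsilon$, $\arg z=\pi$ on $L_+$, and $z^{w}=e^{w\operatorname{Log} z}$. *)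

(* Defs.v *)
From Stdlib Require Import Reals ClassicalEpsilon.
From Coquelicot Require Import Coquelicot.

Open Scope R_scope.

Definition Cexp (z : C) : C := (exp (Re z) * cos (Im z), exp (Re z) * sin (Im z)).

(* Principal argument, with values in (-PI, PI] for z <> 0. *)
Definition Carg (z : C) : R :=
  if Rle_dec 0 (Im z) then acos (Re z / Cmod z) else - acos (Re z / Cmod z).

Definition CLog (z : C) : C := (ln (Cmod z), Carg z).

Definition Cpower (z w : C) : C := Cexp (w * CLog z)%C.

Definition holomorphic_on (D : C -> Prop) (F : C -> C) : Prop :=
  forall s, D s -> @ex_derive C_AbsRing C_NormedModule F s.

(* The function holomorphic on D whose value at each s in U is the v such that
   [val s v].  For D open and connected, and U a nonempty open subset of D, it is
   unique on D, and its values outside D are meaningless. *)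
Definition analytic_continuation (D U : C -> Prop) (val : C -> C -> Prop) : C -> C :=
  epsilon (inhabits (fun _ : C => RtoC 0))
    (fun F => holomorphic_on D F /\ forall s, U s -> val s (F s)).

(* Euler's integral of t^(s-1) e^(-t) over (0, +oo), continued to C \ {0, -1, -2, ...}. *)
Definition Gamma : C -> C :=
  analytic_continuation
    (fun s => forall n : nat, s <> (- RtoC (INR n))%C)
    (fun s => 0 < Re s)
    (fun s v =>
       @is_RInt_gen C_R_NormedModule
         (fun t : R => (Cexp ((s - 1) * RtoC (ln t)) * RtoC (exp (- t)))%C)
         (at_right 0) (Rbar_locally p_infty) v).

(* On functions that are complex differentiable at the point, [C_derive] is the
   complex derivative (Coquelicot's [C_derive_correct]). *)
Definition digamma (s : C) : C := (C_derive Gamma s / Gamma s)%C.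

Definition hurwitz_zeta (s a : C) : C :=
  analytic_continuation
    (fun s => s <> RtoC 1)
    (fun s => 1 < Re s)
    (fun s v =>
       @is_series C_AbsRing C_NormedModule
         (fun n : nat => Cpower (RtoC (INR n) + a) (- s)%C) v)
    s.

Definition hurwitz_zeta' (s a : C) : C :=
  C_derive (fun s => hurwitz_zeta s a) s.

(* An integrand on the Hankel contour is a function [f z l] of a point z and of the
   value l of Log z there, because the lower side (Im l = -PI) and the upper side
   (Im l = PI) of the cut lie over the same points z.  Both sides are parametrized by
   z = x < 0: from -oo to -eps on the lower side, from -eps to -oo on the upper one. *)
Definition hankel_lower (f : C -> C -> C) (x : R) : C := f (RtoC x) (ln (- x), - PI).

Definition hankel_upper (f : C -> C -> C) (x : R) : C := f (RtoC x) (ln (- x), PI).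

Definition hankel_circle (eps : R) (f : C -> C -> C) (theta : R) : C :=
  let z := (RtoC eps * Cexp (Ci * RtoC theta))%C in
  (f z (ln eps, theta) * (Ci * z))%C.

Definition ex_hankel_int (eps : R) (f : C -> C -> C) : Prop :=
  @ex_RInt_gen C_R_NormedModule (hankel_lower f)
    (Rbar_locally m_infty) (at_point (- eps)%R) /\
  @ex_RInt C_R_NormedModule (hankel_circle eps f) (- PI) PI /\
  @ex_RInt_gen C_R_NormedModule (hankel_upper f)
    (at_point (- eps)%R) (Rbar_locally m_infty).

Definition hankel_int (eps : R) (f : C -> C -> C) : C :=
  (@RInt_gen C_R_CompleteNormedModule (hankel_lower f)
     (Rbar_locally m_infty) (at_point (- eps)%R) +
   @RInt C_R_CompleteNormedModule (hankel_circle eps f) (- PI)%R PI +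
   @RInt_gen C_R_CompleteNormedModule (hankel_upper f)
     (at_point (- eps)%R) (Rbar_locally m_infty))%C.

(* Main.v *)
(** In the coordinate [z = exp w], the Hankel contour becomes the boundary of a half-strip:
  the lines [Im w = -PI] and [Im w = PI] for [Re w > ln eps], joined by the segment
  [Re w = ln eps].  By Goursat's theorem on rectangles, for [Re s > 1] the segment can be
  pushed to [Re w = -oo], where it vanishes, so that the integral [I(s)] of
  [z^(s-1) e^(az) / (1 - e^z)] equals
  [(e^(i pi s) - e^(- i pi s)) Gamma(s) zeta(s, a)]; by the reflection formula this is
  [2 i pi zeta(s, a) / Gamma(1 - s)].  Since [I] is entire, with derivative the integral
  carrying the extra factor [Log z], the function [Gamma(1 - s) I(s) / (2 i pi)] continues
  [zeta], and continuations are unique.  Its values at [s = -n] give (i); its logarithmic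
  derivative gives (iii) and (iv); and (ii) is the derivative of
  [(e^(i pi s) - e^(- i pi s)) Gamma(s) zeta(s, a)] at the zero [s = n + 1] of the first
  factor. *)

Require Import Defs.
From Stdlib Require Import Reals Factorial.
From Stdlib Require Import ZArith Lra Lia Classical ClassicalEpsilon.
From Coquelicot Require Import Coquelicot.

Open Scope R_scope.

(** * Complex differentiability *)

Definition Ccont (F : C -> C) (z : C) : Prop :=
 forall eps, 0 < eps -> exists d, 0 < d /\
  forall w, Cmod (w - z)%C < d -> Cmod (F w - F z)%C < eps.

(* Caratheodory's form of the derivative, stable under products and composition
  without any estimate. *)
Definition cdiff (F : C -> C) (z l : C) : Prop :=
 exists phi : C -> C, Ccont phi z /\ phi z = l /\
  forall w, F w = (F z + (w - z) * phi w)%C.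

Definition hol (F : C -> C) (z : C) : Prop := exists l, cdiff F z l.

Lemma Cmod_triangle_minus (a b : C) : Cmod (a - b)%C <= Cmod a + Cmod b.
Proof.
 unfold Cminus. rewrite <- (Cmod_opp b). apply Cmod_triangle.
Qed.

Lemma Cmod_small_0 (z : C) (K : R) :
 (forall e, 0 < e -> Cmod z <= K * e) -> z = 0.
Proof.
 intros H. apply Cmod_eq_0, Rle_antisym; [|apply Cmod_ge_0].
 apply le_epsilon. intros e He. rewrite Rplus_0_l.
 assert (P := Rabs_pos K). assert (Q := Rle_abs K).
 eapply Rle_trans; [apply (H (e / (Rabs K + 1))); apply Rdiv_lt_0_compat; lra|].
 apply Rmult_le_reg_r with (Rabs K + 1); [lra|].
 replace (K * (e / (Rabs K + 1)) * (Rabs K + 1)) with (K * e) by (field; lra). nra.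
Qed.

Lemma Cmod_triangle_rev (a b : C) : Cmod a - Cmod b <= Cmod (a - b)%C.
Proof.
 assert (H := Cmod_triangle (a - b)%C b).
 replace (a - b + b)%C with a in H by ring. lra.
Qed.

Lemma Cmod_sym (a b : C) : Cmod (a - b)%C = Cmod (b - a)%C.
Proof. rewrite <- Cmod_opp. f_equal. ring. Qed.

Lemma Cmod_pos (z : C) : z <> 0 -> 0 < Cmod z.
Proof. apply Cmod_gt_0. Qed.

Lemma Ccont_continuous F z :
 Ccont F z <-> @continuous (AbsRing_UniformSpace C_AbsRing) (AbsRing_UniformSpace C_AbsRing) F z.
Proof.
 split; intros H.
 - intros P [eps HP]. destruct (H eps (cond_pos eps)) as (d & Hd & Hw).
  exists (mkposreal d Hd). intros w Bw. apply HP, Hw, Bw.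
 - intros eps He. destruct (H (fun y => Cmod (y - F z)%C < eps)) as [d Hd].
  + exists (mkposreal eps He). auto.
  + exists d. split; [apply cond_pos|exact Hd].
Qed.

Lemma Ccont_const (c z : C) : Ccont (fun _ => c) z.
Proof.
 intros eps He. exists 1. split; [lra|]. intros w _.
 replace (c - c)%C with (RtoC 0) by ring. now rewrite Cmod_0.
Qed.

Lemma Ccont_id (z : C) : Ccont (fun w => w) z.
Proof. intros eps He. exists eps. auto. Qed.

Lemma Ccont_plus F G z : Ccont F z -> Ccont G z -> Ccont (fun w => F w + G w)%C z.
Proof.
 intros HF HG. apply Ccont_continuous.
 apply (@continuous_plus (AbsRing_UniformSpace C_AbsRing) C_AbsRing (AbsRing_NormedModule C_AbsRing) F G);
  now apply Ccont_continuous.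
Qed.

Lemma Ccont_mult F G z : Ccont F z -> Ccont G z -> Ccont (fun w => F w * G w)%C z.
Proof.
 intros HF HG. apply Ccont_continuous.
 apply (@continuous_mult (AbsRing_UniformSpace C_AbsRing) C_AbsRing F G); now apply Ccont_continuous.
Qed.

Lemma Ccont_comp F G z : Ccont G z -> Ccont F (G z) -> Ccont (fun w => F (G w)) z.
Proof.
 intros HG HF eps He. destruct (HF eps He) as (d & Hd & H).
 destruct (HG d Hd) as (d' & Hd' & H'). exists d'. split; auto.
Qed.

Lemma Ccont_inv (z : C) : z <> 0 -> Ccont Cinv z.
Proof.
 intros Hz eps He.
 assert (Hm : 0 < Cmod z) by now apply Cmod_pos.
 exists (Rmin (Cmod z / 2) (eps * Cmod z * Cmod z / 4)). split.
 { apply Rmin_glb_lt; [lra|]. apply Rdiv_lt_0_compat; [|lra].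
  apply Rmult_lt_0_compat; [|lra]. apply Rmult_lt_0_compat; lra. }
 intros w Hw.
 assert (H1 := Rlt_le_trans _ _ _ Hw (Rmin_l _ _)).
 assert (H2 := Rlt_le_trans _ _ _ Hw (Rmin_r _ _)).
 assert (H3 := Cmod_triangle_rev z w). rewrite Cmod_sym in H3.
 assert (Hw0 : w <> 0).
 { intro E. subst w. rewrite Cmod_0 in H3. lra. }
 replace (/ w - / z)%C with ((z - w) * (/ w * / z))%C by (field; auto).
 rewrite !Cmod_mult, !Cmod_inv by auto. rewrite Cmod_sym.
 apply Rle_lt_trans with (Cmod (w - z)%C * (/ (Cmod z / 2) * / Cmod z)).
 - apply Rmult_le_compat_l; [apply Cmod_ge_0|].
  apply Rmult_le_compat_r; [left; now apply Rinv_0_lt_compat|].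
  apply Rinv_le_contravar; lra.
 - replace (/ (Cmod z / 2) * / Cmod z) with (2 / (Cmod z * Cmod z)) by (field; lra).
  apply Rmult_lt_reg_r with (Cmod z * Cmod z); [now apply Rmult_lt_0_compat|].
  replace (Cmod (w - z)%C * (2 / (Cmod z * Cmod z)) * (Cmod z * Cmod z))
   with (2 * Cmod (w - z)%C) by (field; lra).
  assert (0 < eps * Cmod z * Cmod z) by (apply Rmult_lt_0_compat; [|lra]; apply Rmult_lt_0_compat; lra).
  lra.
Qed.

Lemma Ccont_ext F G z : (forall w, F w = G w) -> Ccont F z -> Ccont G z.
Proof.
 intros E H eps He. destruct (H eps He) as (d & Hd & H').
 exists d. split; auto. intros w Hw. rewrite <- !E. auto.
Qed.

Lemma Ccont_ext_loc F G z r : 0 < r -> (forall w, Cmod (w - z)%C < r -> F w = G w) ->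
 Ccont F z -> Ccont G z.
Proof.
 intros Hr E H eps He. destruct (H eps He) as (d & Hd & H').
 exists (Rmin d r). split; [now apply Rmin_glb_lt|]. intros w Hw.
 assert (H1 := Rlt_le_trans _ _ _ Hw (Rmin_l _ _)).
 assert (H2 := Rlt_le_trans _ _ _ Hw (Rmin_r _ _)).
 rewrite <- !E; auto. replace (z - z)%C with (RtoC 0) by ring. now rewrite Cmod_0.
Qed.

Lemma cdiff_cont F z l : cdiff F z l -> Ccont F z.
Proof.
 intros (phi & Hc & _ & E).
 apply Ccont_ext with (fun w => F z + (w - z) * phi w)%C; [intros; symmetry; auto|].
 apply Ccont_plus; [apply Ccont_const|]. apply Ccont_mult; [|auto].
 apply (Ccont_plus (fun w => w) (fun _ => - z)%C); [apply Ccont_id|apply Ccont_const].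
Qed.

Lemma hol_cont F z : hol F z -> Ccont F z.
Proof. intros [l H]. eapply cdiff_cont, H. Qed.

Lemma cdiff_const c z : cdiff (fun _ => c) z 0.
Proof.
 exists (fun _ => RtoC 0). split; [apply Ccont_const|]. split; auto. intros; ring.
Qed.

Lemma cdiff_id z : cdiff (fun w => w) z 1.
Proof.
 exists (fun _ => RtoC 1). split; [apply Ccont_const|]. split; auto. intros; ring.
Qed.

Lemma cdiff_plus F G z a b :
 cdiff F z a -> cdiff G z b -> cdiff (fun w => F w + G w)%C z (a + b)%C.
Proof.
 intros (f & Hf & <- & Ef) (g & Hg & <- & Eg).
 exists (fun w => f w + g w)%C. split; [now apply Ccont_plus|]. split; auto.
 intros w. rewrite (Ef w), (Eg w). ring.
Qed.

Lemma cdiff_mult F G z a b :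
 cdiff F z a -> cdiff G z b -> cdiff (fun w => F w * G w)%C z (a * G z + F z * b)%C.
Proof.
 intros HF HG. assert (CG := cdiff_cont _ _ _ HG).
 destruct HF as (f & Hf & <- & Ef). destruct HG as (g & Hg & <- & Eg).
 exists (fun w => f w * G w + F z * g w)%C. split.
 - apply Ccont_plus; apply Ccont_mult; auto. apply Ccont_const.
 - split; auto. intros w. rewrite (Ef w). 
  replace (F z * G z)%C with (F z * (G w - (w - z) * g w))%C
   by (rewrite (Eg w); ring). ring.
Qed.

Lemma cdiff_comp F G z a b :
 cdiff G z b -> cdiff F (G z) a -> cdiff (fun w => F (G w)) z (a * b)%C.
Proof.
 intros HG (f & Hf & <- & Ef). assert (CG := cdiff_cont _ _ _ HG).
 destruct HG as (g & Hg & <- & Eg).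
 exists (fun w => f (G w) * g w)%C. split.
 - apply Ccont_mult; auto. now apply Ccont_comp.
 - split; auto. intros w. rewrite (Ef (G w)).
  replace (G w - G z)%C with ((w - z) * g w)%C by (rewrite (Eg w); ring). ring.
Qed.

Lemma cdiff_ext F G z l : (forall w, F w = G w) -> cdiff F z l -> cdiff G z l.
Proof.
 intros E (f & Hf & Hl & Ef). exists f. split; auto. split; auto.
 intros w. rewrite <- !E. auto.
Qed.

Lemma cdiff_eq F z l l' : l = l' -> cdiff F z l -> cdiff F z l'.
Proof. now intros ->. Qed.

Lemma cdiff_ext_loc F G z l r : 0 < r ->
 (forall w, Cmod (w - z)%C < r -> F w = G w) -> cdiff F z l -> cdiff G z l.
Proof.
 intros Hr E (f & Hf & Hl & Ef).
 assert (Ez : F z = G z).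
 { apply E. replace (z - z)%C with (RtoC 0) by ring. now rewrite Cmod_0. }
 exists (fun w => match Rlt_dec (Cmod (w - z)%C) r with
          | left _ => f w
          | right _ => ((G w - G z) / (w - z))%C end).
 split; [|split].
 - apply Ccont_ext_loc with f r; auto. intros w Hw. now destruct Rlt_dec.
 - destruct Rlt_dec; auto. exfalso. apply n.
  replace (z - z)%C with (RtoC 0) by ring. now rewrite Cmod_0.
 - intros w. destruct Rlt_dec.
  + rewrite <- E, <- Ez by auto. auto.
  + field. intro E0. apply n. rewrite E0. now rewrite Cmod_0.
Qed.

Lemma cdiff_inv (z : C) : z <> 0 -> cdiff Cinv z (- (/ z * / z))%C.
Proof.
 intros Hz. assert (Hm : 0 < Cmod z) by now apply Cmod_pos.
 apply cdiff_ext_loc with (fun w => / z + (w - z) * (- (/ w * / z)))%C (Cmod z); auto.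
 { intros w Hw. assert (w <> 0).
  { intros ->. rewrite Cmod_sym in Hw. replace (z - 0)%C with z in Hw by ring. lra. }
  field. auto. }
 exists (fun w => - (/ w * / z))%C. split; [|split]; auto.
 - apply Ccont_ext with (fun w => (- / z) * / w)%C; [intros; ring|].
  apply Ccont_mult; [apply Ccont_const|now apply Ccont_inv].
 - intros. ring.
Qed.

Lemma cdiff_eps F z l : 
 (forall eps, 0 < eps -> exists d, 0 < d /\ forall w, Cmod (w - z)%C < d ->
   Cmod (F w - F z - (w - z) * l)%C <= eps * Cmod (w - z)%C) -> cdiff F z l.
Proof.
 intros H.
 exists (fun w => match Ceq_dec w z with left _ => l
      | right _ => ((F w - F z) / (w - z))%C end).
 split; [|split].
 - intros eps He. destruct (H (eps / 2)) as (d & Hd & Hw); [lra|].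
  exists d. split; auto. intros w Hw'. specialize (Hw w Hw').
  destruct (Ceq_dec z z) as [_|N]; [|congruence].
  destruct (Ceq_dec w z) as [E|N].
  + replace (l - l)%C with (RtoC 0) by ring. now rewrite Cmod_0.
  + assert (N' : (w - z)%C <> 0) by now apply Cminus_eq_contra.
   assert (Hm : 0 < Cmod (w - z)%C) by now apply Cmod_pos.
   replace ((F w - F z) / (w - z) - l)%C with ((F w - F z - (w - z) * l) / (w - z))%C by (field; auto).
   rewrite Cmod_div by auto. apply Rmult_lt_reg_r with (Cmod (w - z)%C); auto.
   unfold Rdiv. rewrite Rmult_assoc, Rinv_l by lra.
   assert (0 < eps * Cmod (w - z)%C) by now apply Rmult_lt_0_compat. lra.
 - destruct (Ceq_dec z z); congruence.
 - intros w. destruct (Ceq_dec w z) as [->|N]; [ring|].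
  field. now apply Cminus_eq_contra.
Qed.

Lemma cdiff_eps_inv F z l : cdiff F z l ->
 forall eps, 0 < eps -> exists d, 0 < d /\ forall w, Cmod (w - z)%C < d ->
   Cmod (F w - F z - (w - z) * l)%C <= eps * Cmod (w - z)%C.
Proof.
 intros (f & Hf & <- & Ef) eps He. destruct (Hf eps He) as (d & Hd & H).
 exists d. split; auto. intros w Hw. rewrite (Ef w).
 replace (F z + (w - z) * f w - F z - (w - z) * f z)%C with ((f w - f z) * (w - z))%C by ring.
 rewrite Cmod_mult. apply Rmult_le_compat_r; [apply Cmod_ge_0|]. left; auto.
Qed.

Lemma cdiff_is_derive F z l :
 cdiff F z l -> @is_derive C_AbsRing C_NormedModule F z l.
Proof.
 intros H. split.
 - apply (@is_linear_scal_l C_AbsRing C_NormedModule).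
 - intros x Hx.
  assert (E : z = x) by exact (@is_filter_lim_locally_unique _ (AbsRing_NormedModule C_AbsRing) _ _ Hx).
  subst x. intros eps.
  destruct (cdiff_eps_inv _ _ _ H eps (cond_pos eps)) as (d & Hd & Hw).
  exists (mkposreal d Hd). intros w Bw. apply Hw, Bw.
Qed.

Lemma is_derive_cdiff F z l :
 @is_derive C_AbsRing C_NormedModule F z l -> cdiff F z l.
Proof.
 intros [_ H]. apply cdiff_eps. intros eps He.
 destruct (H z (fun P HP => HP) (mkposreal eps He)) as [d Hd].
 exists d. split; [apply cond_pos|]. intros w Hw. apply Hd, Hw.
Qed.

Lemma hol_ex_derive F z : hol F z <-> @ex_derive C_AbsRing C_NormedModule F z.
Proof.
 split; intros [l H]; exists l; [now apply cdiff_is_derive|now apply is_derive_cdiff].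
Qed.

Lemma cdiff_C_derive F z l : cdiff F z l -> C_derive F z = l.
Proof. intros H. apply is_C_derive_unique. now apply cdiff_is_derive. Qed.

Lemma cdiff_unique F z l l' : cdiff F z l -> cdiff F z l' -> l = l'.
Proof. intros H H'. now rewrite <- (cdiff_C_derive _ _ _ H), (cdiff_C_derive _ _ _ H'). Qed.

Lemma hol_const c z : hol (fun _ => c) z.
Proof. eexists. apply cdiff_const. Qed.
Lemma hol_id z : hol (fun w => w) z.
Proof. eexists. apply cdiff_id. Qed.
Lemma hol_plus F G z : hol F z -> hol G z -> hol (fun w => F w + G w)%C z.
Proof. intros [a Ha] [b Hb]. eexists. apply cdiff_plus; eauto. Qed.
Lemma hol_mult F G z : hol F z -> hol G z -> hol (fun w => F w * G w)%C z.
Proof. intros [a Ha] [b Hb]. eexists. apply cdiff_mult; eauto. Qed.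
Lemma hol_comp F G z : hol G z -> hol F (G z) -> hol (fun w => F (G w)) z.
Proof. intros [a Ha] [b Hb]. eexists. eapply cdiff_comp; eauto. Qed.
Lemma hol_ext F G z : (forall w, F w = G w) -> hol F z -> hol G z.
Proof. intros E [a Ha]. exists a. eapply cdiff_ext; eauto. Qed.
Lemma hol_ext_loc F G z r : 0 < r ->
 (forall w, Cmod (w - z)%C < r -> F w = G w) -> hol F z -> hol G z.
Proof. intros Hr E [a Ha]. exists a. eapply cdiff_ext_loc; eauto. Qed.
Lemma hol_opp F z : hol F z -> hol (fun w => - F w)%C z.
Proof.
 intros H. apply hol_ext with (fun w => (-(1)) * F w)%C; [intros; ring|].
 apply hol_mult; auto. apply hol_const.
Qed.
Lemma hol_minus F G z : hol F z -> hol G z -> hol (fun w => F w - G w)%C z.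
Proof. intros H1 H2. apply hol_plus; auto. now apply hol_opp. Qed.
Lemma hol_inv (F : C -> C) (z : C) : F z <> 0 -> hol F z -> hol (fun w => / F w)%C z.
Proof. intros N H. apply (hol_comp Cinv F); auto. eexists. now apply cdiff_inv. Qed.
Lemma hol_div (F G : C -> C) (z : C) : G z <> 0 -> hol F z -> hol G z -> hol (fun w => F w / G w)%C z.
Proof. intros N H1 H2. apply hol_mult; auto. now apply hol_inv. Qed.

(** * The complex exponential *)

Lemma C_eq (x y : C) : Re x = Re y -> Im x = Im y -> x = y.
Proof. intros. now apply injective_projections. Qed.

Lemma Cexp_plus (x y : C) : Cexp (x + y)%C = (Cexp x * Cexp y)%C.
Proof.
 unfold Cexp. apply C_eq; unfold Re, Im; simpl; rewrite exp_plus, ?cos_plus, ?sin_plus; ring.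
Qed.

Lemma Cexp_R (x : R) : Cexp x = (exp x).
Proof. unfold Cexp, RtoC, Re, Im. simpl. rewrite cos_0, sin_0. f_equal; ring. Qed.

Lemma Cexp_0 : Cexp 0 = 1.
Proof. rewrite Cexp_R. now rewrite exp_0. Qed.

Lemma Cmod_Cexp (z : C) : Cmod (Cexp z) = exp (Re z).
Proof.
 unfold Cexp, Cmod. simpl.
 replace (exp (Re z) * cos (Im z) * (exp (Re z) * cos (Im z) * 1) +
   exp (Re z) * sin (Im z) * (exp (Re z) * sin (Im z) * 1))
  with (Rsqr (exp (Re z)) * (Rsqr (sin (Im z)) + Rsqr (cos (Im z)))) by (unfold Rsqr; ring).
 rewrite sin2_cos2, Rmult_1_r. apply sqrt_Rsqr. left; apply exp_pos.
Qed.

Lemma Cexp_neq_0 (z : C) : Cexp z <> 0.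
Proof.
 intros E. assert (H := Cmod_Cexp z). rewrite E, Cmod_0 in H.
 generalize (exp_pos (Re z)). lra.
Qed.

Lemma Cexp_opp (z : C) : Cexp (- z)%C = (/ Cexp z)%C.
Proof.
 assert (H : (Cexp (- z) * Cexp z)%C = 1).
 { rewrite <- Cexp_plus. replace (- z + z)%C with (RtoC 0) by ring. apply Cexp_0. }
 rewrite <- (Cmult_1_l (/ Cexp z)), <- H. field. apply Cexp_neq_0.
Qed.

Lemma Cexp_minus (x y : C) : Cexp (x - y)%C = (Cexp x / Cexp y)%C.
Proof. unfold Cminus. now rewrite Cexp_plus, Cexp_opp. Qed.

Lemma Cexp_Ci_PI : Cexp (RtoC PI * Ci)%C = (- (1))%C.
Proof.
 unfold Cexp. apply C_eq; simpl.
 - replace (PI * 0 - 0 * 1) with 0 by ring. replace (PI * 1 + 0 * 0) with PI by ring.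
  rewrite exp_0, cos_PI. ring.
 - replace (PI * 0 - 0 * 1) with 0 by ring. replace (PI * 1 + 0 * 0) with PI by ring.
  rewrite exp_0, sin_PI. ring.
Qed.

Lemma norm_Cmod (z : C) : @norm R_AbsRing C_R_NormedModule z = Cmod z.
Proof. symmetry. apply Cmod_norm. Qed.

Lemma Cmod_le_sum (z : C) : Cmod z <= Rabs (Re z) + Rabs (Im z).
Proof.
 destruct z as [x y]. simpl.
 replace ((x, y) : C) with (x + y * Ci)%C by (apply C_eq; simpl; ring).
 eapply Rle_trans; [apply Cmod_triangle|].
 rewrite Cmod_mult, !Cmod_R, Cmod_Ci. lra.
Qed.

Lemma Re_le_Cmod (z : C) : Rabs (Re z) <= Cmod z.
Proof. eapply Rle_trans; [|apply Rmax_Cmod]. apply Rmax_l. Qed.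
Lemma Im_le_Cmod (z : C) : Rabs (Im z) <= Cmod z.
Proof. eapply Rle_trans; [|apply Rmax_Cmod]. apply Rmax_r. Qed.

(** * Integrals of complex functions of a real variable *)

Notation is_CI := (@is_RInt C_R_NormedModule).
Notation ex_CI := (@ex_RInt C_R_NormedModule).
Definition CI (f : R -> C) (a b : R) : C := @RInt C_R_CompleteNormedModule f a b.
Notation rcont := (@continuous R_UniformSpace C_R_NormedModule).

Lemma rcont_eps (f : R -> C) (x : R) :
 (forall eps, 0 < eps -> exists d, 0 < d /\ forall y, Rabs (y - x) < d ->
   Cmod (f y - f x)%C < eps) -> rcont f x.
Proof.
 intros H P [eps HP].
 destruct (H eps (cond_pos eps)) as (d & Hd & Hy).
 exists (mkposreal d Hd). intros y By. apply HP.
 specialize (Hy y By). split; simpl.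
 - eapply Rle_lt_trans; [|exact Hy]. apply (Re_le_Cmod (f y - f x)%C).
 - eapply Rle_lt_trans; [|exact Hy]. apply (Im_le_Cmod (f y - f x)%C).
Qed.

Lemma rcont_eps_inv (f : R -> C) (x : R) : rcont f x ->
 forall eps, 0 < eps -> exists d, 0 < d /\ forall y, Rabs (y - x) < d ->
   Cmod (f y - f x)%C < eps.
Proof.
 intros H eps He.
 destruct (H (ball (f x : C_R_NormedModule) (eps / 2))) as [d Hd].
 { exists (mkposreal (eps / 2) ltac:(lra)). auto. }
 exists d. split; [apply cond_pos|]. intros y Hy.
 destruct (Hd y Hy) as [H1 H2].
 eapply Rle_lt_trans; [apply Cmod_le_sum|].
 change (Rabs (Re (f y - f x)%C) < eps / 2) in H1.
 change (Rabs (Im (f y - f x)%C) < eps / 2) in H2. lra.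
Qed.

Lemma rcont_comp (F : C -> C) (g : R -> C) (x : R) :
 rcont g x -> Ccont F (g x) -> rcont (fun t => F (g t)) x.
Proof.
 intros Hg HF. apply rcont_eps. intros eps He.
 destruct (HF eps He) as (d & Hd & H).
 destruct (rcont_eps_inv _ _ Hg d Hd) as (d' & Hd' & H'). exists d'. auto.
Qed.

Lemma rcont_RtoC (x : R) : rcont RtoC x.
Proof.
 apply rcont_eps. intros eps He. exists eps. split; auto. intros y Hy.
 now rewrite <- RtoC_minus, Cmod_R.
Qed.

Lemma rcont_line (F : C -> C) (p d : C) (x : R) :
 Ccont F (p + d * x)%C -> rcont (fun t => F (p + d * t)%C) x.
Proof.
 intros H. apply (rcont_comp (fun z => F (p + d * z)%C) RtoC); [apply rcont_RtoC|].
 apply Ccont_comp; auto. apply Ccont_plus; [apply Ccont_const|].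
 apply Ccont_mult; [apply Ccont_const|apply Ccont_id].
Qed.

Lemma ex_CI_cont (f : R -> C) (a b : R) :
 (forall x, Rmin a b <= x <= Rmax a b -> rcont f x) -> ex_CI f a b.
Proof. intros H. now apply (@ex_RInt_continuous C_R_CompleteNormedModule). Qed.

Lemma is_CI_CI (f : R -> C) (a b : R) : ex_CI f a b -> is_CI f a b (CI f a b).
Proof. intros H. now apply (@RInt_correct C_R_CompleteNormedModule). Qed.

Lemma is_CI_unique (f : R -> C) (a b : R) (l : C) : is_CI f a b l -> CI f a b = l.
Proof. apply (@is_RInt_unique C_R_CompleteNormedModule). Qed.

Lemma is_CI_pair (f : R -> C) (a b : R) (l : C) :
 is_RInt (fun t => Re (f t)) a b (Re l) -> is_RInt (fun t => Im (f t)) a b (Im l) ->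
 is_CI f a b l.
Proof.
 intros H1 H2. rewrite (surjective_pairing l).
 now apply (@is_RInt_fct_extend_pair R_NormedModule R_NormedModule).
Qed.

Lemma is_CI_Re (f : R -> C) (a b : R) (l : C) :
 is_CI f a b l -> is_RInt (fun t => Re (f t)) a b (Re l).
Proof. apply (@is_RInt_fct_extend_fst R_NormedModule R_NormedModule). Qed.

Lemma is_CI_Im (f : R -> C) (a b : R) (l : C) :
 is_CI f a b l -> is_RInt (fun t => Im (f t)) a b (Im l).
Proof. apply (@is_RInt_fct_extend_snd R_NormedModule R_NormedModule). Qed.

Lemma is_CI_plus (f g : R -> C) (a b : R) (l m : C) :
 is_CI f a b l -> is_CI g a b m -> is_CI (fun t => f t + g t)%C a b (l + m)%C.
Proof. apply (@is_RInt_plus C_R_NormedModule). Qed.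

Lemma is_CI_scal (c : C) (f : R -> C) (a b : R) (l : C) :
 is_CI f a b l -> is_CI (fun t => c * f t)%C a b (c * l)%C.
Proof.
 intros H. assert (H1 := is_CI_Re _ _ _ _ H). assert (H2 := is_CI_Im _ _ _ _ H).
 apply is_CI_pair.
 - apply (@is_RInt_minus R_NormedModule);
   apply (@is_RInt_scal R_NormedModule); auto.
 - apply (@is_RInt_plus R_NormedModule);
   apply (@is_RInt_scal R_NormedModule); auto.
Qed.

Lemma is_CI_minus (f g : R -> C) (a b : R) (l m : C) :
 is_CI f a b l -> is_CI g a b m -> is_CI (fun t => f t - g t)%C a b (l - m)%C.
Proof. apply (@is_RInt_minus C_R_NormedModule). Qed.

Lemma is_CI_ext (f g : R -> C) (a b : R) (l : C) :
 (forall t, f t = g t) -> is_CI f a b l -> is_CI g a b l.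
Proof. intros E. apply is_RInt_ext. auto. Qed.

Lemma CI_ext (f g : R -> C) (a b : R) :
 (forall t, Rmin a b < t < Rmax a b -> f t = g t) -> CI f a b = CI g a b.
Proof. intros E. now apply (@RInt_ext C_R_CompleteNormedModule). Qed.

Lemma CI_scal (c : C) (f : R -> C) (a b : R) :
 ex_CI f a b -> CI (fun t => c * f t)%C a b = (c * CI f a b)%C.
Proof. intros H. apply is_CI_unique, is_CI_scal, is_CI_CI, H. Qed.

Lemma CI_plus (f g : R -> C) (a b : R) : ex_CI f a b -> ex_CI g a b ->
 CI (fun t => f t + g t)%C a b = (CI f a b + CI g a b)%C.
Proof. intros H H'. apply is_CI_unique, is_CI_plus; now apply is_CI_CI. Qed.

Lemma CI_Chasles (f : R -> C) (a b c : R) : ex_CI f a b -> ex_CI f b c ->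
 (CI f a b + CI f b c)%C = CI f a c.
Proof. apply (@RInt_Chasles C_R_CompleteNormedModule). Qed.

Lemma CI_bound (f : R -> C) (a b M : R) : a <= b -> ex_CI f a b ->
 (forall x, a <= x <= b -> Cmod (f x) <= M) -> Cmod (CI f a b) <= (b - a) * M.
Proof.
 intros Hab He H. rewrite <- norm_Cmod.
 apply (norm_RInt_le_const (V := C_R_NormedModule) f a b); auto.
 - intros x Hx. rewrite norm_Cmod. auto.
 - now apply is_CI_CI.
Qed.

Lemma is_CI_bound (f : R -> C) (g : R -> R) (a b : R) (l : C) (m : R) : a <= b ->
 is_CI f a b l -> is_RInt g a b m ->
 (forall x, a <= x <= b -> Cmod (f x) <= g x) -> Cmod l <= m.
Proof.
 intros Hab He Hg H. rewrite <- norm_Cmod.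
 apply (norm_RInt_le (V := C_R_NormedModule) f g a b); auto.
 intros x Hx. rewrite norm_Cmod. auto.
Qed.

Global Opaque CI.

Lemma is_CI_Cexp (h : C) :
 is_CI (fun t => h * Cexp (h * t))%C 0 1 (Cexp h - 1)%C.
Proof.
 destruct h as [x y].
 apply is_CI_pair; simpl.
 - replace (exp x * cos y + - (1)) with
   (minus (exp (x * 1) * cos (y * 1)) (exp (x * 0) * cos (y * 0))).
  2:{ unfold minus, plus, opp; simpl. rewrite !Rmult_1_r, !Rmult_0_r, exp_0, cos_0. ring. }
  apply (is_RInt_derive (fun t => exp (x * t) * cos (y * t))).
  + intros t _. auto_derive; auto. 
   replace (x * t - y * 0) with (x * t) by ring. 
   replace (x * 0 + y * t) with (y * t) by ring. ring.
  + intros t _. apply (@ex_derive_continuous R_AbsRing R_NormedModule). auto_derive; auto.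
 - replace (exp x * sin y + - 0) with
   (minus (exp (x * 1) * sin (y * 1)) (exp (x * 0) * sin (y * 0))).
  2:{ unfold minus, plus, opp; simpl. rewrite !Rmult_1_r, !Rmult_0_r, exp_0, sin_0. ring. }
  apply (is_RInt_derive (fun t => exp (x * t) * sin (y * t))).
  + intros t _. auto_derive; auto. 
   replace (x * t - y * 0) with (x * t) by ring. 
   replace (x * 0 + y * t) with (y * t) by ring. ring.
  + intros t _. apply (@ex_derive_continuous R_AbsRing R_NormedModule). auto_derive; auto.
Qed.

Lemma exp_le (x y : R) : x <= y -> exp x <= exp y.
Proof. intros [H| ->]; [left; now apply exp_increasing|lra]. Qed.

Lemma exp_mul_opp (x y : R) : x + y = 0 -> exp x * exp y = 1.
Proof. intros E. now rewrite <- exp_plus, E, exp_0. Qed.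

Lemma Re_le (z : C) : Re z <= Cmod z.
Proof. eapply Rle_trans; [apply Rle_abs|apply Re_le_Cmod]. Qed.

Lemma Re_mult_R (h : C) (t : R) : Re (h * t)%C = Re h * t.
Proof. apply re_scal_r. Qed.

Lemma Re_mult_le (h : C) (t : R) : 0 <= t <= 1 -> Re (h * t)%C <= Cmod h.
Proof.
 intros Ht. rewrite Re_mult_R. assert (H := Re_le h). assert (H' := Cmod_ge_0 h). nra.
Qed.

Lemma Cexp_bound1 (h : C) : Cmod (Cexp h - 1)%C <= Cmod h * exp (Cmod h).
Proof.
 rewrite <- (Rmult_1_l (Cmod h * _)). replace 1 with (1 - 0) at 2 by ring.
 rewrite <- (is_CI_unique _ _ _ _ (is_CI_Cexp h)).
 apply CI_bound; [lra|eexists; apply is_CI_Cexp|].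
 intros x Hx. rewrite Cmod_mult, Cmod_Cexp.
 apply Rmult_le_compat_l; [apply Cmod_ge_0|]. apply exp_le, Re_mult_le; lra.
Qed.

Lemma is_CI_const1 (h : C) : is_CI (fun _ => h) 0 1 h.
Proof.
 assert (H := @is_RInt_const C_R_NormedModule 0 1 h).
 rewrite Rminus_0_r in H.
 now rewrite (@scal_one R_AbsRing C_R_NormedModule) in H.
Qed.

Lemma Cexp_bound2 (h : C) : Cmod (Cexp h - 1 - h)%C <= Cmod h ^ 2 * exp (Cmod h).
Proof.
 rewrite <- (Rmult_1_l (Cmod h ^ 2 * _)). replace 1 with (1 - 0) at 2 by ring.
 assert (H : is_CI (fun t => h * Cexp (h * t) - h)%C 0 1 (Cexp h - 1 - h)%C).
 { apply is_CI_minus; [apply is_CI_Cexp|].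
  apply is_CI_const1. }
 rewrite <- (is_CI_unique _ _ _ _ H).
 apply CI_bound; [lra|eexists; apply H|].
 intros x Hx. replace (h * Cexp (h * x) - h)%C with (h * (Cexp (h * x) - 1))%C by ring.
 assert (B := Cexp_bound1 (h * x)%C).
 assert (N : Cmod (h * x)%C <= Cmod h).
 { rewrite Cmod_mult, Cmod_R, Rabs_pos_eq by lra. generalize (Cmod_ge_0 h). nra. }
 rewrite Cmod_mult. simpl. rewrite Rmult_1_r, Rmult_assoc.
 apply Rmult_le_compat_l; [apply Cmod_ge_0|].
 eapply Rle_trans; [apply B|]. apply Rmult_le_compat; auto; try apply Cmod_ge_0.
 - left; apply exp_pos.
 - now apply exp_le.
Qed.

Lemma cdiff_Cexp (z : C) : cdiff Cexp z (Cexp z).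
Proof.
 apply cdiff_eps. intros eps He.
 set (M := Cmod (Cexp z) * exp 1).
 assert (HM : 0 < M) by (apply Rmult_lt_0_compat; [apply Cmod_pos, Cexp_neq_0|apply exp_pos]).
 exists (Rmin 1 (eps / M)). split.
 { apply Rmin_glb_lt; [lra|now apply Rdiv_lt_0_compat]. }
 intros w Hw. set (h := (w - z)%C) in *.
 replace (Cexp w - Cexp z - h * Cexp z)%C with (Cexp z * (Cexp h - 1 - h))%C.
 2:{ replace w with (z + h)%C by (unfold h; ring). rewrite Cexp_plus. ring. }
 assert (H1 := Rlt_le_trans _ _ _ Hw (Rmin_l _ _)).
 assert (H2 := Rlt_le_trans _ _ _ Hw (Rmin_r _ _)).
 assert (B := Cexp_bound2 h). assert (P := Cmod_ge_0 h). assert (P' := Cmod_ge_0 (Cexp z)).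
 rewrite Cmod_mult.
 apply Rle_trans with (Cmod (Cexp z) * (Cmod h ^ 2 * exp 1)).
 - apply Rmult_le_compat_l; auto. eapply Rle_trans; [apply B|].
  apply Rmult_le_compat_l; [nra|]. apply exp_le; lra.
 - replace (Cmod (Cexp z) * (Cmod h ^ 2 * exp 1)) with (M * Cmod h * Cmod h) by (unfold M; ring).
  apply Rmult_le_compat_r; auto. 
  apply Rmult_lt_compat_l with (r := M) in H2; auto.
  replace (M * (eps / M)) with eps in H2 by (field; lra). lra.
Qed.

Lemma hol_Cexp (F : C -> C) (z : C) : hol F z -> hol (fun w => Cexp (F w)) z.
Proof. intros H. apply (hol_comp Cexp F); auto. eexists. apply cdiff_Cexp. Qed.

Lemma hol_Cpow (F : C -> C) (n : nat) (z : C) : hol F z -> hol (fun w => F w ^ n)%C z.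
Proof.
 intros H. induction n as [|n IH].
 - apply hol_ext with (fun _ => RtoC 1); [reflexivity|apply hol_const].
 - apply hol_ext with (fun w => F w * F w ^ n)%C; [reflexivity|now apply hol_mult].
Qed.

Ltac holo :=
 repeat first [ apply hol_const | apply hol_id | apply hol_Cexp | apply hol_Cpow
  | apply hol_minus | apply hol_plus | apply hol_opp | apply hol_div | apply hol_mult
  | apply hol_inv ].

(** * The fundamental theorem along a line *)

Lemma is_derive_line (F : C -> C) (p d : C) (x : R) (l : C) :
 cdiff F (p + d * x)%C l ->
 @is_derive R_AbsRing C_R_NormedModule (fun t => F (p + d * t)%C) x (d * l)%C.
Proof.
 intros H.
 assert (H1 : cdiff (fun z => F (p + d * z)%C) x (l * (0 + (0 * x + d * 1)))%C).
 { apply (cdiff_comp F (fun z => p + d * z)%C); auto.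
  apply cdiff_plus; [apply cdiff_const|]. apply cdiff_mult; [apply cdiff_const|apply cdiff_id]. }
 apply cdiff_eq with (l' := (d * l)%C) in H1; [|ring].
 split; [apply (@is_linear_scal_l R_AbsRing C_R_NormedModule)|].
 intros y Hy.
 assert (E : x = y) by exact (@is_filter_lim_locally_unique _ R_NormedModule _ _ Hy).
 subst y. intros eps.
 destruct (cdiff_eps_inv _ _ _ H1 eps (cond_pos eps)) as (r & Hr & Hw).
 exists (mkposreal r Hr). intros w Bw. specialize (Hw w).
 rewrite <- RtoC_minus, Cmod_R in Hw. specialize (Hw Bw).
 rewrite norm_Cmod.
 assert (Es : (RtoC (w - x) * (d * l))%C = @scal R_AbsRing C_R_NormedModule (w - x) (d * l)%C).
 { symmetry. apply scal_R_Cmult. }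
 rewrite Es in Hw. exact Hw.
Qed.

Lemma is_CI_derive_line (F F' : C -> C) (p d : C) (a b : R) :
 (forall x, Rmin a b <= x <= Rmax a b -> cdiff F (p + d * x)%C (F' (p + d * x)%C)) ->
 (forall x, Rmin a b <= x <= Rmax a b -> Ccont F' (p + d * x)%C) ->
 is_CI (fun t => d * F' (p + d * t))%C a b (F (p + d * b) - F (p + d * a))%C.
Proof.
 intros H1 H2.
 apply (@is_RInt_derive C_R_CompleteNormedModule (fun t => F (p + d * t)%C)).
 - intros x Hx. apply is_derive_line. auto.
 - intros x Hx. apply (rcont_line (fun z => d * F' z)%C).
  apply Ccont_mult; [apply Ccont_const|auto].
Qed.

(** * Goursat's theorem on rectangles *)

Lemma C_hor (x y : R) : ((x, y) : C) = ((0, y) + 1 * x)%C.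
Proof. apply C_eq; simpl; ring. Qed.
Lemma C_ver (x y : R) : ((x, y) : C) = ((x, 0) + Ci * y)%C.
Proof. apply C_eq; simpl; ring. Qed.

Lemma rcont_hor (f : C -> C) (x y : R) : Ccont f (x, y) -> rcont (fun t => f (t, y)) x.
Proof.
 intros H. apply (continuous_ext (fun t => f ((0, y) + 1 * RtoC t)%C)).
 { intros t. now rewrite <- C_hor. }
 apply rcont_line. now rewrite <- C_hor.
Qed.

Lemma rcont_ver (f : C -> C) (x y : R) : Ccont f (x, y) -> rcont (fun t => f (x, t)) y.
Proof.
 intros H. apply (continuous_ext (fun t => f ((x, 0) + Ci * RtoC t)%C)).
 { intros t. now rewrite <- C_ver. }
 apply rcont_line. now rewrite <- C_ver.
Qed.

Definition bnd (f : C -> C) (x1 x2 y1 y2 : R) : C :=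
 (CI (fun x => f (x, y1)) x1 x2 + Ci * CI (fun y => f (x2, y)) y1 y2
  - CI (fun x => f (x, y2)) x1 x2 - Ci * CI (fun y => f (x1, y)) y1 y2)%C.

Definition on_rect (P : C -> Prop) (x1 x2 y1 y2 : R) : Prop :=
 forall z, x1 <= Re z <= x2 -> y1 <= Im z <= y2 -> P z.

Lemma on_rect_sub P x1 x2 y1 y2 x1' x2' y1' y2' :
 x1 <= x1' -> x2' <= x2 -> y1 <= y1' -> y2' <= y2 ->
 on_rect P x1 x2 y1 y2 -> on_rect P x1' x2' y1' y2'.
Proof. intros ? ? ? ? H z Hx Hy. apply H; lra. Qed.

Lemma ex_CI_hor f x1 x2 y1 y2 y : on_rect (Ccont f) x1 x2 y1 y2 -> x1 <= x2 -> y1 <= y <= y2 ->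
 ex_CI (fun x => f (x, y)) x1 x2.
Proof.
 intros H Hx Hy. apply ex_CI_cont. intros x. rewrite Rmin_left, Rmax_right by lra.
 intros H'. apply rcont_hor. now apply H.
Qed.

Lemma ex_CI_ver f x1 x2 y1 y2 x : on_rect (Ccont f) x1 x2 y1 y2 -> x1 <= x <= x2 -> y1 <= y2 ->
 ex_CI (fun y => f (x, y)) y1 y2.
Proof.
 intros H Hx Hy. apply ex_CI_cont. intros y. rewrite Rmin_left, Rmax_right by lra.
 intros H'. apply rcont_ver. now apply H.
Qed.

Lemma bnd_split_x f x1 xm x2 y1 y2 : on_rect (Ccont f) x1 x2 y1 y2 ->
 x1 <= xm <= x2 -> y1 <= y2 ->
 bnd f x1 x2 y1 y2 = (bnd f x1 xm y1 y2 + bnd f xm x2 y1 y2)%C.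
Proof.
 intros H Hx Hy. unfold bnd.
 assert (H1 : on_rect (Ccont f) x1 xm y1 y2) by (eapply on_rect_sub; [..|apply H]; lra).
 assert (H2 : on_rect (Ccont f) xm x2 y1 y2) by (eapply on_rect_sub; [..|apply H]; lra).
 rewrite <- (CI_Chasles (fun x => f (x, y1)) x1 xm x2)
  by (eapply ex_CI_hor; eauto; lra).
 rewrite <- (CI_Chasles (fun x => f (x, y2)) x1 xm x2)
  by (eapply ex_CI_hor; eauto; lra).
 ring.
Qed.

Lemma bnd_split_y f x1 x2 y1 ym y2 : on_rect (Ccont f) x1 x2 y1 y2 ->
 x1 <= x2 -> y1 <= ym <= y2 ->
 bnd f x1 x2 y1 y2 = (bnd f x1 x2 y1 ym + bnd f x1 x2 ym y2)%C.
Proof.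
 intros H Hx Hy. unfold bnd.
 assert (H1 : on_rect (Ccont f) x1 x2 y1 ym) by (eapply on_rect_sub; [..|apply H]; lra).
 assert (H2 : on_rect (Ccont f) x1 x2 ym y2) by (eapply on_rect_sub; [..|apply H]; lra).
 rewrite <- (CI_Chasles (fun y => f (x1, y)) y1 ym y2)
  by (eapply ex_CI_ver; eauto; lra).
 rewrite <- (CI_Chasles (fun y => f (x2, y)) y1 ym y2)
  by (eapply ex_CI_ver; eauto; lra).
 ring.
Qed.

Definition on_bd (P : C -> Prop) (x1 x2 y1 y2 : R) : Prop :=
 forall z, x1 <= Re z <= x2 -> y1 <= Im z <= y2 ->
  Re z = x1 \/ Re z = x2 \/ Im z = y1 \/ Im z = y2 -> P z.

Lemma on_rect_bd P x1 x2 y1 y2 : on_rect P x1 x2 y1 y2 -> on_bd P x1 x2 y1 y2.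
Proof. intros H z A B _. auto. Qed.

Lemma ex_CI_bd_hor f x1 x2 y1 y2 y : on_bd (Ccont f) x1 x2 y1 y2 -> x1 <= x2 -> y1 <= y2 ->
 y = y1 \/ y = y2 -> ex_CI (fun x => f (x, y)) x1 x2.
Proof.
 intros H Hx Hy E. apply ex_CI_cont. intros x. rewrite Rmin_left, Rmax_right by lra.
 intros H'. apply rcont_hor. apply H; simpl; lra.
Qed.

Lemma ex_CI_bd_ver f x1 x2 y1 y2 x : on_bd (Ccont f) x1 x2 y1 y2 -> x1 <= x2 -> y1 <= y2 ->
 x = x1 \/ x = x2 -> ex_CI (fun y => f (x, y)) y1 y2.
Proof.
 intros H Hx Hy E. apply ex_CI_cont. intros y. rewrite Rmin_left, Rmax_right by lra.
 intros H'. apply rcont_ver. apply H; simpl; lra.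
Qed.

Lemma bnd_bound f x1 x2 y1 y2 M : on_bd (Ccont f) x1 x2 y1 y2 -> x1 <= x2 -> y1 <= y2 ->
 on_bd (fun z => Cmod (f z) <= M) x1 x2 y1 y2 ->
 Cmod (bnd f x1 x2 y1 y2) <= 2 * ((x2 - x1) + (y2 - y1)) * M.
Proof.
 intros H Hx Hy HM. unfold bnd.
 eapply Rle_trans; [apply Cmod_triangle_minus|].
 eapply Rle_trans; [apply Rplus_le_compat_r, Cmod_triangle_minus|].
 eapply Rle_trans; [apply Rplus_le_compat_r, Rplus_le_compat_r, Cmod_triangle|].
 rewrite !Cmod_mult, Cmod_Ci.
 assert (A : forall y, y = y1 \/ y = y2 ->
  Cmod (CI (fun x => f (x, y)) x1 x2) <= (x2 - x1) * M).
 { intros y E. apply CI_bound; auto; [apply (ex_CI_bd_hor f x1 x2 y1 y2); auto|].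
  intros; apply HM; simpl; lra. }
 assert (B : forall x, x = x1 \/ x = x2 ->
  Cmod (CI (fun y => f (x, y)) y1 y2) <= (y2 - y1) * M).
 { intros x E. apply CI_bound; auto; [apply (ex_CI_bd_ver f x1 x2 y1 y2); auto|].
  intros; apply HM; simpl; lra. }
 assert (A1 := A y1 ltac:(auto)). assert (A2 := A y2 ltac:(auto)).
 assert (B1 := B x1 ltac:(auto)). assert (B2 := B x2 ltac:(auto)).
 lra.
Qed.

Lemma bnd_plus f g x1 x2 y1 y2 : on_bd (Ccont f) x1 x2 y1 y2 ->
 on_bd (Ccont g) x1 x2 y1 y2 -> x1 <= x2 -> y1 <= y2 ->
 bnd (fun z => f z + g z)%C x1 x2 y1 y2 = (bnd f x1 x2 y1 y2 + bnd g x1 x2 y1 y2)%C.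
Proof.
 intros Hf Hg Hx Hy. unfold bnd.
 rewrite (CI_plus (fun x => f (x, y1)) (fun x => g (x, y1))),
  (CI_plus (fun x => f (x, y2)) (fun x => g (x, y2))),
  (CI_plus (fun y => f (x1, y)) (fun y => g (x1, y))),
  (CI_plus (fun y => f (x2, y)) (fun y => g (x2, y))); [ring|..].
 - apply (ex_CI_bd_ver f x1 x2 y1 y2 x2); auto.
 - apply (ex_CI_bd_ver g x1 x2 y1 y2 x2); auto.
 - apply (ex_CI_bd_ver f x1 x2 y1 y2 x1); auto.
 - apply (ex_CI_bd_ver g x1 x2 y1 y2 x1); auto.
 - apply (ex_CI_bd_hor f x1 x2 y1 y2 y2); auto.
 - apply (ex_CI_bd_hor g x1 x2 y1 y2 y2); auto.
 - apply (ex_CI_bd_hor f x1 x2 y1 y2 y1); auto.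
 - apply (ex_CI_bd_hor g x1 x2 y1 y2 y1); auto.
Qed.

Lemma bnd_scal c f x1 x2 y1 y2 : on_bd (Ccont f) x1 x2 y1 y2 -> x1 <= x2 -> y1 <= y2 ->
 bnd (fun z => c * f z)%C x1 x2 y1 y2 = (c * bnd f x1 x2 y1 y2)%C.
Proof.
 intros Hf Hx Hy. unfold bnd.
 rewrite (CI_scal c (fun x => f (x, y1))), (CI_scal c (fun x => f (x, y2))),
  (CI_scal c (fun y => f (x1, y))), (CI_scal c (fun y => f (x2, y))); [ring|..].
 - apply (ex_CI_bd_ver f x1 x2 y1 y2 x2); auto.
 - apply (ex_CI_bd_ver f x1 x2 y1 y2 x1); auto.
 - apply (ex_CI_bd_hor f x1 x2 y1 y2 y2); auto.
 - apply (ex_CI_bd_hor f x1 x2 y1 y2 y1); auto.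
Qed.

Lemma bnd_ext f g x1 x2 y1 y2 : x1 <= x2 -> y1 <= y2 ->
 on_bd (fun z => f z = g z) x1 x2 y1 y2 ->
 bnd f x1 x2 y1 y2 = bnd g x1 x2 y1 y2.
Proof.
 intros Hx Hy E.
 assert (Eh : forall y, y = y1 \/ y = y2 ->
  CI (fun x => f (x, y)) x1 x2 = CI (fun x => g (x, y)) x1 x2).
 { intros y Ey. apply CI_ext. intros t. rewrite Rmin_left, Rmax_right by lra.
  intros Ht. apply E; simpl; lra. }
 assert (Ev : forall x, x = x1 \/ x = x2 ->
  CI (fun y => f (x, y)) y1 y2 = CI (fun y => g (x, y)) y1 y2).
 { intros x Ex. apply CI_ext. intros t. rewrite Rmin_left, Rmax_right by lra.
  intros Ht. apply E; simpl; lra. }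
 unfold bnd. rewrite (Eh y1), (Eh y2), (Ev x1), (Ev x2) by auto. reflexivity.
Qed.

Lemma bnd_primitive (F f : C -> C) x1 x2 y1 y2 : x1 <= x2 -> y1 <= y2 ->
 on_rect (fun z => cdiff F z (f z)) x1 x2 y1 y2 -> on_rect (Ccont f) x1 x2 y1 y2 ->
 bnd f x1 x2 y1 y2 = 0.
Proof.
 intros Hx Hy HF Hf.
 assert (Hh : forall y, y1 <= y <= y2 ->
  CI (fun x => f (x, y)) x1 x2 = (F (x2, y) - F (x1, y))%C).
 { intros y Hy'. apply is_CI_unique. rewrite (C_hor x2), (C_hor x1).
  apply is_CI_ext with (fun t => 1 * f ((0, y) + 1 * t))%C.
  { intros t. rewrite <- C_hor. ring. }
  apply is_CI_derive_line; intros x; rewrite Rmin_left, Rmax_right by lra;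
   intros; rewrite <- C_hor; [apply HF|apply Hf]; simpl; lra. }
 assert (Hv : forall x, x1 <= x <= x2 ->
  (Ci * CI (fun y => f (x, y)) y1 y2 = F (x, y2) - F (x, y1))%C).
 { intros x Hx'. rewrite <- CI_scal by (eapply ex_CI_ver; eauto; lra).
  apply is_CI_unique. rewrite (C_ver x y2), (C_ver x y1).
  apply is_CI_ext with (fun t => Ci * f ((x, 0) + Ci * t))%C.
  { intros t. now rewrite <- C_ver. }
  apply is_CI_derive_line; intros y; rewrite Rmin_left, Rmax_right by lra;
   intros; rewrite <- C_ver; [apply HF|apply Hf]; simpl; lra. }
 unfold bnd. rewrite !Hh, !Hv by lra. ring.
Qed.

Lemma bnd_affine a b x1 x2 y1 y2 : x1 <= x2 -> y1 <= y2 ->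
 bnd (fun z => a + b * z)%C x1 x2 y1 y2 = 0.
Proof.
 intros Hx Hy. apply bnd_primitive with (fun z => a * z + b * (z * z * RtoC (/ 2)))%C; auto.
 - intros z _ _. eapply cdiff_eq.
  2:{ apply cdiff_plus; [apply cdiff_mult; [apply cdiff_const|apply cdiff_id]|].
    apply cdiff_mult; [apply cdiff_const|]. apply cdiff_mult; [|apply cdiff_const].
    apply cdiff_mult; apply cdiff_id. }
  apply C_eq; destruct a, b, z; unfold Re, Im; simpl; field.
 - intros z _ _. apply hol_cont. holo.
Qed.

Lemma nested_intervals (a b : nat -> R) :
 (forall n, a n <= a (S n)) -> (forall n, b (S n) <= b n) -> (forall n, a n <= b n) ->
 exists c, forall n, a n <= c <= b n.
Proof.
 intros Ha Hb Hab.
 assert (Ha' : forall n k, a n <= a (n + k)%nat).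
 { intros n k. induction k as [|k IH]; [rewrite Nat.add_0_r; lra|].
  rewrite Nat.add_succ_r. eapply Rle_trans; [apply IH|apply Ha]. }
 assert (Hb' : forall n k, b (n + k)%nat <= b n).
 { intros n k. induction k as [|k IH]; [rewrite Nat.add_0_r; lra|].
  rewrite Nat.add_succ_r. eapply Rle_trans; [apply Hb|apply IH]. }
 assert (H : forall m n, a m <= b n).
 { intros m n. eapply Rle_trans; [apply (Ha' m n)|].
  eapply Rle_trans; [apply Hab|]. rewrite Nat.add_comm. apply Hb'. }
 destruct (completeness (fun x => exists n, x = a n)) as [c [H1 H2]].
 - exists (b 0%nat). intros x [n ->]. apply H.
 - exists (a 0%nat), 0%nat. auto.
 - exists c. intros n. split; [apply H1; eauto|].
  apply H2. intros x [m ->]. apply H.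
Qed.

Definition quad : Type := (R * R * (R * R))%type.
Definition bndq (f : C -> C) (r : quad) : C :=
 bnd f (fst (fst r)) (snd (fst r)) (fst (snd r)) (snd (snd r)).
Definition mid (x y : R) : R := (x + y) / 2.

Definition bisect_x (f : C -> C) (r : quad) : quad :=
 let l := (fst (fst r), mid (fst (fst r)) (snd (fst r)), snd r) in
 if Rle_dec (Cmod (bndq f r) / 2) (Cmod (bndq f l)) then l
 else (mid (fst (fst r)) (snd (fst r)), snd (fst r), snd r).

Definition bisect_y (f : C -> C) (r : quad) : quad :=
 let l := (fst r, (fst (snd r), mid (fst (snd r)) (snd (snd r)))) in
 if Rle_dec (Cmod (bndq f r) / 2) (Cmod (bndq f l)) then l
 else (fst r, (mid (fst (snd r)) (snd (snd r)), snd (snd r))).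

Definition bisect (f : C -> C) (r : quad) : quad := bisect_y f (bisect_x f r).

Definition good_quad (f : C -> C) (r : quad) : Prop :=
 fst (fst r) <= snd (fst r) /\ fst (snd r) <= snd (snd r) /\
 on_rect (Ccont f) (fst (fst r)) (snd (fst r)) (fst (snd r)) (snd (snd r)).

Lemma bisect_spec f r : good_quad f r ->
 let r' := bisect f r in
 good_quad f r' /\ Cmod (bndq f r) / 4 <= Cmod (bndq f r') /\
 snd (fst r') - fst (fst r') = (snd (fst r) - fst (fst r)) / 2 /\
 snd (snd r') - fst (snd r') = (snd (snd r) - fst (snd r)) / 2 /\
 fst (fst r) <= fst (fst r') /\ snd (fst r') <= snd (fst r) /\
 fst (snd r) <= fst (snd r') /\ snd (snd r') <= snd (snd r).
Proof.
 intros Hr.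
 assert (Hx : let q := bisect_x f r in good_quad f q /\
  Cmod (bndq f r) / 2 <= Cmod (bndq f q) /\
  snd (fst q) - fst (fst q) = (snd (fst r) - fst (fst r)) / 2 /\ snd q = snd r /\
  fst (fst r) <= fst (fst q) /\ snd (fst q) <= snd (fst r)).
 { destruct r as [[x1 x2] [y1 y2]]. destruct Hr as (h1 & h2 & h3). simpl in *.
  assert (S := bnd_split_x f x1 (mid x1 x2) x2 y1 y2 h3 ltac:(unfold mid; lra) h2).
  assert (T := Cmod_triangle (bnd f x1 (mid x1 x2) y1 y2) (bnd f (mid x1 x2) x2 y1 y2)).
  rewrite <- S in T.
  unfold bisect_x, bndq, good_quad; simpl.
  destruct Rle_dec as [L|L]; simpl; unfold mid in *;
   (split; [split; [lra|split; [lra|]]; eapply on_rect_sub; [..|apply h3]; lra|];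
   repeat split; lra). }
 simpl in *. destruct Hx as (Hq & B1 & L1 & E1 & I1 & I2).
 unfold bisect. set (q := bisect_x f r) in *. clearbody q.
 rewrite <- E1. clear E1.
 destruct q as [[x1 x2] [y1 y2]]. destruct Hq as (h1 & h2 & h3). simpl in *.
 assert (S := bnd_split_y f x1 x2 y1 (mid y1 y2) y2 h3 h1 ltac:(unfold mid; lra)).
 assert (T := Cmod_triangle (bnd f x1 x2 y1 (mid y1 y2)) (bnd f x1 x2 (mid y1 y2) y2)).
 rewrite <- S in T.
 unfold bisect_y, good_quad. unfold bndq in *; simpl in *.
 destruct Rle_dec as [L|L]; simpl; unfold mid in *;
   (split; [split; [lra|split; [lra|]]; eapply on_rect_sub; [..|apply h3]; lra|];
   repeat split; lra).
Qed.

Lemma goursat f x1 x2 y1 y2 : x1 <= x2 -> y1 <= y2 ->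
 on_rect (hol f) x1 x2 y1 y2 -> bnd f x1 x2 y1 y2 = 0.
Proof.
 intros Hx Hy Hf.
 set (r := fun n => Nat.iter n (bisect f) ((x1, x2), (y1, y2))).
 assert (Hc : on_rect (Ccont f) x1 x2 y1 y2) by (intros z A B; apply hol_cont, Hf; auto).
 assert (G : forall n, good_quad f (r n)).
 { induction n as [|n IH]; [repeat split; auto|]. now apply (bisect_spec f (r n)). }
 assert (Sp := fun n => bisect_spec f (r n) (G n)). simpl in Sp.
 change (forall n, good_quad f (r (S n)) /\
   Cmod (bndq f (r n)) / 4 <= Cmod (bndq f (r (S n))) /\
   snd (fst (r (S n))) - fst (fst (r (S n))) = (snd (fst (r n)) - fst (fst (r n))) / 2 /\
   snd (snd (r (S n))) - fst (snd (r (S n))) = (snd (snd (r n)) - fst (snd (r n))) / 2 /\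
   fst (fst (r n)) <= fst (fst (r (S n))) /\ snd (fst (r (S n))) <= snd (fst (r n)) /\
   fst (snd (r n)) <= fst (snd (r (S n))) /\ snd (snd (r (S n))) <= snd (snd (r n))) in Sp.
 assert (Lx : forall n, snd (fst (r n)) - fst (fst (r n)) = (x2 - x1) * (/ 2) ^ n).
 { induction n as [|n IH]; [simpl; ring|].
  destruct (Sp n) as (_ & _ & E & _). rewrite E, IH. simpl. field. }
 assert (Ly : forall n, snd (snd (r n)) - fst (snd (r n)) = (y2 - y1) * (/ 2) ^ n).
 { induction n as [|n IH]; [simpl; ring|].
  destruct (Sp n) as (_ & _ & _ & E & _). rewrite E, IH. simpl. field. }
 assert (LB : forall n, Cmod (bnd f x1 x2 y1 y2) * (/ 4) ^ n <= Cmod (bndq f (r n))).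
 { induction n as [|n IH]; [simpl; unfold bndq; simpl; lra|].
  destruct (Sp n) as (_ & E & _). rewrite <- tech_pow_Rmult. lra. }
 destruct (nested_intervals (fun n => fst (fst (r n))) (fun n => snd (fst (r n)))) as [px Hpx];
  [intros n; apply (Sp n)..|intros n; apply (G n)|].
 destruct (nested_intervals (fun n => fst (snd (r n))) (fun n => snd (snd (r n)))) as [py Hpy];
  [intros n; apply (Sp n)..|intros n; apply (G n)|].
 destruct (Hf (px, py) (Hpx 0%nat) (Hpy 0%nat)) as [l Hl].
 assert (HB : forall eps, 0 < eps ->
  Cmod (bnd f x1 x2 y1 y2) <= 2 * ((x2 - x1) + (y2 - y1)) ^ 2 * eps).
 { intros eps He.
  destruct (cdiff_eps_inv _ _ _ Hl eps He) as (d & Hd & Hw).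
  set (s := (x2 - x1) + (y2 - y1)).
  assert (Hs : 0 <= s) by (unfold s; lra).
  assert (Hlim : is_lim_seq (fun n => s * (/ 2) ^ n) 0).
  { replace (Finite 0) with (Rbar_mult s 0) by (simpl; f_equal; ring).
   apply is_lim_seq_scal_l. apply is_lim_seq_geom. rewrite Rabs_pos_eq; lra. }
  apply is_lim_seq_spec in Hlim. destruct (Hlim (mkposreal d Hd)) as [N HN].
  specialize (HN N (le_n _)). simpl in HN. rewrite Rminus_0_r in HN.
  assert (P2 : 0 < (/ 2) ^ N) by (apply pow_lt; lra).
  rewrite Rabs_pos_eq in HN by nra.
  destruct (G N) as (g1 & g2 & g3). specialize (LB N). specialize (Lx N). specialize (Ly N).
  specialize (Hpx N). specialize (Hpy N). simpl in Hpx, Hpy.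
  unfold bndq in LB. destruct (r N) as [[a1 a2] [b1 b2]]. simpl in *.
  assert (Hm : forall z, a1 <= Re z <= a2 -> b1 <= Im z <= b2 ->
   Cmod (z - (px, py))%C <= s * (/2) ^ N).
  { intros [zx zy] A B. simpl in A, B. eapply Rle_trans; [apply Cmod_le_sum|]. simpl.
   unfold s. rewrite Rmult_plus_distr_r, <- Lx, <- Ly.
   apply Rplus_le_compat; apply Rabs_le; lra. }
  set (g := fun z : C => (f z - f (px, py) - (z - (px, py)) * l)%C).
  assert (Eb : bnd f a1 a2 b1 b2 = bnd g a1 a2 b1 b2).
  { transitivity (bnd (fun z => g z + ((f (px, py) - (px, py) * l) + l * z))%C a1 a2 b1 b2).
   - apply bnd_ext; auto. intros z _ _ _; unfold g; ring.
   - rewrite bnd_plus; auto; [rewrite bnd_affine by auto; ring| |].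
    + intros z A B _. unfold g. apply Ccont_plus.
     * apply (Ccont_plus f (fun _ => - f (px, py))%C); [now apply g3|apply Ccont_const].
     * apply hol_cont. holo.
    + intros z A B _. apply hol_cont. holo. }
  rewrite Eb in LB.
  assert (B : Cmod (bnd g a1 a2 b1 b2) <= 2 * ((a2 - a1) + (b2 - b1)) * (eps * (s * (/2)^N))).
  { apply bnd_bound; auto.
   - intros z A B _. unfold g. apply Ccont_plus.
     * apply (Ccont_plus f (fun _ => - f (px, py))%C); [now apply g3|apply Ccont_const].
     * apply hol_cont. holo.
   - intros z A B _. specialize (Hm z A B). eapply Rle_trans; [apply Hw; lra|].
    apply Rmult_le_compat_l; lra. }
  rewrite Lx, Ly in B.
  replace (2 * ((x2 - x1) * (/ 2) ^ N + (y2 - y1) * (/ 2) ^ N) * (eps * (s * (/ 2) ^ N)))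
   with ((2 * s ^ 2 * eps) * ((/ 2) ^ N * (/2) ^ N)) in B by (unfold s; ring).
  rewrite <- Rpow_mult_distr in B. replace (/ 2 * / 2) with (/ 4) in B by field.
  apply Rmult_le_reg_r with ((/ 4) ^ N); [apply pow_lt; lra|]. lra. }
 now apply (Cmod_small_0 _ (2 * ((x2 - x1) + (y2 - y1)) ^ 2)).
Qed.

Lemma goursat_puncture f x1 x2 y1 y2 p : x1 < Re p < x2 -> y1 < Im p < y2 ->
 on_rect (Ccont f) x1 x2 y1 y2 -> on_rect (fun z => z <> p -> hol f z) x1 x2 y1 y2 ->
 bnd f x1 x2 y1 y2 = 0.
Proof.
 intros Hx Hy Hc Hf. destruct p as [px py]. simpl in Hx, Hy.
 assert (NE : forall z : C, Re z <> px \/ Im z <> py -> z <> (px, py)).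
 { intros z N E. subst z. simpl in N. tauto. }
 assert (Hmin : forall p q r, 0 < p -> 0 < q -> 0 < r ->
  exists d, 0 < d /\ d < p /\ d < q /\ 2 * d < r).
 { intros p q r Hp Hq Hr. exists (Rmin p (Rmin q r) / 3).
  assert (H1 := Rmin_l p (Rmin q r)). assert (H2 := Rmin_r p (Rmin q r)).
  assert (H3 := Rmin_l q r). assert (H4 := Rmin_r q r).
  assert (0 < Rmin p (Rmin q r)) by (repeat apply Rmin_glb_lt; lra). lra. }
 assert (Hsmall : forall d, 0 < d -> d < px - x1 -> d < x2 - px -> d < py - y1 -> d < y2 - py ->
  bnd f x1 x2 y1 y2 = bnd f (px - d) (px + d) (py - d) (py + d)).
 { intros d Hd D1 D2 D3 D4.
  rewrite (bnd_split_x f x1 (px - d) x2) by (auto; lra).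
  rewrite (bnd_split_x f (px - d) (px + d) x2) by
   (first [lra|eapply on_rect_sub; [..|apply Hc]; lra]).
  rewrite (bnd_split_y f (px - d) (px + d) y1 (py - d) y2) by
   (first [lra|eapply on_rect_sub; [..|apply Hc]; lra]).
  rewrite (bnd_split_y f (px - d) (px + d) (py - d) (py + d) y2) by
   (first [lra|eapply on_rect_sub; [..|apply Hc]; lra]).
  rewrite (goursat f x1 (px - d)), (goursat f (px + d) x2),
   (goursat f (px - d) (px + d) y1), (goursat f (px - d) (px + d) (py + d) y2);
   try lra; try ring.
  all: intros z A B; apply Hf; try lra; apply NE; lra. }
 destruct (Hc (px, py) ltac:(simpl; lra) ltac:(simpl; lra) 1) as (d0 & Hd0 & Hw); [lra|].
 set (M := Cmod (f (px, py)) + 1).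
 assert (HM : 0 < M) by (unfold M; generalize (Cmod_ge_0 (f (px, py))); lra).
 apply (Cmod_small_0 _ (8 * M)). intros e He.
 destruct (Hmin (Rmin (px - x1) (x2 - px)) (Rmin (py - y1) (y2 - py)) (Rmin d0 e))
  as (d & D0 & Dm1 & Dm2 & Dm3); try (apply Rmin_glb_lt; lra).
 assert (m1 := Rmin_l (px - x1) (x2 - px)). assert (m2 := Rmin_r (px - x1) (x2 - px)).
 assert (m3 := Rmin_l (py - y1) (y2 - py)). assert (m4 := Rmin_r (py - y1) (y2 - py)).
 assert (m5 := Rmin_l d0 e). assert (m6 := Rmin_r d0 e).
 rewrite (Hsmall d) by lra.
 eapply Rle_trans; [apply bnd_bound with (M := M); try lra|].
 - apply on_rect_bd. eapply on_rect_sub; [..|apply Hc]; lra.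
 - intros z A B _. unfold M.
  assert (Hz : Cmod (z - (px, py))%C < d0).
  { eapply Rle_lt_trans; [apply Cmod_le_sum|].
   destruct z as [zx zy]; simpl in *.
   assert (Rabs (zx + - px) <= d) by (apply Rabs_le; lra).
   assert (Rabs (zy + - py) <= d) by (apply Rabs_le; lra). lra. }
  specialize (Hw z Hz). assert (T := Cmod_triangle_rev (f z) (f (px, py))). lra.
 - nra.
Qed.

(** * Cauchy's formula and uniqueness of analytic continuation *)

Lemma Cminus_neq_0 (z p : C) : Re z <> Re p \/ Im z <> Im p -> (z - p)%C <> 0.
Proof. intros N E. apply Ceq_minus in E. subst. tauto. Qed.

Lemma cauchy_rect f x1 x2 y1 y2 p : x1 < Re p < x2 -> y1 < Im p < y2 ->
 on_rect (hol f) x1 x2 y1 y2 ->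
 bnd (fun z => f z / (z - p))%C x1 x2 y1 y2 = (f p * bnd (fun z => / (z - p))%C x1 x2 y1 y2)%C.
Proof.
 intros Hx Hy Hf.
 destruct (Hf p) as (l & phi & Hc & Hl & E); try lra.
 assert (NE : on_bd (fun z => (z - p)%C <> 0) x1 x2 y1 y2).
 { intros z A B D. apply Cminus_neq_0. lra. }
 assert (Cb : on_bd (Ccont (fun z => / (z - p))%C) x1 x2 y1 y2).
 { intros z A B D. apply hol_cont. holo. now apply NE. }
 assert (Hphi : on_rect (fun z => z <> p -> hol phi z) x1 x2 y1 y2).
 { intros z A B N.
  apply hol_ext_loc with (fun w => (f w - f p) / (w - p))%C (Cmod (z - p)%C).
  - apply Cmod_pos. now apply Cminus_eq_contra.
  - intros w Hw. rewrite (E w). field. intros E0. apply Ceq_minus in E0. subst w.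
   rewrite Cmod_sym in Hw. lra.
  - holo; [now apply Cminus_eq_contra|now apply Hf]. }
 assert (Cphi : on_rect (Ccont phi) x1 x2 y1 y2).
 { intros z A B. destruct (Ceq_dec z p) as [->|N]; auto. apply hol_cont. now apply Hphi. }
 rewrite (bnd_ext _ (fun z => phi z + f p * / (z - p))%C); try lra.
 - rewrite bnd_plus, bnd_scal, (goursat_puncture phi) with (p := p); auto; try lra; try ring.
  + apply on_rect_bd, Cphi.
  + intros z A B D. apply Ccont_mult; [apply Ccont_const|now apply Cb].
 - intros z A B D. rewrite (E z). field. now apply NE.
Qed.

Lemma Im_Cinv (z : C) : Im (/ z)%C = - Im z / (Re z ^ 2 + Im z ^ 2).
Proof. destruct z; reflexivity. Qed.
Lemma Re_Cinv (z : C) : Re (/ z)%C = Re z / (Re z ^ 2 + Im z ^ 2).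
Proof. destruct z; reflexivity. Qed.

Lemma Im_CI_pos (c : C) (f : R -> C) (t0 d e a b : R) : a < b -> 0 < e -> d <> 0 ->
 (forall t, rcont f t) -> (forall t, Im (c * f t)%C = e / ((t - t0) ^ 2 + d ^ 2)) ->
 0 < Im (c * CI f a b)%C.
Proof.
 intros Hab He Hd Hc E.
 assert (P : forall t, 0 < (t - t0) ^ 2 + d ^ 2).
 { intros t. generalize (pow2_ge_0 (t - t0)), (pow2_gt_0 d Hd). lra. }
 assert (Ex : ex_CI f a b) by (apply ex_CI_cont; auto).
 rewrite <- (is_RInt_unique _ _ _ _ (is_CI_Im _ _ _ _ (is_CI_scal c _ _ _ _ (is_CI_CI _ _ _ Ex)))).
 rewrite (RInt_ext _ (fun t => e / ((t - t0) ^ 2 + d ^ 2))) by auto.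
 apply RInt_gt_0; auto.
 - intros t _. now apply Rdiv_lt_0_compat.
 - intros t _. apply (@ex_derive_continuous R_AbsRing R_NormedModule). auto_derive.
  specialize (P t). intro Z. simpl in P. unfold Rminus in P. lra.
Qed.

Lemma winding_neq_0 x1 x2 y1 y2 p : x1 < Re p < x2 -> y1 < Im p < y2 ->
 bnd (fun z => / (z - p))%C x1 x2 y1 y2 <> 0.
Proof.
 intros Hx Hy E. destruct p as [a b]; simpl in Hx, Hy.
 set (f := fun z => (/ (z - (a, b)))%C).
 assert (Cf : forall z, Re z <> a \/ Im z <> b -> Ccont f z).
 { intros z N. apply hol_cont. unfold f. holo. now apply Cminus_neq_0. }
 assert (Hh : forall y, y = y1 \/ y = y2 -> forall x, rcont (fun x => f (x, y)) x).
 { intros y N x. apply rcont_hor, Cf. simpl. lra. }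
 assert (Hv : forall x, x = x1 \/ x = x2 -> forall y, rcont (fun y => f (x, y)) y).
 { intros x N y. apply rcont_ver, Cf. simpl. lra. }
 assert (J1 : 0 < Im (1 * CI (fun x => f (x, y1)) x1 x2)%C).
 { apply (Im_CI_pos _ _ a (y1 - b) (b - y1)); auto; try lra. intros t. unfold f.
  rewrite im_mult, Im_Cinv, Re_Cinv. simpl. unfold Rdiv, Rminus. ring. }
 assert (J2 : 0 < Im (Ci * CI (fun y => f (x2, y)) y1 y2)%C).
 { apply (Im_CI_pos _ _ b (x2 - a) (x2 - a)); auto; try lra. intros t. unfold f.
  rewrite im_mult, Im_Cinv, Re_Cinv. simpl. unfold Rdiv, Rminus.
  rewrite (Rplus_comm ((x2 + - a) * _)). ring. }
 assert (J3 : 0 < Im (- (1) * CI (fun x => f (x, y2)) x1 x2)%C).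
 { apply (Im_CI_pos _ _ a (y2 - b) (y2 - b)); auto; try lra. intros t. unfold f.
  rewrite im_mult, Im_Cinv, Re_Cinv. simpl. unfold Rdiv, Rminus. ring. }
 assert (J4 : 0 < Im (- Ci * CI (fun y => f (x1, y)) y1 y2)%C).
 { apply (Im_CI_pos _ _ b (x1 - a) (a - x1)); auto; try lra. intros t. unfold f.
  rewrite im_mult, Im_Cinv, Re_Cinv. simpl. unfold Rdiv, Rminus.
  rewrite (Rplus_comm ((x1 + - a) * _)). ring. }
 apply (f_equal Im) in E. unfold bnd in E.
 change (Im (CI (fun x => f (x, y1)) x1 x2 + Ci * CI (fun y => f (x2, y)) y1 y2
  - CI (fun x => f (x, y2)) x1 x2 - Ci * CI (fun y => f (x1, y)) y1 y2)%C = 0) in E.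
 rewrite !im_mult in *. unfold Cminus in E. rewrite !im_plus, !im_opp, !im_mult in E.
 simpl in *. lra.
Qed.

Lemma rcont_bounded (f : R -> C) (a b : R) : (forall x, a <= x <= b -> rcont f x) ->
 exists M, forall x, a <= x <= b -> Cmod (f x) <= M.
Proof.
 intros H. destruct (bounded_continuity (V := C_R_NormedModule) f a b H) as [M HM].
 exists M. intros x Hx. rewrite <- norm_Cmod. left; auto.
Qed.

Lemma bd_bounded f x1 x2 y1 y2 : on_bd (Ccont f) x1 x2 y1 y2 -> x1 <= x2 -> y1 <= y2 ->
 exists M, on_bd (fun z => Cmod (f z) <= M) x1 x2 y1 y2.
Proof.
 intros H Hx Hy.
 destruct (rcont_bounded (fun x => f (x, y1)) x1 x2) as [M1 H1].
 { intros; apply rcont_hor, H; simpl; lra. }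
 destruct (rcont_bounded (fun x => f (x, y2)) x1 x2) as [M2 H2].
 { intros; apply rcont_hor, H; simpl; lra. }
 destruct (rcont_bounded (fun y => f (x1, y)) y1 y2) as [M3 H3].
 { intros; apply rcont_ver, H; simpl; lra. }
 destruct (rcont_bounded (fun y => f (x2, y)) y1 y2) as [M4 H4].
 { intros; apply rcont_ver, H; simpl; lra. }
 exists (Rmax (Rmax M1 M2) (Rmax M3 M4)). intros [x y] A B D. simpl in *.
 destruct D as [D|[D|[D|D]]]; subst.
 - eapply Rle_trans; [now apply H3|]. eapply Rle_trans; [|apply Rmax_r]. apply Rmax_l.
 - eapply Rle_trans; [now apply H4|]. eapply Rle_trans; [|apply Rmax_r]. apply Rmax_r.
 - eapply Rle_trans; [now apply H1|]. eapply Rle_trans; [|apply Rmax_l]. apply Rmax_l.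
 - eapply Rle_trans; [now apply H2|]. eapply Rle_trans; [|apply Rmax_l]. apply Rmax_r.
Qed.

(* Cauchy's formula for [F z / (z - c) ^ k]: as k grows, the boundary of the square
  contributes [O (h ^ - k)], which beats [|z0 - c| ^ - k]. *)
Lemma square_zero (F : C -> C) (c : C) (h r : R) : 0 < r ->
 on_rect (hol F) (Re c - h) (Re c + h) (Im c - h) (Im c + h) ->
 (forall z, Cmod (z - c)%C < r -> F z = 0) ->
 forall z0, Cmod (z0 - c)%C < h -> F z0 = 0.
Proof.
 intros Hr HF H0 z0 Hz.
 assert (Hh : 0 < h) by (generalize (Cmod_ge_0 (z0 - c)%C); lra).
 destruct (Req_dec (Cmod (z0 - c)%C) 0) as [Ez|Nz].
 { apply H0. lra. }
 assert (Hx : Re c - h < Re z0 < Re c + h).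
 { assert (A := Re_le_Cmod (z0 - c)%C). destruct z0, c; simpl in *.
  unfold Rabs in A; destruct Rcase_abs in A; lra. }
 assert (Hy : Im c - h < Im z0 < Im c + h).
 { assert (A := Im_le_Cmod (z0 - c)%C). destruct z0, c; simpl in *.
  unfold Rabs in A; destruct Rcase_abs in A; lra. }
 set (x1 := Re c - h) in *. set (x2 := Re c + h) in *.
 set (y1 := Im c - h) in *. set (y2 := Im c + h) in *.
 assert (Hx12 : x1 <= x2) by lra. assert (Hy12 : y1 <= y2) by lra.
 destruct (bd_bounded F x1 x2 y1 y2) as [M HM]; auto.
 { apply on_rect_bd. intros z A B. apply hol_cont. now apply HF. }
 assert (Far : on_bd (fun z => h <= Cmod (z - c)%C) x1 x2 y1 y2).
 { intros z A B D. assert (R1 := Re_le_Cmod (z - c)%C). assert (I1 := Im_le_Cmod (z - c)%C).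
  destruct z as [zx zy], c as [cx cy]. unfold x1, x2, y1, y2 in *. simpl in *.
  unfold Rabs in *. destruct Rcase_abs in R1; destruct Rcase_abs in I1; lra. }
 set (eta := h - Cmod (z0 - c)%C).
 assert (Heta : 0 < eta) by (unfold eta; lra).
 assert (Far0 : on_bd (fun z => eta <= Cmod (z - z0)%C) x1 x2 y1 y2).
 { intros z A B D. assert (T := Cmod_triangle (z - z0)%C (z0 - c)%C).
  replace (z - z0 + (z0 - c))%C with (z - c)%C in T by ring.
  specialize (Far z A B D). simpl in Far. unfold eta. lra. }
 assert (HM0 : 0 <= M).
 { eapply Rle_trans; [apply Cmod_ge_0|]. apply (HM (x1, y1)); simpl; lra. }
 set (W := bnd (fun z => / (z - z0))%C x1 x2 y1 y2).
 assert (HW : 0 < Cmod W) by now apply Cmod_pos, winding_neq_0.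
 set (q := Cmod (z0 - c)%C / h).
 assert (Hq : 0 <= q < 1).
 { unfold q. split; [apply Rmult_le_pos; [apply Cmod_ge_0|left; now apply Rinv_0_lt_compat]|].
  apply Rmult_lt_reg_r with h; auto. unfold Rdiv. rewrite Rmult_assoc, Rinv_l by lra. lra. }
 set (K := 2 * (x2 - x1 + (y2 - y1)) * (M / eta)).
 assert (B : forall k : nat, Cmod (F z0) * Cmod W <= K * q ^ k).
 { intros k. set (G := fun z => (F z * (/ (z - c)) ^ k)%C).
  assert (HG : on_rect (hol G) x1 x2 y1 y2).
  { intros z A B. destruct (Ceq_dec z c) as [->|N].
   - apply hol_ext_loc with (fun _ => RtoC 0) r; auto; [|apply hol_const].
    intros w Hw. unfold G. rewrite H0 by auto. ring.
   - unfold G. holo; [now apply HF|now apply Cminus_eq_contra]. }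
  assert (E := cauchy_rect G x1 x2 y1 y2 z0 Hx Hy HG). fold W in E.
  assert (Bd : Cmod (bnd (fun z => G z / (z - z0))%C x1 x2 y1 y2) <=
   2 * (x2 - x1 + (y2 - y1)) * (M * (/ h) ^ k * / eta)).
  { apply bnd_bound; auto.
   - intros z A B D. apply hol_cont. apply hol_div; [|now apply HG|holo].
    apply Cmod_gt_0. specialize (Far0 z A B D). simpl in Far0. lra.
   - intros z A B D. specialize (Far z A B D). specialize (Far0 z A B D).
    specialize (HM z A B D). simpl in *.
    assert (N1 : (z - c)%C <> 0) by (apply Cmod_gt_0; lra).
    assert (N2 : (z - z0)%C <> 0) by (apply Cmod_gt_0; lra).
    unfold G, Cdiv. rewrite !Cmod_mult, Cmod_pow, !Cmod_inv by auto.
    assert (I1 : / Cmod (z - c)%C <= / h) by (apply Rinv_le_contravar; lra).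
    assert (I2 : / Cmod (z - z0)%C <= / eta) by (apply Rinv_le_contravar; lra).
    assert (P1 : 0 < / Cmod (z - c)%C) by (apply Rinv_0_lt_compat; lra).
    assert (P2 : 0 < / Cmod (z - z0)%C) by (apply Rinv_0_lt_compat; lra).
    assert (I3 : (/ Cmod (z - c)%C) ^ k <= (/ h) ^ k) by (apply pow_incr; lra).
    assert (P3 : 0 <= (/ Cmod (z - c)%C) ^ k) by (apply pow_le; lra).
    apply Rmult_le_compat; auto; [apply Rmult_le_pos; auto; apply Cmod_ge_0|lra|].
    apply Rmult_le_compat; auto; apply Cmod_ge_0. }
  rewrite E, Cmod_mult in Bd. unfold G in Bd.
  assert (Nzc : (z0 - c)%C <> 0) by (intros E0; apply Nz; rewrite E0; apply Cmod_0).
  rewrite Cmod_mult, Cmod_pow, Cmod_inv in Bd by auto.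
  set (m := Cmod (z0 - c)%C) in *.
  assert (Hm : 0 < m) by (apply Cmod_pos, Nzc).
  apply Rmult_le_compat_r with (r := m ^ k) in Bd; [|apply pow_le; lra].
  replace (Cmod (F z0) * (/ m) ^ k * Cmod W * m ^ k) with
   (Cmod (F z0) * Cmod W * ((/ m) ^ k * m ^ k)) in Bd by ring.
  rewrite <- Rpow_mult_distr, Rinv_l, pow1, Rmult_1_r in Bd by lra.
  eapply Rle_trans; [exact Bd|]. right. unfold K, q, Rdiv. rewrite Rpow_mult_distr. ring. }
 assert (L : is_lim_seq (fun k => K * q ^ k) 0).
 { replace (Finite 0) with (Rbar_mult K 0) by (simpl; f_equal; ring).
  apply is_lim_seq_scal_l. apply is_lim_seq_geom. rewrite Rabs_pos_eq; lra. }
 assert (L' : Rbar_le (Cmod (F z0) * Cmod W) 0).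
 { apply (is_lim_seq_le (fun _ => Cmod (F z0) * Cmod W) (fun k => K * q ^ k)); auto.
  apply is_lim_seq_const. }
 simpl in L'. apply Cmod_eq_0. generalize (Cmod_ge_0 (F z0)). nra.
Qed.

Lemma zero_off_axis (F : C -> C) (x1 x2 : R) : x1 < x2 ->
 (forall z, Im z <> 0 -> hol F z) ->
 (forall z, x1 < Re z < x2 -> Im z <> 0 -> F z = 0) ->
 forall z, Im z <> 0 -> F z = 0.
Proof.
 intros Hx HF H0 z Hz.
 set (y := Rabs (Im z)). assert (Hy : 0 < y) by now apply Rabs_pos_lt.
 set (m := (x1 + x2) / 2).
 set (T := ((Re z - m) ^ 2 + y ^ 2) / y + 1).
 assert (HT : T * y = (Re z - m) ^ 2 + y ^ 2 + y) by (unfold T; field; lra).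
 assert (HTy : y < T).
 { assert (S := pow2_ge_0 (Re z - m)). apply Rmult_lt_reg_r with y; nra. }
 set (sg := Im z / y).
 assert (Hsg : (sg = 1 /\ Im z = y) \/ (sg = -1 /\ Im z = - y)).
 { unfold sg, y, Rabs. destruct Rcase_abs; [right|left]; split; try lra; field; lra. }
 set (r := Rmin ((x2 - x1) / 2) y).
 assert (Hr : 0 < r) by (apply Rmin_glb_lt; lra).
 apply (square_zero F (m, sg * T) (T - y / 2) r); auto; simpl.
 - intros w A B. apply HF. destruct Hsg as [[-> _]|[-> _]]; lra.
 - intros w Hw. assert (R1 := Re_le_Cmod (w - (m, (sg * T)%R))%C).
  assert (I1 := Im_le_Cmod (w - (m, (sg * T)%R))%C).
  assert (r1 : r <= (x2 - x1) / 2) by apply Rmin_l.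
  assert (r2 : r <= y) by apply Rmin_r.
  simpl in R1, I1. destruct w as [wx wy]. simpl in *.
  assert (R2 : Rabs (wx + - m) < (x2 - x1) / 2) by lra.
  assert (I2 : Rabs (wy + - (sg * T)) < y) by lra.
  apply Rabs_def2 in R2. apply Rabs_def2 in I2.
  apply H0; simpl; [unfold m in *; lra|]. destruct Hsg as [[-> _]|[-> _]]; lra.
 - replace (T - y / 2) with (sqrt ((T - y / 2) ^ 2)) by (apply sqrt_pow2; lra).
  apply sqrt_lt_1_alt. destruct z as [zx zy]; simpl in *.
  split; [apply Rplus_le_le_0_compat; apply pow2_ge_0|].
  clearbody y sg T m. destruct Hsg as [[-> ->]|[-> ->]]; nra.
Qed.

Lemma zero_at_cont (F : C -> C) (x1 x2 : R) : x1 < x2 ->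
 (forall z, Im z <> 0 -> hol F z) ->
 (forall z, x1 < Re z < x2 -> Im z <> 0 -> F z = 0) ->
 forall z, Ccont F z -> F z = 0.
Proof.
 intros Hx HF H0 z Hz.
 destruct (Req_dec (Im z) 0) as [E|N]; [|eapply zero_off_axis; eauto].
 destruct (Ceq_dec (F z) 0) as [|N]; auto. exfalso.
 destruct (Hz (Cmod (F z))) as (d & Hd & H); [now apply Cmod_pos|].
 specialize (H (z + RtoC (d / 2) * Ci)%C).
 replace (z + RtoC (d / 2) * Ci - z)%C with (RtoC (d / 2) * Ci)%C in H by ring.
 rewrite Cmod_mult, Cmod_Ci, Cmod_R, Rabs_pos_eq in H by lra.
 specialize (H ltac:(lra)).
 rewrite (zero_off_axis F x1 x2) in H; auto.
 - replace (0 - F z)%C with (- F z)%C in H by ring. rewrite Cmod_opp in H. lra.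
 - destruct z; unfold Im in *; simpl in *. lra.
Qed.

Lemma continuation_unique (F G : C -> C) (x1 x2 : R) : x1 < x2 ->
 (forall z, Im z <> 0 -> hol F z) -> (forall z, Im z <> 0 -> hol G z) ->
 (forall z, x1 < Re z < x2 -> Im z <> 0 -> F z = G z) ->
 forall z, hol F z -> hol G z -> F z = G z.
Proof.
 intros Hx HF HG E z Fz Gz. apply Ceq_minus.
 apply (zero_at_cont (fun w => F w - G w)%C x1 x2); auto.
 - intros w Hw. apply hol_minus; auto.
 - intros w A B. rewrite E by auto. ring.
 - apply hol_cont. now apply hol_minus.
Qed.

(** * Improper integrals *)

Notation is_CIg := (@is_RInt_gen C_R_NormedModule).
Notation ex_CIg := (@ex_RInt_gen C_R_NormedModule).
Definition CIg (f : R -> C) (Fa Fb : (R -> Prop) -> Prop) : C :=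
 @RInt_gen C_R_CompleteNormedModule f Fa Fb.

Ltac tc := try typeclasses eauto.

Lemma CIg_correct (f : R -> C) Fa Fb {FFa : ProperFilter Fa} {FFb : ProperFilter Fb} :
 ex_CIg f Fa Fb -> is_CIg f Fa Fb (CIg f Fa Fb).
Proof. apply (@RInt_gen_correct C_R_CompleteNormedModule); apply Proper_StrongProper; auto. Qed.

Lemma CIg_unique (f : R -> C) Fa Fb {FFa : ProperFilter Fa} {FFb : ProperFilter Fb} (l : C) :
 is_CIg f Fa Fb l -> CIg f Fa Fb = l.
Proof. apply (@is_RInt_gen_unique C_R_CompleteNormedModule); apply Proper_StrongProper; auto. Qed.

Lemma CIg_RInt_gen (f : R -> C) Fa Fb :
 @RInt_gen C_R_CompleteNormedModule f Fa Fb = CIg f Fa Fb.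
Proof. reflexivity. Qed.

Global Opaque CIg.

Lemma is_CIg_eps (f : R -> C) Fa Fb {FFa : Filter Fa} {FFb : Filter Fb} (l : C) :
 is_CIg f Fa Fb l <-> forall eps, 0 < eps ->
  filter_prod Fa Fb (fun ab => exists y, is_CI f (fst ab) (snd ab) y /\ Cmod (y - l)%C < eps).
Proof.
 split.
 - intros H eps He.
  apply (H (fun y : C => Cmod (y - l)%C < eps)).
  exists (mkposreal (eps / 2) ltac:(lra)). intros y [H1 H2].
  eapply Rle_lt_trans; [apply Cmod_le_sum|].
  change (Rabs (Re (y - l)%C) < eps / 2) in H1.
  change (Rabs (Im (y - l)%C) < eps / 2) in H2. lra.
 - intros H P [eps HP].
  assert (H' := H eps (cond_pos eps)).
  unfold filtermapi. eapply filter_imp; [|exact H'].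
  intros ab (y & Hy & Hl). exists y. split; auto. apply HP. split.
  + eapply Rle_lt_trans; [|exact Hl]. apply (Re_le_Cmod (y - l)%C).
  + eapply Rle_lt_trans; [|exact Hl]. apply (Im_le_Cmod (y - l)%C).
Qed.

Lemma is_CIg_scal (c : C) (f : R -> C) Fa Fb {FFa : Filter Fa} {FFb : Filter Fb} (l : C) :
 is_CIg f Fa Fb l -> is_CIg (fun t => c * f t)%C Fa Fb (c * l)%C.
Proof.
 intros H. apply is_CIg_eps; auto. intros eps He.
 assert (Hc : 0 < Cmod c + 1) by (generalize (Cmod_ge_0 c); lra).
 assert (H' := proj1 (is_CIg_eps f Fa Fb l) H (eps / (Cmod c + 1)) (Rdiv_lt_0_compat _ _ He Hc)).
 eapply filter_imp; [|exact H'].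
 intros ab (y & Hy & Hl). exists (c * y)%C. split; [now apply is_CI_scal|].
 replace (c * y - c * l)%C with (c * (y - l))%C by ring. rewrite Cmod_mult.
 apply Rle_lt_trans with ((Cmod c + 1) * Cmod (y - l)%C).
 - apply Rmult_le_compat_r; [apply Cmod_ge_0|lra].
 - apply Rmult_lt_compat_l with (r := Cmod c + 1) in Hl; auto.
  replace ((Cmod c + 1) * (eps / (Cmod c + 1))) with eps in Hl by (field; lra). auto.
Qed.

Lemma is_CIg_plus (f g : R -> C) Fa Fb {FFa : Filter Fa} {FFb : Filter Fb} (l m : C) :
 is_CIg f Fa Fb l -> is_CIg g Fa Fb m -> is_CIg (fun t => f t + g t)%C Fa Fb (l + m)%C.
Proof. apply (@is_RInt_gen_plus C_R_NormedModule); auto. Qed.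

Lemma is_CIg_minus (f g : R -> C) Fa Fb {FFa : Filter Fa} {FFb : Filter Fb} (l m : C) :
 is_CIg f Fa Fb l -> is_CIg g Fa Fb m -> is_CIg (fun t => f t - g t)%C Fa Fb (l - m)%C.
Proof. apply (@is_RInt_gen_minus C_R_NormedModule); auto. Qed.

Lemma is_CIg_ext (f g : R -> C) Fa Fb {FFa : Filter Fa} {FFb : Filter Fb} (l : C) :
 (forall t, f t = g t) -> is_CIg f Fa Fb l -> is_CIg g Fa Fb l.
Proof.
 intros E. apply (@is_RInt_gen_ext C_R_NormedModule); auto.
 apply filter_forall. auto.
Qed.

Lemma is_CIg_eq (f : R -> C) Fa Fb (l m : C) : is_CIg f Fa Fb l -> l = m -> is_CIg f Fa Fb m.
Proof. now intros H <-. Qed.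

Definition dominated (Fa Fb : (R -> Prop) -> Prop) (f : R -> C) (g : R -> R) : Prop :=
 filter_prod Fa Fb (fun ab => fst ab <= snd ab /\
  forall x, fst ab <= x <= snd ab -> Cmod (f x) <= g x).

Lemma is_CIg_bound (f : R -> C) (g : R -> R) Fa Fb
 {FFa : ProperFilter Fa} {FFb : ProperFilter Fb} (l : C) (m : R) :
 dominated Fa Fb f g -> is_CIg f Fa Fb l -> is_RInt_gen g Fa Fb m -> Cmod l <= m.
Proof.
 intros D Hf Hg. rewrite <- norm_Cmod.
 apply (RInt_gen_norm (V := C_R_CompleteNormedModule) (Fa := Fa) (Fb := Fb) f g); auto.
 - eapply filter_imp; [|exact D]. now intros ab [H _].
 - eapply filter_imp; [|exact D]. intros ab [_ H] x Hx.
  change (@norm R_AbsRing C_R_NormedModule (f x) <= g x). rewrite norm_Cmod. auto.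
Qed.

Lemma CI_bound_abs (f : R -> C) (g : R -> R) (a b : R) :
 (forall x, rcont f x) -> (forall x, continuous g x) ->
 (forall x, Rmin a b <= x <= Rmax a b -> Cmod (f x) <= g x) ->
 Cmod (CI f a b) <= Rabs (RInt g a b).
Proof.
 intros Hf Hg.
 assert (W : forall a b, a <= b -> (forall x, a <= x <= b -> Cmod (f x) <= g x) ->
  Cmod (CI f a b) <= RInt g a b).
 { clear a b. intros a b Hab H.
  apply (is_CI_bound f g a b); auto.
  - apply is_CI_CI, ex_CI_cont; auto.
  - apply (@RInt_correct R_CompleteNormedModule). now apply (@ex_RInt_continuous R_CompleteNormedModule). }
 intros H. destruct (Rle_dec a b) as [L|L].
 - rewrite Rmin_left, Rmax_right in H by auto.
  eapply Rle_trans; [apply W; auto|apply Rle_abs].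
 - apply Rnot_le_lt in L. rewrite Rmin_right, Rmax_left in H by lra.
  assert (E : (CI f a b + CI f b a)%C = CI f a a).
  { apply CI_Chasles; apply ex_CI_cont; auto. }
  assert (E0 : CI f a a = 0).
  { apply is_CI_unique. apply (@is_RInt_point C_R_NormedModule). }
  rewrite E0 in E. replace (CI f a b) with (- CI f b a)%C.
  2:{ replace (CI f a b) with ((CI f a b + CI f b a) - CI f b a)%C by ring. rewrite E. ring. }
  rewrite Cmod_opp, <- (opp_RInt_swap (V := R_CompleteNormedModule)).
  + unfold opp; simpl. rewrite Rabs_Ropp. eapply Rle_trans; [apply W; auto; lra|apply Rle_abs].
  + now apply (@ex_RInt_continuous R_CompleteNormedModule).
Qed.

Lemma ex_CIg_dom (f : R -> C) (g : R -> R) Fa Fb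
 {FFa : ProperFilter Fa} {FFb : ProperFilter Fb} :
 (forall x, rcont f x) -> (forall x, continuous g x) ->
 ex_RInt_gen g Fa Fb -> dominated Fa Fb f g -> ex_CIg f Fa Fb.
Proof.
 intros Hf Hg [lg Lg] D.
 assert (Exg : forall a b, ex_RInt g a b).
 { intros. now apply (@ex_RInt_continuous R_CompleteNormedModule). }
 assert (Exf : forall a b, ex_CI f a b) by (intros; now apply ex_CI_cont).
 destruct (proj1 (filterlim_locally_cauchy (U := C_R_CompleteNormedModule)
  (F := filter_prod Fa Fb) (fun ab => CI f (fst ab) (snd ab)))) as [l Hl].
 - intros eps. set (e := eps / 8). assert (He : 0 < e) by (unfold e; generalize (cond_pos eps); lra).
  assert (Hge : filter_prod Fa Fb (fun ab => Rabs (RInt g (fst ab) (snd ab) - lg) < e)).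
  { assert (H := Lg (fun y => Rabs (y - lg) < e)). unfold filtermapi in H.
   eapply filter_imp; [|apply H].
   - intros ab (y & Hy & Hl). now rewrite (is_RInt_unique _ _ _ _ Hy).
   - exists (mkposreal e He). auto. }
  destruct (filter_and _ _ Hge D) as [Q S HQ HS HQS].
  exists (fun ab => Q (fst ab) /\ S (snd ab)). split.
  { exists Q S; auto. }
  intros [a b] [a' b'] [Qa Sb] [Qa' Sb']. simpl in *.
  destruct (HQS a b Qa Sb) as [G1 [O1 B1]]. destruct (HQS a' b' Qa' Sb') as [G2 [O2 B2]].
  destruct (HQS a' b Qa' Sb) as [G3 [O3 B3]]. simpl in *.
  assert (E : (CI f a' b' - CI f a b = CI f a' a + CI f b b')%C).
  { rewrite <- (CI_Chasles f a' a b'), <- (CI_Chasles f a b b') by auto. ring. }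
  assert (A1 : Cmod (CI f a' a) <= Rabs (RInt g a' a)).
  { apply CI_bound_abs; auto. intros x. unfold Rmin, Rmax.
   destruct (Rle_dec a' a); intros; [apply B3; lra|apply B1; lra]. }
  assert (A2 : Cmod (CI f b b') <= Rabs (RInt g b b')).
  { apply CI_bound_abs; auto. intros x. unfold Rmin, Rmax.
   destruct (Rle_dec b b'); intros; [apply B2; lra|apply B3; lra]. }
  assert (E1 : RInt g a' a + RInt g a b = RInt g a' b) by (apply (RInt_Chasles g a' a b); apply Exg).
  assert (E2 : RInt g a' b + RInt g b b' = RInt g a' b') by (apply (RInt_Chasles g a' b b'); apply Exg).
  assert (T := Cmod_triangle (CI f a' a) (CI f b b')). rewrite <- E in T.
  assert (T1 : Rabs (RInt g a' a) < 2 * e).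
  { replace (RInt g a' a) with ((RInt g a' b - lg) - (RInt g a b - lg)) by lra.
   eapply Rle_lt_trans; [apply Rabs_triang|]. rewrite Rabs_Ropp. lra. }
  assert (T2 : Rabs (RInt g b b') < 2 * e).
  { replace (RInt g b b') with ((RInt g a' b' - lg) - (RInt g a' b - lg)) by lra.
   eapply Rle_lt_trans; [apply Rabs_triang|]. rewrite Rabs_Ropp. lra. }
  assert (TT : Cmod (CI f a' b' - CI f a b)%C < eps) by (unfold e in *; lra).
  split; (eapply Rle_lt_trans; [|exact TT]).
  + apply (Re_le_Cmod (CI f a' b' - CI f a b)%C).
  + apply (Im_le_Cmod (CI f a' b' - CI f a b)%C).
 - exists l. intros P HP. specialize (Hl P HP). unfold filtermapi, filtermap in *.
  eapply filter_imp; [|exact Hl]. intros ab H. exists (CI f (fst ab) (snd ab)).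
  split; auto. now apply is_CI_CI.
Qed.

Lemma exp_ge_id (y : R) : y <= exp y.
Proof. generalize (exp_ineq1_le y). lra. Qed.

Lemma sq_le_exp (y : R) : 0 <= y -> y ^ 2 <= 4 * exp y.
Proof.
 intros Hy. assert (H := exp_ge_id (y / 2)).
 replace y with (y / 2 + y / 2) at 2 by field. rewrite exp_plus. nra.
Qed.

Lemma rcont_plus (f g : R -> C) x : rcont f x -> rcont g x -> rcont (fun u => f u + g u)%C x.
Proof. apply (@continuous_plus R_UniformSpace R_AbsRing C_R_NormedModule). Qed.

Lemma rcont_const (c : C) x : rcont (fun _ => c) x.
Proof. apply (@continuous_const R_UniformSpace C_R_NormedModule). Qed.

(* Polarization reduces products to sums and squares. *)
Lemma rcont_mult (f g : R -> C) x : rcont f x -> rcont g x -> rcont (fun u => f u * g u)%C x.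
Proof.
 intros Hf Hg.
 assert (Hn : rcont (fun u => (- (1)) * g u)%C x).
 { apply (rcont_comp (fun z => (- (1)) * z)%C g); auto. apply hol_cont. holo. }
 apply (continuous_ext (fun u => RtoC (/ 4) * ((f u + g u) * (f u + g u)) +
  RtoC (- / 4) * ((f u + (- (1)) * g u) * (f u + (- (1)) * g u)))%C).
 { intros u. apply C_eq; destruct (f u), (g u); unfold Re, Im; simpl; field. }
 apply rcont_plus.
 - apply (rcont_comp (fun z => RtoC (/ 4) * (z * z))%C (fun u => f u + g u)%C).
  + now apply rcont_plus.
  + apply hol_cont. holo.
 - apply (rcont_comp (fun z => RtoC (- / 4) * (z * z))%C (fun u => f u + (- (1)) * g u)%C).
  + now apply rcont_plus.
  + apply hol_cont. holo.
Qed.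

Lemma continuous_scal_R (g : R -> R) (K x : R) :
 continuous g x -> continuous (fun x => K * g x) x.
Proof. apply (@continuous_scal_r R_UniformSpace R_AbsRing R_NormedModule K g). Qed.

Lemma ex_RInt_gen_scal_R (g : R -> R) Fa Fb {FFa : Filter Fa} {FFb : Filter Fb} (K : R) :
 ex_RInt_gen g Fa Fb -> ex_RInt_gen (fun x => K * g x) Fa Fb.
Proof.
 intros [l H]. exists (K * l). now apply (is_RInt_gen_scal (V := R_NormedModule) g K l).
Qed.

(* The quadratic remainder [|e^h - 1 - h| <= |h|^2 e^|h|] replaces dominated convergence. *)
Lemma cdiff_param Fa Fb {FFa : ProperFilter Fa} {FFb : ProperFilter Fb}
 (k lam : R -> C) (g : R -> R) (s : C) (eta : R) :
 0 < eta -> (forall x, rcont k x) -> (forall x, rcont lam x) -> (forall x, continuous g x) ->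
 ex_RInt_gen g Fa Fb ->
 dominated Fa Fb (fun u => k u * Cexp (s * lam u) * RtoC (exp (2 * eta * Cmod (lam u))))%C g ->
 ex_CIg (fun u => k u * Cexp (s * lam u))%C Fa Fb /\
 ex_CIg (fun u => k u * Cexp (s * lam u) * lam u)%C Fa Fb /\
 cdiff (fun z => CIg (fun u => k u * Cexp (z * lam u))%C Fa Fb) s
  (CIg (fun u => k u * Cexp (s * lam u) * lam u)%C Fa Fb).
Proof.
 intros Heta Hk Hl Hg Eg D.
 set (f := fun u => (k u * Cexp (s * lam u))%C) in *.
 set (y := fun u => eta * Cmod (lam u)).
 assert (Y0 : forall u, 0 <= y u) by (intros; apply Rmult_le_pos; [lra|apply Cmod_ge_0]).
 assert (Y1 : forall u, 1 <= exp (y u)).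
 { intros u. generalize (exp_ineq1_le (y u)), (Y0 u). lra. }
 assert (Eh : forall h u, (k u * Cexp ((s + h) * lam u))%C = (f u * Cexp (h * lam u))%C).
 { intros h u. unfold f. rewrite Cmult_plus_distr_r, Cexp_plus. ring. }
 assert (Fc : forall x, rcont f x).
 { intros x. apply rcont_mult; auto. apply (rcont_comp (fun w => Cexp (s * w))%C lam); auto.
  apply hol_cont. holo. }
 assert (Dom : forall A f', 0 <= A -> (forall u, Cmod (f' u) <= A * (Cmod (f u) * exp (y u) ^ 2)) ->
  dominated Fa Fb f' (fun x => A * g x)).
 { intros A f' HA H. unfold dominated in *. eapply filter_imp; [|exact D]. intros ab [O B].
  split; auto. intros x Hx. eapply Rle_trans; [apply H|]. apply Rmult_le_compat_l; auto.
  eapply Rle_trans; [|apply B; auto].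
  rewrite Cmod_mult, Cmod_R, Rabs_pos_eq by (left; apply exp_pos). right. f_equal.
  simpl. rewrite Rmult_1_r, <- exp_plus. f_equal. unfold y. ring. }
 assert (Ex : forall A f', 0 <= A -> (forall x, rcont f' x) ->
  (forall u, Cmod (f' u) <= A * (Cmod (f u) * exp (y u) ^ 2)) -> ex_CIg f' Fa Fb).
 { intros A f' HA Hc H. apply ex_CIg_dom with (fun x => A * g x); auto.
  - intros x. apply continuous_scal_R, Hg.
  - now apply ex_RInt_gen_scal_R; tc. }
 assert (Hex : forall h, Cmod h <= eta -> ex_CIg (fun u => f u * Cexp (h * lam u))%C Fa Fb).
 { intros h Hh. apply (Ex 1); [lra| |].
  - intros x. apply rcont_mult; auto. apply (rcont_comp (fun w => Cexp (h * w))%C lam); auto.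
   apply hol_cont. holo.
  - intros u. rewrite Rmult_1_l, Cmod_mult, Cmod_Cexp.
   apply Rmult_le_compat_l; [apply Cmod_ge_0|].
   apply Rle_trans with (exp (y u)); [|specialize (Y1 u); nra].
   apply exp_le. eapply Rle_trans; [apply Re_le|]. rewrite Cmod_mult.
   apply Rmult_le_compat_r; auto. apply Cmod_ge_0. }
 assert (Ex0 : ex_CIg f Fa Fb).
 { apply (Ex 1); auto; [lra|]. intros u. specialize (Y1 u).
  assert (P := Cmod_ge_0 (f u)). assert (1 <= exp (y u) ^ 2) by nra. nra. }
 assert (Exl : ex_CIg (fun u => f u * lam u)%C Fa Fb).
 { apply (Ex (/ eta)); [left; now apply Rinv_0_lt_compat|intros x; now apply rcont_mult|].
  intros u. rewrite Cmod_mult.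
  replace (/ eta * (Cmod (f u) * exp (y u) ^ 2)) with (Cmod (f u) * (/ eta * exp (y u) ^ 2)) by ring.
  apply Rmult_le_compat_l; [apply Cmod_ge_0|]. apply Rmult_le_reg_l with eta; auto.
  rewrite <- Rmult_assoc, Rinv_r, Rmult_1_l by lra.
  specialize (Y1 u). generalize (exp_ge_id (y u)). unfold y in *. nra. }
 split; auto. split; auto.
 destruct Eg as [lg Lg].
 set (A := 4 / (eta * eta)).
 assert (HA : 0 < A) by (apply Rdiv_lt_0_compat; nra).
 assert (Q : forall h, Cmod h <= eta -> Cmod (CIg (fun u => k u * Cexp ((s + h) * lam u)) Fa Fb
   - CIg f Fa Fb - h * CIg (fun u => f u * lam u) Fa Fb)%C <= (Cmod h ^ 2 * A) * lg).
 { intros h Hh.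
  assert (I : is_CIg (fun u => f u * Cexp (h * lam u) - f u - h * (f u * lam u))%C Fa Fb
    (CIg (fun u => k u * Cexp ((s + h) * lam u)) Fa Fb - CIg f Fa Fb
   - h * CIg (fun u => f u * lam u) Fa Fb)%C).
  { apply is_CIg_minus; tc; [apply is_CIg_minus; tc; [|now apply CIg_correct]|].
   - destruct (Hex h Hh) as [l Il].
    assert (J := is_CIg_ext _ (fun u => k u * Cexp ((s + h) * lam u))%C _ _ _
     (fun u => eq_sym (Eh h u)) Il).
    now rewrite (CIg_unique _ _ _ _ J).
   - apply is_CIg_scal; tc. now apply CIg_correct. }
  refine (is_CIg_bound _ (fun x => (Cmod h ^ 2 * A) * g x) Fa Fb _ _ _ I _).
  - apply Dom; [apply Rmult_le_pos; [apply pow2_ge_0|lra]|]. intros u.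
   replace (f u * Cexp (h * lam u) - f u - h * (f u * lam u))%C with
    (f u * (Cexp (h * lam u) - 1 - h * lam u))%C by ring.
   rewrite Cmod_mult.
   replace (Cmod h ^ 2 * A * (Cmod (f u) * exp (y u) ^ 2)) with
    (Cmod (f u) * (Cmod h ^ 2 * (A * exp (y u) * exp (y u)))) by ring.
   apply Rmult_le_compat_l; [apply Cmod_ge_0|].
   eapply Rle_trans; [apply Cexp_bound2|]. rewrite Cmod_mult, Rpow_mult_distr, Rmult_assoc.
   apply Rmult_le_compat_l; [apply pow2_ge_0|].
   assert (B := sq_le_exp (y u) (Y0 u)). unfold y in B at 1. rewrite Rpow_mult_distr in B.
   apply Rmult_le_compat; [apply pow2_ge_0|left; apply exp_pos| |].
   + unfold A. apply Rmult_le_reg_l with (eta ^ 2); [nra|].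
    eapply Rle_trans; [exact B|]. right. field. lra.
   + apply exp_le. apply Rmult_le_compat_r; auto. apply Cmod_ge_0.
  - apply (is_RInt_gen_scal (V := R_NormedModule) g); auto. }
 apply cdiff_eps. intros eps He.
 set (M := A * Rabs lg + 1). assert (HM : 0 < M) by (unfold M; generalize (Rabs_pos lg); nra).
 exists (Rmin eta (eps / M)). split; [apply Rmin_glb_lt; auto; now apply Rdiv_lt_0_compat|].
 intros z Hz. assert (Z1 := Rlt_le_trans _ _ _ Hz (Rmin_l _ _)).
 assert (Z2 := Rlt_le_trans _ _ _ Hz (Rmin_r _ _)).
 specialize (Q (z - s)%C ltac:(lra)). replace (s + (z - s))%C with z in Q by ring.
 eapply Rle_trans; [exact Q|].
 set (m := Cmod (z - s)%C) in *. assert (Hm : 0 <= m) by apply Cmod_ge_0.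
 apply Rmult_lt_compat_r with (r := M) in Z2; auto.
 replace (eps / M * M) with eps in Z2 by (field; lra).
 apply Rle_trans with (m * (m * M)); [|nra].
 replace (m ^ 2 * A * lg) with (m * (m * (A * lg))) by ring.
 repeat (apply Rmult_le_compat_l; auto). unfold M. generalize (Rle_abs lg). nra.
Qed.

Notation pinf := (Rbar_locally p_infty).
Notation minf := (Rbar_locally m_infty).

Lemma is_RInt_gen_FTC (G g : R -> R) Fa Fb {FFa : Filter Fa} {FFb : Filter Fb} (la lb : R) :
 (forall x, is_derive G x (g x)) -> (forall x, continuous g x) ->
 filterlim G Fa (locally la) -> filterlim G Fb (locally lb) ->
 is_RInt_gen g Fa Fb (lb - la).
Proof.
 intros Hd Hc La Lb.
 assert (E : forall x, Derive G x = g x) by (intros; now apply is_derive_unique).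
 apply (is_RInt_gen_ext (V := R_NormedModule) (Derive G)).
 - apply filter_forall. auto.
 - apply is_RInt_gen_Derive; auto; apply filter_forall; intros ab x _.
  + eexists; apply Hd.
  + apply continuous_ext with g; auto.
Qed.

Lemma exp_small_p (c K e : R) : 0 < c -> 0 < e -> pinf (fun u => K * exp (- c * u) < e).
Proof.
 intros Hc He. assert (HK := Rabs_pos K). assert (HK' := Rle_abs K).
 set (d := e / (Rabs K + 1)). assert (Hd : 0 < d) by (apply Rdiv_lt_0_compat; lra).
 exists (- ln d / c). intros u Hu.
 assert (L : exp (- c * u) < d).
 { rewrite <- (exp_ln d) by auto. apply exp_increasing.
  apply Rmult_lt_compat_r with (r := c) in Hu; auto.
  replace (- ln d / c * c) with (- ln d) in Hu by (field; lra). lra. }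
 assert (P := exp_pos (- c * u)).
 replace e with ((Rabs K + 1) * d) by (unfold d; field; lra). nra.
Qed.

Lemma exp_small_m (c K e : R) : 0 < c -> 0 < e -> minf (fun u => K * exp (c * u) < e).
Proof.
 intros Hc He. destruct (exp_small_p c K e Hc He) as [X HX]. exists (- X). intros u Hu.
 replace (c * u) with (- c * - u) by ring. apply HX. lra.
Qed.

Lemma is_CIg_FTC (G f : R -> C) (la lb : C) (K c K' c' : R) : 0 < c -> 0 < c' ->
 (forall a b, is_CI f a b (G b - G a)%C) ->
 (forall x, Cmod (G x - la)%C <= K * exp (c * x)) ->
 (forall x, Cmod (G x - lb)%C <= K' * exp (- c' * x)) ->
 is_CIg f minf pinf (lb - la)%C.
Proof.
 intros Hc Hc' H Ha Hb. apply is_CIg_eps; tc. intros eps He.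
 eexists; [apply (exp_small_m c K (eps / 2)); lra|apply (exp_small_p c' K' (eps / 2)); lra|].
 intros a b Qa Qb. exists (G b - G a)%C. split; [apply H|]. simpl.
 replace (G b - G a - (lb - la))%C with ((G b - lb) - (G a - la))%C by ring.
 eapply Rle_lt_trans; [apply Cmod_triangle_minus|].
 specialize (Ha a). specialize (Hb b). lra.
Qed.

Lemma locally_Rabs (G : R -> R) (F : (R -> Prop) -> Prop) {FF : Filter F} (l : R) :
 (forall e, 0 < e -> F (fun x => Rabs (G x - l) < e)) -> filterlim G F (locally l).
Proof.
 intros H P [e He]. unfold filtermap. eapply filter_imp; [|apply (H e (cond_pos e))].
 intros x Hx. apply He. exact Hx.
Qed.

Lemma cont_by_derive (g : R -> R) (x : R) : ex_derive g x -> continuous g x.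
Proof. apply (@ex_derive_continuous R_AbsRing R_NormedModule). Qed.

Lemma is_RInt_gen_exp (b c : R) : 0 < c ->
 is_RInt_gen (fun u => exp (- c * u)) (at_point b) pinf (exp (- c * b) / c).
Proof.
 intros Hc. replace (exp (- c * b) / c) with (0 - (- exp (- c * b) / c)) by (field; lra).
 apply (is_RInt_gen_FTC (fun u => - exp (- c * u) / c)); tc.
 - intros x. auto_derive; auto. field. lra.
 - intros x. apply cont_by_derive. auto_derive; auto.
 - apply locally_Rabs; tc. intros e He. unfold at_point.
  rewrite Rminus_diag, Rabs_R0. auto.
 - apply locally_Rabs; tc. intros e He.
  eapply filter_imp; [|apply (exp_small_p c (/ c) e); auto].
  intros u Hu. assert (P := exp_pos (- c * u)).
  replace (- exp (- c * u) / c - 0) with (- (/ c * exp (- c * u))) by (field; lra).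
  rewrite Rabs_Ropp, Rabs_pos_eq; auto.
  apply Rmult_le_pos; [left; now apply Rinv_0_lt_compat|lra].
Qed.

(* A logistic density: comparable to [exp (- c * Rabs u)], with an elementary primitive. *)
Definition logistic (c u : R) : R := exp (- c * u) / (1 + exp (- c * u)) ^ 2.

Lemma one_plus_exp_neq (x : R) : 1 + exp x <> 0.
Proof. generalize (exp_pos x). intros P E. lra. Qed.

Lemma logistic_cont (c x : R) : continuous (logistic c) x.
Proof.
 apply cont_by_derive. unfold logistic. auto_derive.
 exact (pow_nonzero _ 2 (one_plus_exp_neq (- c * x))).
Qed.

Lemma is_RInt_gen_logistic (c : R) : 0 < c -> is_RInt_gen (logistic c) minf pinf (/ c).
Proof.
 intros Hc. replace (/ c) with (/ c - 0) by ring.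
 apply (is_RInt_gen_FTC (fun u => / c * / (1 + exp (- c * u)))); tc.
 - intros x. assert (P := one_plus_exp_neq (- c * x)). unfold logistic.
  auto_derive; auto. field. split; auto. lra.
 - intros x. apply logistic_cont.
 - apply locally_Rabs; tc. intros e He.
  eapply filter_imp; [|apply (exp_small_m c (/ c) e); auto].
  intros u Hu. assert (P := exp_pos (- c * u)). assert (P' := exp_pos (c * u)).
  assert (Pc := Rinv_0_lt_compat c Hc).
  assert (E : exp (- c * u) = / exp (c * u)) by (rewrite <- exp_Ropp; f_equal; ring).
  rewrite Rminus_0_r, Rabs_pos_eq.
  + eapply Rle_lt_trans; [|exact Hu]. apply Rmult_le_compat_l; [lra|].
   rewrite <- (Rinv_inv (exp (c * u))), <- E. apply Rinv_le_contravar; lra.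
  + left. apply Rmult_lt_0_compat; [lra|apply Rinv_0_lt_compat; lra].
 - apply locally_Rabs; tc. intros e He.
  eapply filter_imp; [|apply (exp_small_p c (/ c) e); auto].
  intros u Hu. assert (P := exp_pos (- c * u)). assert (Pc := Rinv_0_lt_compat c Hc).
  replace (/ c * / (1 + exp (- c * u)) - / c) with
   (- (/ c * exp (- c * u) * / (1 + exp (- c * u)))) by (field; lra).
  assert (Q : 0 < / (1 + exp (- c * u)) <= 1).
  { split; [apply Rinv_0_lt_compat; lra|]. rewrite <- Rinv_1. apply Rinv_le_contravar; lra. }
  assert (0 < / c * exp (- c * u)) by (apply Rmult_lt_0_compat; lra).
  rewrite Rabs_Ropp, Rabs_pos_eq; nra.
Qed.

Lemma le_logistic (c u m M : R) : 0 <= m -> m * exp (c * u) <= M -> m * exp (- c * u) <= M ->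
 m <= (4 * M) * logistic c u.
Proof.
 intros Hm H1 H2. unfold logistic. set (x := exp (- c * u)) in *.
 assert (Hx : 0 < x) by apply exp_pos.
 assert (E : exp (c * u) * x = 1).
 { apply exp_mul_opp. ring. }
 assert (Hx2 : m <= M * x).
 { apply Rmult_le_compat_r with (r := x) in H1; [|lra]. rewrite Rmult_assoc, E in H1. lra. }
 assert (HM : m <= M).
 { destruct (Rle_dec x 1); nra. }
 apply Rmult_le_reg_r with ((1 + x) ^ 2); [nra|].
 replace (4 * M * (x / (1 + x) ^ 2) * (1 + x) ^ 2) with (4 * M * x) by (field; lra).
 nra.
Qed.

Definition exp_decay (f : R -> C) (c M : R) : Prop :=
 forall u e, e = c \/ e = - c -> Cmod (f u) * exp (e * u) <= M.

Lemma full_dominated (f : R -> C) (c M : R) : 0 < c -> exp_decay f c M ->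
 dominated minf pinf f (fun u => (4 * M) * logistic c u).
Proof.
 intros Hc H. exists (fun x => x < 0) (fun x => 0 < x); [now exists 0|now exists 0|].
 intros a b Ha Hb. simpl. split; [lra|]. intros x _.
 apply le_logistic; [apply Cmod_ge_0|..]; apply H; auto.
Qed.

Lemma ex_logistic (c M : R) : 0 < c -> ex_RInt_gen (fun u => M * logistic c u) minf pinf.
Proof.
 intros Hc. apply ex_RInt_gen_scal_R; tc. eexists. now apply is_RInt_gen_logistic.
Qed.

Lemma ex_CIg_full (f : R -> C) (c M : R) : 0 < c -> (forall x, rcont f x) ->
 exp_decay f c M -> ex_CIg f minf pinf.
Proof.
 intros Hc Hf H. apply ex_CIg_dom with (fun u => (4 * M) * logistic c u); auto; tc.
 - intros x. apply continuous_scal_R, logistic_cont.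
 - now apply ex_logistic.
 - now apply full_dominated.
Qed.

Lemma CIg_full_bound (f : R -> C) (c M : R) (l : C) : 0 < c -> exp_decay f c M ->
 is_CIg f minf pinf l -> Cmod l <= 4 * M / c.
Proof.
 intros Hc H Hl. eapply is_CIg_bound; [..|exact Hl|]; tc.
 - now apply (full_dominated f c M).
 - apply (is_RInt_gen_scal (V := R_NormedModule)); tc. now apply is_RInt_gen_logistic.
Qed.

Lemma half_dominated (f : R -> C) (b c M : R) :
 (forall u, b <= u -> Cmod (f u) <= M * exp (- c * u)) ->
 dominated (at_point b) pinf f (fun u => M * exp (- c * u)).
Proof.
 intros H. exists (fun x => x = b) (fun x => b < x); [now unfold at_point|now exists b|].
 intros a x -> Hx. simpl. split; [lra|]. intros y Hy. apply H; lra.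
Qed.

Lemma laplace_full (k : R -> C) (s : C) (c M : R) : 0 < c -> (forall x, rcont k x) ->
 (forall u, Cmod (k u) * exp ((Re s + 4 * c) * u) <= M) ->
 (forall u, Cmod (k u) * exp ((Re s - 4 * c) * u) <= M) ->
 ex_CIg (fun u => k u * Cexp (s * u))%C minf pinf /\
 ex_CIg (fun u => k u * Cexp (s * u) * u)%C minf pinf /\
 cdiff (fun z => CIg (fun u => k u * Cexp (z * u))%C minf pinf) s
  (CIg (fun u => k u * Cexp (s * u) * u)%C minf pinf).
Proof.
 intros Hc Hk H1 H2.
 apply cdiff_param with (g := fun u => (4 * M) * logistic c u) (eta := c);
  auto; tc.
 - apply rcont_RtoC.
 - intros x. apply continuous_scal_R, logistic_cont.
 - now apply ex_logistic.
 - apply full_dominated; auto. intros u d Hd.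
  assert (Hd' : - c <= d <= c) by (destruct Hd; lra).
  rewrite !Cmod_mult, Cmod_Cexp, !Cmod_R, Re_mult_R.
  rewrite (Rabs_pos_eq (exp _)) by (left; apply exp_pos).
  rewrite !Rmult_assoc, <- !exp_plus.
  destruct (Rle_dec 0 u) as [L|L];
   [eapply Rle_trans; [|apply (H1 u)]|eapply Rle_trans; [|apply (H2 u)]];
   apply Rmult_le_compat_l; try apply Cmod_ge_0; apply exp_le.
  + rewrite Rabs_pos_eq by lra. nra.
  + rewrite Rabs_left by lra. nra.
Qed.

Lemma laplace_half (k : R -> C) (s : C) (b phi : R) : (forall x, rcont k x) ->
 (forall A, exists M, forall u, b <= u -> Cmod (k u) * exp (A * u) <= M * exp (- (1) * u)) ->
 ex_CIg (fun u => k u * Cexp (s * (u, phi)))%C (at_point b) pinf /\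
 ex_CIg (fun u => k u * Cexp (s * (u, phi)) * (u, phi))%C (at_point b) pinf /\
 cdiff (fun z => CIg (fun u => k u * Cexp (z * (u, phi)))%C (at_point b) pinf) s
  (CIg (fun u => k u * Cexp (s * (u, phi)) * (u, phi))%C (at_point b) pinf).
Proof.
 intros Hk HA. destruct (HA (Re s + 1)) as [M HM].
 set (K := exp (- Im s * phi + 2 * Rabs b + Rabs phi)).
 apply cdiff_param with (g := fun u => (K * M) * exp (- (1) * u)) (eta := / 2) (lam := fun u => (u, phi));
  auto; tc.
 - lra.
 - intros x. apply (rcont_hor (fun z => z)). apply Ccont_id.
 - intros x. apply continuous_scal_R, cont_by_derive. auto_derive; auto.
 - apply ex_RInt_gen_scal_R; tc. eexists. apply is_RInt_gen_exp; lra.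
 - apply half_dominated. intros u Hu. specialize (HM u Hu).
  rewrite !Cmod_mult, Cmod_Cexp, Cmod_R.
  rewrite (Rabs_pos_eq (exp _)) by (left; apply exp_pos).
  rewrite !Rmult_assoc, <- !exp_plus.
  apply Rle_trans with (K * (Cmod (k u) * exp ((Re s + 1) * u))).
  + replace (K * (Cmod (k u) * exp ((Re s + 1) * u))) with
    (Cmod (k u) * (K * exp ((Re s + 1) * u))) by ring.
   apply Rmult_le_compat_l; [apply Cmod_ge_0|]. unfold K. rewrite <- exp_plus.
   apply exp_le. rewrite re_mult. simpl.
   assert (N := Cmod_le_sum (u, phi)). simpl in N.
   assert (Bu : Rabs u <= u + 2 * Rabs b).
   { unfold Rabs. destruct (Rcase_abs u), (Rcase_abs b); lra. }
   lra.
  + apply Rmult_le_compat_l; auto. left; apply exp_pos.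
Qed.

Lemma param_compact (k lam : R -> C) (s : C) (a b : R) : a <= b ->
 (forall x, rcont k x) -> (forall x, rcont lam x) ->
 ex_CIg (fun u => k u * Cexp (s * lam u))%C (at_point a) (at_point b) /\
 ex_CIg (fun u => k u * Cexp (s * lam u) * lam u)%C (at_point a) (at_point b) /\
 cdiff (fun z => CIg (fun u => k u * Cexp (z * lam u))%C (at_point a) (at_point b)) s
  (CIg (fun u => k u * Cexp (s * lam u) * lam u)%C (at_point a) (at_point b)).
Proof.
 intros Hab Hk Hl.
 destruct (rcont_bounded lam a b) as [L HL]; auto.
 destruct (rcont_bounded (fun u => k u * Cexp (s * lam u))%C a b) as [M HM].
 { intros x _. apply rcont_mult; auto. apply (rcont_comp (fun w => Cexp (s * w))%C lam); auto.
  apply hol_cont. holo. }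
 apply cdiff_param with (g := fun u => M * exp (2 * 1 * L)) (eta := 1);
  auto; tc; try lra.
 - intros x. apply continuous_const.
 - apply (proj2 (ex_RInt_gen_at_point (V := R_CompleteNormedModule) _ a b)).
  apply (@ex_RInt_continuous R_CompleteNormedModule). intros; apply continuous_const.
 - exists (fun x => x = a) (fun x => x = b); [now unfold at_point|now unfold at_point|].
  intros x y -> ->. simpl. split; auto. intros u Hu.
  rewrite Cmod_mult, Cmod_R, (Rabs_pos_eq (exp _)) by (left; apply exp_pos).
  apply Rmult_le_compat; [apply Cmod_ge_0|left; apply exp_pos|auto|].
  apply exp_le. specialize (HL u Hu). lra.
Qed.

Lemma exp_exp_half (A beta b : R) : 0 < beta ->
 exists M, 0 < M /\ forall u, b <= u -> exp (A * u - beta * exp u) <= M * exp (- (1) * u).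
Proof.
 intros Hb. set (B := beta * exp b / 4).
 assert (HB : 0 < B) by (unfold B; generalize (exp_pos b); intros; nra).
 exists (exp ((A + 1) * b + (A + 1) ^ 2 / (4 * B))). split; [apply exp_pos|].
 intros u Hu. rewrite <- exp_plus. apply exp_le.
 assert (S := sq_le_exp (u - b) ltac:(lra)).
 assert (E : exp u = exp b * exp (u - b)) by (rewrite <- exp_plus; f_equal; ring).
 assert (L : B * (u - b) ^ 2 <= beta * exp u).
 { unfold B. rewrite E. apply Rmult_le_compat_l with (r := beta * exp b / 4) in S; [|unfold B in HB; lra]. lra. }
 assert (Q : (A + 1) * (u - b) - B * (u - b) ^ 2 <= (A + 1) ^ 2 / (4 * B)).
 { apply Rmult_le_reg_r with (4 * B); [lra|].
  replace ((A + 1) ^ 2 / (4 * B) * (4 * B)) with ((A + 1) ^ 2) by (field; lra).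
  assert (P := pow2_ge_0 (2 * B * (u - b) - (A + 1))). nra. }
 lra.
Qed.

Lemma exp_exp_full (A beta : R) : 0 < A -> 0 < beta ->
 exists M, 0 < M /\ forall u, exp (A * u - beta * exp u) <= M.
Proof.
 intros HA Hb. destruct (exp_exp_half A beta 0 Hb) as (M & HM & H).
 exists (M + 1). split; [lra|]. intros u. destruct (Rle_dec 0 u) as [L|L].
 - eapply Rle_trans; [now apply H|].
  assert (E : exp (- (1) * u) <= exp 0) by (apply exp_le; lra). rewrite exp_0 in E. nra.
 - assert (exp (A * u - beta * exp u) <= 1); [|lra].
  rewrite <- exp_0. apply exp_le. generalize (exp_pos u). nra.
Qed.

Lemma CIg_full_lim (f : R -> C) (l : C) : is_CIg f minf pinf l ->
 forall eps, 0 < eps -> exists X, 0 < X /\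
  forall a b, a < - X -> X < b -> Cmod (CI f a b - l)%C < eps.
Proof.
 intros H eps He.
 destruct (proj1 (is_CIg_eps f minf pinf l) H eps He) as [Q S [x1 HQ] [x2 HS] HQS].
 exists (Rmax 1 (Rmax (- x1) x2)).
 assert (R1 := Rmax_l 1 (Rmax (- x1) x2)). assert (R2 := Rmax_r 1 (Rmax (- x1) x2)).
 assert (R3 := Rmax_l (- x1) x2). assert (R4 := Rmax_r (- x1) x2).
 split; [lra|]. intros a b Ha Hb.
 destruct (HQS a b) as (y & Hy & Hl); [apply HQ; lra|apply HS; lra|].
 simpl in *. now rewrite (is_CI_unique _ _ _ _ Hy).
Qed.

Lemma CIg_half_lim (f : R -> C) (b : R) (l : C) : is_CIg f (at_point b) pinf l ->
 forall eps, 0 < eps -> exists X, forall y, X < y -> Cmod (CI f b y - l)%C < eps.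
Proof.
 intros H eps He.
 destruct (proj1 (is_CIg_eps f (at_point b) pinf l) H eps He) as [Q S HQ [x2 HS] HQS].
 exists x2. intros y Hy.
 destruct (HQS b y) as (z & Hz & Hl); [exact HQ|apply HS; lra|].
 simpl in *. now rewrite (is_CI_unique _ _ _ _ Hz).
Qed.

Lemma is_CIg_translate (f : R -> C) (t : R) (l : C) :
 is_CIg f minf pinf l -> is_CIg (fun u => f (u + t)) minf pinf l.
Proof.
 intros H. apply is_CIg_eps; tc. intros eps He.
 destruct (proj1 (is_CIg_eps f minf pinf l) H eps He) as [Q S [x1 HQ] [x2 HS] HQS].
 exists (fun x => x < x1 - t) (fun x => x2 - t < x); [now exists (x1 - t)|now exists (x2 - t)|].
 intros a b Ha Hb. destruct (HQS (a + t) (b + t)) as (y & Hy & Hl); [apply HQ; lra|apply HS; lra|].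
 exists y. split; auto. simpl in *.
 apply (is_RInt_ext (V := C_R_NormedModule) (fun u => scal 1 (f (1 * u + t)))).
 { intros x _. rewrite (@scal_one R_AbsRing C_R_NormedModule). now rewrite Rmult_1_l. }
 apply (@is_RInt_comp_lin C_R_NormedModule). now rewrite !Rmult_1_l.
Qed.

Lemma line_shift (g : C -> C) (p1 p2 c M : R) (l1 l2 : C) : p1 <= p2 -> 0 < c ->
 (forall w, p1 <= Im w <= p2 -> hol g w) ->
 (forall w e, p1 <= Im w <= p2 -> e = c \/ e = - c -> Cmod (g w) * exp (e * Re w) <= M) ->
 is_CIg (fun u => g (u, p1)) minf pinf l1 -> is_CIg (fun u => g (u, p2)) minf pinf l2 ->
 l1 = l2.
Proof.
 intros Hp Hc Hg B0 I1 I2. apply Ceq_minus.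
 apply (Cmod_small_0 _ (2 + 2 * (p2 - p1))). intros e He.
 destruct (CIg_full_lim _ _ I1 e He) as (X1 & HX1 & L1).
 destruct (CIg_full_lim _ _ I2 e He) as (X2 & HX2 & L2).
 destruct (exp_small_p c M e Hc He) as [X3 L3].
 set (R := X1 + X2 + Rabs X3 + 1).
 assert (A3 := Rle_abs X3). assert (A4 := Rabs_pos X3).
 assert (HR : 0 < R) by (unfold R; lra).
 specialize (L1 (- R) R ltac:(unfold R; lra) ltac:(unfold R; lra)).
 specialize (L2 (- R) R ltac:(unfold R; lra) ltac:(unfold R; lra)).
 specialize (L3 R ltac:(unfold R; lra)).
 assert (G := goursat g (- R) R p1 p2 ltac:(lra) Hp ltac:(intros w _ Hw; now apply Hg)).
 assert (Cg : on_rect (Ccont g) (- R) R p1 p2) by (intros w _ Hw; apply hol_cont; now apply Hg).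
 unfold bnd in G.
 assert (V : forall x, x = R \/ x = - R -> Cmod (CI (fun y => g (x, y)) p1 p2) <= (p2 - p1) * e).
 { intros x Hx. apply CI_bound; auto.
  - apply (ex_CI_ver g (- R) R p1 p2 x); auto. lra.
  - intros y Hy. assert (P := exp_pos (- c * R)).
   assert (E : exp (c * R) * exp (- c * R) = 1).
   { apply exp_mul_opp. ring. }
   assert (B : Cmod (g (x, y)) * exp (c * R) <= M).
   { destruct Hx as [-> | ->]; [apply (B0 (R, y) c); auto|].
    replace (c * R) with (- c * - R) by ring. apply (B0 ((- R)%R, y) (- c)); auto. }
   apply Rmult_le_compat_r with (r := exp (- c * R)) in B; [|lra].
   rewrite Rmult_assoc, E in B. lra. }
 assert (V1 := V R ltac:(auto)). assert (V2 := V (- R) ltac:(auto)).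
 set (c1 := CI (fun x => g (x, p1)) (- R) R) in *.
 set (c2 := CI (fun x => g (x, p2)) (- R) R) in *.
 set (v1 := CI (fun y => g (R, y)) p1 p2) in *.
 set (v2 := CI (fun y => g (- R, y)) p1 p2) in *.
 assert (E : (l1 - l2 = (c2 - l2) - (c1 - l1) + Ci * (v2 - v1))%C).
 { replace (c2) with ((c1 + Ci * v1 - Ci * v2) - (c1 + Ci * v1 - c2 - Ci * v2))%C by ring.
  rewrite G. ring. }
 rewrite E. eapply Rle_trans; [apply Cmod_triangle|].
 rewrite Cmod_mult, Cmod_Ci.
 assert (T1 := Cmod_triangle_minus (c2 - l2)%C (c1 - l1)%C).
 assert (T2 := Cmod_triangle_minus v2 v1). lra.
Qed.

(** * Euler's integral in logarithmic coordinates *)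

Definition gamma_ker (b : C) (u : R) : C := Cexp (- (b * Cexp u))%C.
Definition Gamma_int (s b : C) : C := CIg (fun u => gamma_ker b u * Cexp (s * u))%C minf pinf.

Lemma rcont_hol (F : C -> C) (x : R) : hol F x -> rcont (fun u => F u) x.
Proof. intros H. apply (rcont_comp F RtoC); [apply rcont_RtoC|now apply hol_cont]. Qed.

Lemma gamma_ker_cont b x : rcont (gamma_ker b) x.
Proof. apply (rcont_hol (fun z => Cexp (- (b * Cexp z)))%C). holo. Qed.

Lemma gker_add a b u : gamma_ker (a + b)%C u = (gamma_ker a u * gamma_ker b u)%C.
Proof. unfold gamma_ker. rewrite <- Cexp_plus. f_equal. ring. Qed.

Lemma Cmod_gamma_ker b u : Cmod (gamma_ker b u) = exp (- Re b * exp u).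
Proof.
 unfold gamma_ker. rewrite Cmod_Cexp, Cexp_R. f_equal.
 rewrite re_opp, Re_mult_R. ring.
Qed.

Lemma gamma_ker_bound (b : C) (sigma : R) : 0 < sigma -> 0 < Re b ->
 exists M, forall u, Cmod (gamma_ker b u) * exp ((sigma + 4 * (sigma / 8)) * u) <= M /\
  Cmod (gamma_ker b u) * exp ((sigma - 4 * (sigma / 8)) * u) <= M.
Proof.
 intros Hs Hb.
 destruct (exp_exp_full (sigma + 4 * (sigma / 8)) (Re b)) as (M1 & P1 & H1); [lra..|].
 destruct (exp_exp_full (sigma - 4 * (sigma / 8)) (Re b)) as (M2 & P2 & H2); [lra..|].
 exists (M1 + M2). intros u. specialize (H1 u). specialize (H2 u).
 rewrite Cmod_gamma_ker, <- !exp_plus. unfold Rminus in H1, H2.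
 rewrite Rplus_comm in H1, H2.
 replace (- (Re b * exp u)) with (- Re b * exp u) in H1, H2 by ring.
 unfold Rminus. lra.
Qed.

Lemma Gamma_int_laplace (s b : C) : 0 < Re s -> 0 < Re b ->
 ex_CIg (fun u => gamma_ker b u * Cexp (s * u))%C minf pinf /\ hol (fun z => Gamma_int z b) s.
Proof.
 intros Hs Hb. destruct (gamma_ker_bound b (Re s) Hs Hb) as [M HM].
 destruct (laplace_full (gamma_ker b) s (Re s / 8) M) as (H1 & _ & H2); try lra.
 - apply gamma_ker_cont.
 - intros u; apply (HM u).
 - intros u; apply (HM u).
 - split; auto. eexists. exact H2.
Qed.

Lemma is_CIg_Gamma_int (s b : C) : 0 < Re s -> 0 < Re b ->
 is_CIg (fun u => gamma_ker b u * Cexp (s * u))%C minf pinf (Gamma_int s b).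
Proof. intros Hs Hb. apply CIg_correct; tc. now apply Gamma_int_laplace. Qed.

Lemma Cexp_CLog (b : C) : b <> 0 -> Cexp (CLog b) = b.
Proof.
 intros Hb. assert (Hm := Cmod_pos b Hb).
 assert (Hx : -1 <= Re b / Cmod b <= 1).
 { assert (H := Re_le_Cmod b). apply Rabs_le_between in H.
  split; apply Rmult_le_reg_r with (Cmod b); auto; unfold Rdiv;
   rewrite Rmult_assoc, Rinv_l; lra. }
 assert (Hs : Cmod b * sqrt (1 - (Re b / Cmod b)²) = Rabs (Im b)).
 { rewrite <- (sqrt_Rsqr (Cmod b)) at 1 by lra.
  rewrite <- sqrt_mult_alt by apply Rle_0_sqr.
  rewrite <- sqrt_Rsqr_abs. f_equal. unfold Rsqr.
  replace (Cmod b * Cmod b * (1 - Re b / Cmod b * (Re b / Cmod b)))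
   with (Cmod b ^ 2 - Re b ^ 2) by (field; lra).
  rewrite Cmod2_alt. ring. }
 unfold Cexp, CLog. simpl. rewrite exp_ln by auto.
 assert (Ec : cos (Carg b) = Re b / Cmod b).
 { unfold Carg. destruct Rle_dec; [|rewrite cos_neg]; now apply cos_acos. }
 apply C_eq; simpl; fold (Re b) (Im b).
 - rewrite Ec. field. lra.
 - unfold Carg. destruct Rle_dec as [L|L].
  + rewrite sin_acos, Hs by auto. apply Rabs_pos_eq, L.
  + rewrite sin_neg, sin_acos by auto. rewrite Ropp_mult_distr_r_reverse, Hs.
   rewrite Rabs_left by lra. ring.
Qed.

Lemma Carg_bound (b : C) : 0 < Re b ->
 Rabs (Carg b) < PI / 2 /\ 0 < cos (Carg b).
Proof.
 intros Hb. assert (Hb0 : b <> 0) by (intros ->; simpl in Hb; lra).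
 assert (Hm := Cmod_pos b Hb0).
 assert (Hx : 0 < Re b / Cmod b <= 1).
 { split; [now apply Rdiv_lt_0_compat|]. assert (H := Re_le b).
  apply Rmult_le_reg_r with (Cmod b); auto; unfold Rdiv; rewrite Rmult_assoc, Rinv_l; lra. }
 assert (A : 0 <= acos (Re b / Cmod b) < PI / 2).
 { split; [apply acos_bound|]. rewrite acos_atan by lra. apply atan_bound. }
 assert (B : Rabs (Carg b) < PI / 2).
 { unfold Carg. destruct Rle_dec; [|rewrite Rabs_Ropp]; rewrite Rabs_pos_eq; lra. }
 split; auto. apply Rabs_def2 in B. apply cos_gt_0; lra.
Qed.

Lemma cos_ge_of_abs (v p : R) : Rabs v <= Rabs p -> Rabs p <= PI / 2 -> cos p <= cos v.
Proof.
 intros H1 H2.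
 assert (E : forall x, cos x = cos (Rabs x)).
 { intros x. unfold Rabs. destruct Rcase_abs; auto. now rewrite cos_neg. }
 rewrite (E v), (E p). assert (P := PI_RGT_0).
 destruct (Req_dec (Rabs v) (Rabs p)) as [->|N]; [lra|].
 left. apply cos_decreasing_1; try apply Rabs_pos; lra.
Qed.

Lemma Gamma_int_scale (s b : C) : 0 < Re s -> 0 < Re b ->
 Gamma_int s b = (Gamma_int s 1 * Cexp (- s * CLog b))%C.
Proof.
 intros Hs Hb.
 assert (Hb0 : b <> 0) by (intros ->; simpl in Hb; lra).
 destruct (Carg_bound b Hb) as [HA HC].
 set (al := CLog b). set (p := Carg b) in *.
 set (g := fun w => Cexp (s * w - Cexp w)%C).
 assert (G0 : is_CIg (fun u => g (u, 0)) minf pinf (Gamma_int s 1)).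
 { eapply is_CIg_ext; [tc..| |apply is_CIg_Gamma_int; simpl; auto; lra].
  intros u. unfold g, gamma_ker. cbv beta. change ((u, 0) : C) with (RtoC u).
  rewrite <- Cexp_plus. f_equal. ring. }
 assert (Gp : is_CIg (fun u => g (u, p)) minf pinf (Cexp (s * al) * Gamma_int s b)%C).
 { assert (H := is_CIg_scal (Cexp (s * al)) _ _ _ _ (is_CIg_Gamma_int s b Hs Hb)).
  apply (is_CIg_translate _ (- ln (Cmod b))) in H.
  eapply is_CIg_ext; [tc..| |exact H].
  intros u. cbv beta. unfold g, gamma_ker. rewrite <- !Cexp_plus. f_equal.
  replace ((u, p) : C) with (RtoC (u + - ln (Cmod b)) + al)%C
   by (unfold al, CLog; apply C_eq; simpl; fold p; ring).
  rewrite (Cexp_plus (RtoC _) al). unfold al at 3. rewrite Cexp_CLog by auto. ring. }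
 assert (E : Gamma_int s 1 = (Cexp (s * al) * Gamma_int s b)%C).
 { set (sigma := Re s) in *. set (c := sigma / 8). assert (Hc : 0 < c) by (unfold c; lra).
  destruct (exp_exp_full (sigma + c) (cos p)) as (M1 & P1 & H1); [lra..|].
  destruct (exp_exp_full (sigma - c) (cos p)) as (M2 & P2 & H2); [unfold c; lra|lra|].
  set (K := exp (Rabs (Im s) * Rabs p)).
  assert (Bg : forall w d, Rabs (Im w) <= Rabs p ->
   Cmod (g w) * exp (d * Re w) <= K * exp ((sigma + d) * Re w - cos p * exp (Re w))).
  { intros [u v] d Hv. simpl in Hv. unfold g. rewrite Cmod_Cexp. simpl.
   fold (Re s) (Im s). fold sigma. unfold K. rewrite <- !exp_plus. apply exp_le.
   assert (C1 := cos_ge_of_abs v p Hv ltac:(lra)).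
   assert (T : Im s * v >= - (Rabs (Im s) * Rabs p)).
   { assert (A := Rle_abs (- (Im s * v))). rewrite Rabs_Ropp, Rabs_mult in A.
    assert (B := Rabs_pos (Im s)). nra. }
   assert (P := exp_pos u). nra. }
  assert (HK : 0 < K) by apply exp_pos.
  assert (H' : forall w e, Rabs (Im w) <= Rabs p -> e = c \/ e = - c ->
   Cmod (g w) * exp (e * Re w) <= K * (M1 + M2)).
  { intros w e Hw He. eapply Rle_trans; [now apply Bg|]. apply Rmult_le_compat_l; [lra|].
   specialize (H1 (Re w)). specialize (H2 (Re w)).
   destruct He as [-> | ->]; [lra|]. change (sigma + - c) with (sigma - c). lra. }
  assert (Hg : forall w, hol g w) by (intros w; unfold g; holo).
  assert (Ab : forall w p1 p2, (p1 = 0 /\ p2 = p) \/ (p1 = p /\ p2 = 0) ->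
   p1 <= Im w <= p2 -> Rabs (Im w) <= Rabs p).
  { intros w p1 p2 Hp Hw. unfold Rabs. destruct (Rcase_abs (Im w)), (Rcase_abs p); lra. }
  destruct (Rle_dec 0 p) as [L|L].
  - apply (line_shift g 0 p c (K * (M1 + M2))); auto.
   intros w e Hw. apply H', (Ab w 0 p); auto.
  - symmetry. apply (line_shift g p 0 c (K * (M1 + M2))); auto; try lra.
   intros w e Hw. apply H', (Ab w p 0); auto. }
 rewrite E. replace (- s * al)%C with (- (s * al))%C by ring. rewrite Cexp_opp.
 field. apply Cexp_neq_0.
Qed.

Lemma is_CI_primitive (G g : C -> C) (a b : R) :
 (forall x : R, cdiff G x (g x)) -> (forall x : R, Ccont g x) ->
 is_CI (fun u => g u) a b (G b - G a)%C.
Proof.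
 intros HG Hg.
 assert (E : forall x : R, (0 + 1 * x)%C = x) by (intros; ring).
 assert (H := is_CI_derive_line G g 0 1 a b).
 rewrite !E in H. eapply is_CI_ext; [|apply H].
 - intros t. cbv beta. rewrite E. ring.
 - intros x _. rewrite E. auto.
 - intros x _. rewrite E. auto.
Qed.

Lemma Gamma_int_succ (s : C) : 0 < Re s -> Gamma_int (s + 1)%C 1 = (s * Gamma_int s 1)%C.
Proof.
 intros Hs.
 assert (Hs1 : 0 < Re (s + 1)%C) by (simpl; fold (Re s); lra).
 assert (H1 : 0 < Re 1) by (simpl; lra).
 assert (I : is_CIg (fun u => s * (gamma_ker 1 u * Cexp (s * u)) - gamma_ker 1 u * Cexp ((s + 1) * u))%C
  minf pinf (s * Gamma_int s 1 - Gamma_int (s + 1) 1)%C).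
 { apply is_CIg_minus; tc.
  - apply is_CIg_scal; tc. now apply is_CIg_Gamma_int.
  - now apply is_CIg_Gamma_int. }
 set (G := fun z => (Cexp (- (1 * Cexp z)) * Cexp (s * z))%C).
 assert (J : is_CIg (fun u => s * (gamma_ker 1 u * Cexp (s * u)) - gamma_ker 1 u * Cexp ((s + 1) * u))%C
  minf pinf (0 - 0)%C).
 { destruct (gamma_ker_bound 1 (Re s) Hs H1) as [M HM].
  set (c := Re s + 4 * (Re s / 8)) in *. set (c' := Re s - 4 * (Re s / 8)) in *.
  assert (Bd : forall u d, (forall v, Cmod (gamma_ker 1 v) * exp ((Re s + d) * v) <= M) ->
   Cmod (G (RtoC u)) <= M * exp (- d * u)).
  { intros u d Hd. specialize (Hd u). unfold G. rewrite Cmod_mult.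
   change (Cexp (- (1 * Cexp u)))%C with (gamma_ker 1 u).
   rewrite Cmod_Cexp, Re_mult_R.
   replace (exp (Re s * u)) with (exp ((Re s + d) * u) * exp (- d * u))
    by (rewrite <- exp_plus; f_equal; ring).
   rewrite <- Rmult_assoc. apply Rmult_le_compat_r; [left; apply exp_pos|auto]. }
  apply (is_CIg_FTC (fun u => G u) _ 0 0 M (Re s / 2) M (Re s / 2)); try lra.
  - intros a b.
   apply (is_CI_primitive G (fun z => s * (Cexp (- (1 * Cexp z)) * Cexp (s * z))
    - Cexp (- (1 * Cexp z)) * Cexp ((s + 1) * z))%C).
   + intros x. eapply cdiff_eq.
    2:{ unfold G. apply cdiff_mult.
     - apply (cdiff_comp Cexp (fun z => - (1 * Cexp z))%C).
      + apply cdiff_ext with (fun z => (- (1)) * Cexp z)%C; [intros; ring|].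
       apply cdiff_mult; [apply cdiff_const|apply cdiff_Cexp].
      + apply cdiff_Cexp.
     - apply (cdiff_comp Cexp (fun z => s * z)%C).
      + apply cdiff_mult; [apply cdiff_const|apply cdiff_id].
      + apply cdiff_Cexp. }
    replace ((s + 1) * x)%C with (s * x + x)%C by ring. rewrite (Cexp_plus (s * x)%C). ring.
   + intros x. apply hol_cont. holo.
  - intros u. replace (G u - 0)%C with (G u) by ring.
   replace (Re s / 2 * u) with (- - (Re s / 2) * u) by ring. apply Bd. intros v.
   replace (Re s + - (Re s / 2)) with c' by (unfold c'; field). apply HM.
  - intros u. replace (G u - 0)%C with (G u) by ring. apply Bd. intros v.
   replace (Re s + Re s / 2) with c by (unfold c; field). apply HM. }
 apply CIg_unique in I; tc. apply CIg_unique in J; tc.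
 rewrite I in J. symmetry. apply Ceq_minus. rewrite J. ring.
Qed.

Lemma Gamma_int_1 : Gamma_int 1 1 = 1.
Proof.
 assert (J : is_CIg (fun u => gamma_ker 1 u * Cexp (1 * u))%C minf pinf (0 - (- (1)))%C).
 { apply (is_CIg_FTC (fun u => - (1) * Cexp (- (1 * Cexp u)))%C _ _ _ 1 1 1 1); try lra.
  - intros a b.
   apply (is_CI_primitive (fun z => - (1) * Cexp (- (1 * Cexp z)))%C
    (fun z => Cexp (- (1 * Cexp z)) * Cexp (1 * z))%C).
   + intros x. eapply cdiff_eq.
    2:{ apply cdiff_mult; [apply cdiff_const|].
      apply (cdiff_comp Cexp (fun z => - (1 * Cexp z))%C).
      + apply cdiff_ext with (fun z => (- (1)) * Cexp z)%C; [intros; ring|].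
       apply cdiff_mult; [apply cdiff_const|apply cdiff_Cexp].
      + apply cdiff_Cexp. }
    rewrite (Cmult_1_l x). ring.
   + intros x. apply hol_cont. holo.
  - intros u. rewrite !Rmult_1_l.
   replace (- (1) * Cexp (- (1 * Cexp u)) - - (1))%C with (RtoC (1 - exp (- exp u))).
   2:{ rewrite Cmult_1_l, Cexp_R, <- (RtoC_opp (exp u)), Cexp_R, RtoC_minus. ring. }
   rewrite Cmod_R. assert (E := exp_ineq1_le (- exp u)). assert (P := exp_pos u).
   assert (E' : exp (- exp u) <= exp 0) by (apply exp_le; lra). rewrite exp_0 in E'.
   rewrite Rabs_pos_eq; lra.
  - intros u. replace (- (1) * Cexp (- (1 * Cexp u)) - 0)%C with (- gamma_ker 1 u)%C by (unfold gamma_ker; ring).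
   rewrite Cmod_opp, Cmod_gamma_ker, Rmult_1_l. simpl.
   apply exp_le. generalize (exp_ge_id u). lra. }
 apply CIg_unique in J; tc. unfold Gamma_int. rewrite J. ring.
Qed.

Lemma Gamma_int_fact (n : nat) : Gamma_int (INR (n + 1)) 1 = (INR (fact n)).
Proof.
 induction n as [|n IH].
 - simpl. apply Gamma_int_1.
 - replace (RtoC (INR (S n + 1))) with ((INR (n + 1)) + 1)%C.
  2:{ rewrite <- RtoC_plus. f_equal. rewrite <- S_INR. reflexivity. }
  rewrite Gamma_int_succ, IH.
  + rewrite <- RtoC_mult. f_equal. change (fact (S n)) with (S n * fact n)%nat.
   now rewrite mult_INR, Nat.add_1_r.
  + unfold Re. simpl fst. apply lt_0_INR. lia.
Qed.

(** * The reflection formula *)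

Definition beta_ker (u : R) : C := (/ (1 + Cexp u))%C.
Definition Beta_int (s : C) : C := CIg (fun u => beta_ker u * Cexp (s * u))%C minf pinf.

Lemma beta_ker_R u : beta_ker u = RtoC (/ (1 + exp u)).
Proof.
 unfold beta_ker. rewrite Cexp_R, <- RtoC_plus, <- RtoC_inv; auto. apply one_plus_exp_neq.
Qed.

Lemma one_plus_Cexp_R u : (1 + Cexp (RtoC u))%C <> 0.
Proof.
 rewrite Cexp_R, <- RtoC_plus. intros E. apply RtoC_inj in E. now apply one_plus_exp_neq in E.
Qed.

Lemma beta_ker_cont x : rcont beta_ker x.
Proof.
 apply (rcont_hol (fun z => / (1 + Cexp z))%C). holo. apply one_plus_Cexp_R.
Qed.

Lemma Cmod_beta_ker u : Cmod (beta_ker u) = / (1 + exp u).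
Proof.
 rewrite beta_ker_R, Cmod_R, Rabs_pos_eq; auto. left. apply Rinv_0_lt_compat.
 generalize (exp_pos u). lra.
Qed.

Lemma ln_one_plus_exp (u : R) : 0 <= ln (1 + exp u).
Proof. rewrite <- ln_1. left. apply ln_increasing; generalize (exp_pos u); lra. Qed.

Lemma beta_ker_bound (A u d : R) : 0 <= d -> d <= A <= 1 - d ->
 / (1 + exp u) * exp (d * ln (1 + exp u)) * exp (A * u) <= 1.
Proof.
 intros Hd HA. assert (P := exp_pos u).
 rewrite <- (exp_ln (/ (1 + exp u))) by (apply Rinv_0_lt_compat; lra).
 rewrite ln_Rinv by lra. rewrite <- !exp_plus.
 apply Rle_trans with (exp 0); [apply exp_le|rewrite exp_0; lra].
 assert (L1 := ln_one_plus_exp u).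
 assert (L2 : u <= ln (1 + exp u)).
 { rewrite <- (ln_exp u) at 1. left. apply ln_increasing; lra. }
 destruct (Rle_dec 0 u); nra.
Qed.

Lemma rcont_term (s : C) x : rcont (fun u => beta_ker u * Cexp (s * u))%C x.
Proof.
 apply rcont_mult; [apply beta_ker_cont|]. apply (rcont_hol (fun z => Cexp (s * z))%C). holo.
Qed.

Lemma strip_margin (s : C) : 0 < Re s < 1 ->
 exists c, 0 < c /\ 2 * c <= Re s /\ 2 * c <= 1 - Re s.
Proof.
 intros Hs. exists (Rmin (Re s) (1 - Re s) / 2).
 assert (H1 := Rmin_l (Re s) (1 - Re s)). assert (H2 := Rmin_r (Re s) (1 - Re s)).
 assert (0 < Rmin (Re s) (1 - Re s)) by (apply Rmin_glb_lt; lra). lra.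
Qed.

Lemma exp_decay_twist (s : C) (theta : R -> C) (c K : R) :
 0 < c -> 2 * c <= Re s -> 2 * c <= 1 - Re s -> 0 <= K ->
 (forall u, Cmod (theta u) <= K * exp (c * ln (1 + exp u))) ->
 exp_decay (fun u => beta_ker u * Cexp (s * u) * theta u)%C c K.
Proof.
 intros Hc H1 H2 HK H u e He. assert (He' : - c <= e <= c) by (destruct He; lra).
 rewrite !Cmod_mult, Cmod_beta_ker, Cmod_Cexp, Re_mult_R.
 assert (B := beta_ker_bound (Re s + e) u c ltac:(lra) ltac:(lra)).
 assert (P : 0 < / (1 + exp u)) by (apply Rinv_0_lt_compat; generalize (exp_pos u); lra).
 rewrite Rmult_plus_distr_r, exp_plus in B.
 assert (P1 := exp_pos (Re s * u)). assert (P2 := exp_pos (e * u)).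
 assert (P3 : 0 < / (1 + exp u) * exp (Re s * u) * exp (e * u)).
 { repeat apply Rmult_lt_0_compat; auto. }
 specialize (H u).
 apply Rmult_le_compat_l with (r := / (1 + exp u) * exp (Re s * u) * exp (e * u)) in H; [|lra].
 apply Rmult_le_compat_l with (r := K) in B; lra.
Qed.

Lemma exp_decay_twist_const (s : C) (theta : R -> C) (c K : R) :
 0 < c -> 2 * c <= Re s -> 2 * c <= 1 - Re s -> (forall u, Cmod (theta u) <= K) ->
 exp_decay (fun u => beta_ker u * Cexp (s * u) * theta u)%C c K.
Proof.
 intros Hc H1 H2 H. assert (HK : 0 <= K) by (eapply Rle_trans; [apply Cmod_ge_0|apply (H 0)]).
 apply exp_decay_twist; auto. intros u. eapply Rle_trans; [apply H|].
 assert (L : exp 0 <= exp (c * ln (1 + exp u))).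
 { apply exp_le. generalize (ln_one_plus_exp u). nra. }
 rewrite exp_0 in L. nra.
Qed.

Lemma is_CIg_Beta_int (s : C) : 0 < Re s < 1 ->
 is_CIg (fun u => beta_ker u * Cexp (s * u))%C minf pinf (Beta_int s).
Proof.
 intros Hs. apply CIg_correct; tc. destruct (strip_margin s Hs) as (c & Hc & c1 & c2).
 apply ex_CIg_full with c 1; auto.
 - apply rcont_term.
 - intros u e He. rewrite <- (Cmult_1_r (beta_ker u * _)).
  apply (exp_decay_twist_const s (fun _ => RtoC 1) c 1); auto. intros _. rewrite Cmod_1. lra.
Qed.

Definition Phi (s lam : C) : C :=
 CIg (fun u => beta_ker u * Cexp (s * u) * Cexp (lam * (- (1 + Cexp u))))%C minf pinf.

Lemma Cmod_one_plus u : Cmod (- (1 + Cexp (RtoC u)))%C = 1 + exp u.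
Proof.
 rewrite Cmod_opp, Cexp_R, <- RtoC_plus, Cmod_R, Rabs_pos_eq; auto.
 generalize (exp_pos u). lra.
Qed.

Lemma CLog_pos (x : R) : 0 < x -> CLog x = (ln x).
Proof.
 intros Hx. unfold CLog, Carg. rewrite Cmod_R, Rabs_pos_eq by lra.
 change (Im x) with 0. change (Re x) with x.
 destruct Rle_dec; [|lra]. replace (x / x) with 1 by (field; lra). now rewrite acos_1.
Qed.

Lemma Phi_deriv (s : C) (lam : R) : 0 < Re s < 1 -> 0 < lam ->
 is_CIg (fun u => beta_ker u * Cexp (s * u) * Cexp (lam * (- (1 + Cexp u))))%C
  minf pinf (Phi s lam) /\
 cdiff (Phi s) lam (- (Cexp (- lam) * (Gamma_int s 1 * Cexp (- s * (ln lam)))))%C.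
Proof.
 intros Hs Hl.
 destruct (strip_margin s Hs) as (c & Hc & c1 & c2).
 destruct (cdiff_param minf pinf (fun u => beta_ker u * Cexp (s * u))%C
  (fun u => - (1 + Cexp u))%C (fun u => (4 * 1) * logistic c u) lam (lam / 2))
  as (H1 & H2 & H3).
 - lra.
 - apply rcont_term.
 - intros x. apply (rcont_hol (fun z => - (1 + Cexp z))%C). holo.
 - intros x. apply continuous_scal_R, logistic_cont.
 - now apply ex_logistic.
 - apply full_dominated; auto. intros u d He. rewrite <- (Cmult_assoc (beta_ker u * _)).
  apply (exp_decay_twist_const s (fun u => Cexp (lam * - (1 + Cexp u)) *
   exp (2 * (lam / 2) * Cmod (- (1 + Cexp u))))%C c 1); auto.
  intros v. rewrite Cmod_mult, Cmod_R, Cmod_one_plus, Cmod_Cexp.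
  rewrite (Rabs_pos_eq (exp _)) by (left; apply exp_pos).
  rewrite re_scal_l, Cexp_R.
  replace (Re (- (1 + RtoC (exp v)))%C) with (- (1 + exp v)) by (simpl; ring).
  right. apply exp_mul_opp. field.
 - split; [now apply CIg_correct; tc|].
  eapply cdiff_eq; [|exact H3].
  apply CIg_unique; tc.
  assert (G := is_CIg_Gamma_int s lam ltac:(lra) ltac:(simpl; lra)).
  apply (is_CIg_scal (- Cexp (- lam))%C) in G; tc.
  rewrite Gamma_int_scale, CLog_pos in G by (simpl; lra).
  eapply is_CIg_eq; [|instantiate (1 := (- Cexp (- lam) * (Gamma_int s 1 * Cexp (- s * ln lam)))%C); ring].
  eapply is_CIg_ext; [tc..| |exact G].
  intros u. cbv beta. unfold gamma_ker, beta_ker.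
  replace (lam * - (1 + Cexp u))%C with (- lam + - (lam * Cexp u))%C by ring.
  rewrite Cexp_plus. field. apply one_plus_Cexp_R.
Qed.

Lemma min1_le_power (y d : R) : 0 < y -> 0 <= d <= 1 -> 1 - exp (- y) <= exp (d * ln y).
Proof.
 intros Hy Hd. destruct (Rle_dec 1 y) as [L|L].
 - assert (0 <= ln y).
  { rewrite <- ln_1. destruct (Rle_lt_or_eq_dec 1 y L) as [H| <-]; [left; apply ln_increasing; lra|lra]. }
  assert (E : exp 0 <= exp (d * ln y)) by (apply exp_le; nra). rewrite exp_0 in E.
  generalize (exp_pos (- y)). lra.
 - assert (ln y < 0) by (rewrite <- ln_1; apply ln_increasing; lra).
  assert (E : exp (ln y) <= exp (d * ln y)) by (apply exp_le; nra). rewrite exp_ln in E by auto.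
  generalize (exp_ineq1_le (- y)). lra.
Qed.

Lemma Phi_near_0 (s : C) : 0 < Re s < 1 -> exists d K, 0 < d /\ forall v : R,
 Cmod (Phi s (exp v) - Beta_int s)%C <= K * exp (d * v).
Proof.
 intros Hs. destruct (strip_margin s Hs) as (d & Hd & d1 & d2).
 exists d, (4 / d). split; auto. intros v. assert (Pv := exp_pos v).
 assert (I : is_CIg (fun u => beta_ker u * Cexp (s * u) * (Cexp (exp v * - (1 + Cexp u)) - 1))%C minf pinf
   (Phi s (exp v) - Beta_int s)%C).
 { eapply is_CIg_ext; [tc..| |apply is_CIg_minus; [tc..|now apply Phi_deriv|now apply is_CIg_Beta_int]].
  intros u. cbv beta. ring. }
 replace (4 / d * exp (d * v)) with (4 * exp (d * v) / d) by (field; lra).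
 refine (CIg_full_bound _ d (exp (d * v)) _ Hd _ I).
 apply exp_decay_twist; auto; [left; apply exp_pos|]. intros u. assert (P := exp_pos u).
 set (y := exp v * (1 + exp u)). assert (Hy : 0 < y) by (unfold y; nra).
 replace (exp v * - (1 + Cexp u))%C with (RtoC (- y)).
 2:{ unfold y. rewrite Cexp_R, RtoC_opp, RtoC_mult, RtoC_plus. ring. }
 rewrite Cexp_R, <- RtoC_minus, Cmod_R.
 assert (E1 : exp (- y) <= exp 0) by (apply exp_le; lra). rewrite exp_0 in E1.
 rewrite Rabs_left1 by lra.
 assert (E2 := min1_le_power y d Hy ltac:(lra)).
 replace (exp (d * ln y)) with (exp (d * v) * exp (d * ln (1 + exp u))) in E2; [lra|].
 unfold y. rewrite ln_mult, ln_exp by lra. rewrite <- exp_plus. f_equal. ring.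
Qed.

Lemma Phi_near_inf (s : C) : 0 < Re s < 1 -> exists K, forall v : R,
 Cmod (Phi s (exp v)) <= K * exp (- (1) * v).
Proof.
 intros Hs. destruct (strip_margin s Hs) as (c & Hc & c1 & c2).
 exists (4 / c). intros v. assert (Pv := exp_pos v).
 replace (4 / c * exp (- (1) * v)) with (4 * exp (- (1) * v) / c) by (field; lra).
 refine (CIg_full_bound _ c (exp (- (1) * v)) _ Hc _ (proj1 (Phi_deriv s (exp v) Hs Pv))).
 apply exp_decay_twist_const; auto. intros u.
 rewrite Cmod_Cexp, re_scal_l, Cexp_R. apply exp_le.
 replace (Re (- (1 + RtoC (exp u)))%C) with (- (1 + exp u)) by (simpl; ring).
 assert (P := exp_pos u). assert (P' := exp_ge_id v). nra.
Qed.

(* [Phi s] interpolates between [Beta_int s] at 0 and 0 at infinity, and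
  [d/dv (Phi s (exp v))] is, up to [- Gamma_int s 1], the integrand of [Gamma_int (1 - s) 1]:
  this plays the role of Fubini's theorem. *)
Lemma Gamma_int_Beta_int (s : C) : 0 < Re s < 1 -> (Gamma_int s 1 * Gamma_int (1 - s) 1)%C = Beta_int s.
Proof.
 intros Hs.
 assert (Hs' : 0 < Re (1 - s)%C) by (simpl; fold (Re s); lra).
 assert (I : is_CIg (fun u => - Gamma_int s 1 * (gamma_ker 1 u * Cexp ((1 - s) * u)))%C minf pinf
  (- Gamma_int s 1 * Gamma_int (1 - s) 1)%C).
 { apply is_CIg_scal; tc. apply is_CIg_Gamma_int; auto. simpl; lra. }
 destruct (Phi_near_0 s Hs) as (d & K & Hd & H0). destruct (Phi_near_inf s Hs) as (K' & H1).
 assert (J : is_CIg (fun u => - Gamma_int s 1 * (gamma_ker 1 u * Cexp ((1 - s) * u)))%C minf pinf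
  (0 - Beta_int s)%C).
 { apply (is_CIg_FTC (fun v => Phi s (Cexp v)) _ _ _ K d K' 1); [exact Hd|lra| | |].
  - intros a b. apply (is_CI_primitive (fun z => Phi s (Cexp z))
    (fun z => - Gamma_int s 1 * (Cexp (- (1 * Cexp z)) * Cexp ((1 - s) * z)))%C).
   + intros x. eapply cdiff_eq.
    2:{ apply (cdiff_comp (Phi s) Cexp); [apply cdiff_Cexp|].
      rewrite Cexp_R. apply Phi_deriv; auto. apply exp_pos. }
    rewrite ln_exp, <- Cexp_R, (Cmult_1_l (Cexp _)).
    replace ((1 - s) * x)%C with (x + - s * x)%C by ring.
    rewrite (Cexp_plus x). ring.
   + intros x. apply hol_cont. holo.
  - intros x. rewrite Cexp_R. apply H0.
  - intros x. rewrite Cexp_R. replace (Phi s (exp x) - 0)%C with (Phi s (exp x)) by ring.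
   apply H1. }
 apply CIg_unique in I; tc. apply CIg_unique in J; tc.
 rewrite J in I.
 replace (Beta_int s) with (- (0 - Beta_int s))%C by ring. rewrite I. ring.
Qed.

Lemma cos_eq_m1 (y : R) : 0 <= y <= 2 * PI -> cos y = -1 -> y = PI.
Proof.
 intros Hy E. rewrite <- cos_PI in E.
 destruct (Rtotal_order y PI) as [L|[L|L]]; auto; exfalso.
 - assert (cos PI < cos y) by (apply cos_decreasing_1; lra). lra.
 - assert (cos PI < cos y) by (apply cos_increasing_1; lra). lra.
Qed.

Lemma one_plus_Cexp_zero (w : C) : 0 <= Im w <= 2 * PI -> (1 + Cexp w)%C = 0 -> w = (0, PI).
Proof.
 intros Hw E. assert (E1 : Cexp w = (- (1))%C).
 { replace (Cexp w) with ((1 + Cexp w) - 1)%C by ring. rewrite E. ring. }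
 assert (M := Cmod_Cexp w). rewrite E1, Cmod_opp, Cmod_1 in M.
 assert (R0 : Re w = 0) by (apply exp_inv; rewrite exp_0; auto).
 assert (C0 : cos (Im w) = -1).
 { apply (f_equal Re) in E1. unfold Cexp in E1. rewrite R0, exp_0 in E1. simpl in E1. lra. }
 apply C_eq; simpl; auto. now apply cos_eq_m1.
Qed.

Lemma bnd_minus f g x1 x2 y1 y2 : on_bd (Ccont f) x1 x2 y1 y2 ->
 on_bd (Ccont g) x1 x2 y1 y2 -> x1 <= x2 -> y1 <= y2 ->
 bnd (fun z => f z - g z)%C x1 x2 y1 y2 = (bnd f x1 x2 y1 y2 - bnd g x1 x2 y1 y2)%C.
Proof.
 intros Hf Hg Hx Hy.
 rewrite (bnd_ext _ (fun z => f z + (- (1)) * g z)%C); auto; [|intros z _ _ _; ring].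
 rewrite bnd_plus, bnd_scal; auto; [ring|].
 intros z A B D. apply Ccont_mult; [apply Ccont_const|now apply Hg].
Qed.

Lemma is_CI_const (c : C) (a b : R) : is_CI (fun _ => c) a b (RtoC (b - a) * c)%C.
Proof. rewrite <- scal_R_Cmult. apply (@is_RInt_const C_R_NormedModule). Qed.

(* The residue at a common simple zero: the quotient extends continuously. *)
Lemma bnd_quotient (N D : C -> C) x1 x2 y1 y2 p d : x1 < Re p < x2 -> y1 < Im p < y2 ->
 on_rect (hol N) x1 x2 y1 y2 -> on_rect (hol D) x1 x2 y1 y2 ->
 on_rect (fun z => D z = 0 -> z = p) x1 x2 y1 y2 ->
 N p = 0 -> D p = 0 -> cdiff D p d -> d <> 0 ->
 bnd (fun z => N z / D z)%C x1 x2 y1 y2 = 0.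
Proof.
 intros Hx Hy HN HD Hz Np Dp (delta & Cd & <- & Ed) Nd.
 destruct (HN p) as (n & nu & Cn & _ & En); try lra.
 set (F := fun z => match Ceq_dec z p with
  | left _ => (nu p / delta p)%C | right _ => (N z / D z)%C end).
 rewrite (bnd_ext _ F); try lra.
 2:{ intros z A B D'. unfold F. destruct Ceq_dec as [->|]; auto. lra. }
 apply goursat_puncture with p; auto.
 - intros z A B. destruct (Ceq_dec z p) as [->|Nz].
  + assert (Cq : Ccont (fun w => nu w / delta w)%C p).
   { apply Ccont_mult; auto. apply (Ccont_comp Cinv delta); auto. now apply Ccont_inv. }
   destruct (Cd (Cmod (delta p))) as (r & Hr & Hd); [now apply Cmod_pos|].
   apply Ccont_ext_loc with (fun w => nu w / delta w)%C r; auto.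
   intros w Hw. unfold F. destruct (Ceq_dec w p) as [->|Nw]; auto.
   rewrite (En w), (Ed w), Np, Dp.
   assert (delta w <> 0).
   { intros E. specialize (Hd w Hw). rewrite E in Hd.
    replace (0 - delta p)%C with (- delta p)%C in Hd by ring. rewrite Cmod_opp in Hd. lra. }
   assert ((w - p)%C <> 0) by now apply Cminus_eq_contra.
   replace (0 + (w - p) * nu w)%C with ((w - p) * nu w)%C by ring.
   replace (0 + (w - p) * delta w)%C with ((w - p) * delta w)%C by ring. field. auto.
  + apply hol_cont. apply hol_ext_loc with (fun w => N w / D w)%C (Cmod (z - p)%C).
   * apply Cmod_pos. now apply Cminus_eq_contra.
   * intros w Hw. unfold F. destruct (Ceq_dec w p) as [->|]; auto.
    rewrite Cmod_sym in Hw. lra.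
   * apply hol_div; [|now apply HN|now apply HD]. intros E. apply Nz. now apply Hz.
 - intros z A B Nz. apply hol_ext_loc with (fun w => N w / D w)%C (Cmod (z - p)%C).
  + apply Cmod_pos. now apply Cminus_eq_contra.
  + intros w Hw. unfold F. destruct (Ceq_dec w p) as [->|]; auto.
   rewrite Cmod_sym in Hw. lra.
  + apply hol_div; [|now apply HN|now apply HD]. intros E. apply Nz. now apply Hz.
Qed.

Lemma Cexp_2PI : Cexp (RtoC (2 * PI) * Ci)%C = 1.
Proof.
 replace (RtoC (2 * PI) * Ci)%C with (RtoC PI * Ci + RtoC PI * Ci)%C
  by (rewrite RtoC_mult; ring).
 rewrite Cexp_plus, Cexp_Ci_PI. ring.
Qed.

Lemma Cexp_shift_2PI (s : C) (x : R) :
 Cexp (s * (x, (2 * PI)%R))%C = (Cexp (s * (RtoC (2 * PI) * Ci)) * Cexp (s * x))%C.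
Proof.
 rewrite <- Cexp_plus. f_equal.
 replace ((x, (2 * PI)%R) : C) with (x + RtoC (2 * PI) * Ci)%C by (apply C_eq; simpl; ring).
 ring.
Qed.

Lemma Cmod_one_plus_ge (w : C) : Rabs (exp (Re w) - 1) <= Cmod (1 + Cexp w)%C.
Proof.
 rewrite <- (Cmod_Cexp w). apply Rabs_le. 
 assert (T := Cmod_triangle (1 + Cexp w)%C (- (1))%C).
 replace (1 + Cexp w + - (1))%C with (Cexp w) in T by ring. rewrite Cmod_opp, Cmod_1 in T.
 assert (T2 := Cmod_triangle (1 + Cexp w)%C (- Cexp w)%C).
 replace (1 + Cexp w + - Cexp w)%C with (RtoC 1) in T2 by ring. rewrite Cmod_opp, Cmod_1 in T2.
 lra.
Qed.

Lemma one_plus_Cexp_neq_0 (w : C) : Re w <> 0 \/ Im w = 0 \/ Im w = 2 * PI ->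
 (1 + Cexp w)%C <> 0.
Proof.
 intros Hw E. assert (M := Cmod_one_plus_ge w). rewrite E, Cmod_0 in M.
 assert (E0 : exp (Re w) = exp 0).
 { rewrite exp_0. destruct (Req_dec (exp (Re w) - 1) 0) as [|N]; [lra|].
  apply Rabs_pos_lt in N. lra. }
 apply exp_inv in E0. destruct Hw as [Hw|Hw]; [auto|]. assert (P := PI_RGT_0).
 assert (Hw' : 0 <= Im w <= 2 * PI) by lra.
 rewrite (one_plus_Cexp_zero w Hw' E) in Hw. simpl in Hw. lra.
Qed.

Definition strip_fun (s w : C) : C := (Cexp (s * w) / (1 + Cexp w))%C.

Lemma hol_strip_fun (s w : C) : Re w <> 0 \/ Im w = 0 \/ Im w = 2 * PI -> hol (strip_fun s) w.
Proof. intros H. unfold strip_fun. holo. now apply one_plus_Cexp_neq_0. Qed.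

Lemma ex_strip_CI (s : C) (x : R) : 1 <= x \/ x <= -1 ->
 ex_CI (fun y => strip_fun s (x, y)) 0 (2 * PI).
Proof.
 intros Hx. assert (P := PI_RGT_0). apply (ex_CI_ver (strip_fun s) x x 0 (2 * PI) x); try lra.
 intros w A _. apply hol_cont, hol_strip_fun. lra.
Qed.

Lemma strip_CI_bound (s : C) (x m : R) :
 (1 <= x /\ m = (Re s - 1) * x) \/ (x <= -1 /\ m = Re s * x) ->
 Cmod (CI (fun y => strip_fun s (x, y)) 0 (2 * PI)) <=
  4 * PI * exp (2 * PI * Rabs (Im s)) * exp m.
Proof.
 intros Hx. assert (P := PI_RGT_0).
 replace (4 * PI * exp (2 * PI * Rabs (Im s)) * exp m) with
  ((2 * PI - 0) * (exp (2 * PI * Rabs (Im s)) * (2 * exp m))) by ring.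
 apply CI_bound; [lra|apply ex_strip_CI; lra|].
 intros y Hy. unfold strip_fun.
 assert (Nz : (1 + Cexp (x, y))%C <> 0) by (apply one_plus_Cexp_neq_0; simpl; lra).
 assert (Pm := Cmod_pos _ Nz).
 rewrite Cmod_div, Cmod_Cexp by auto.
 assert (G := Cmod_one_plus_ge (x, y)). simpl in G.
 assert (Rx : Re (s * (x, y))%C <= 2 * PI * Rabs (Im s) + Re s * x).
 { rewrite re_mult. simpl. assert (A := Rle_abs (- Im s)). rewrite Rabs_Ropp in A.
  assert (A' := Rabs_pos (Im s)). unfold Re, Im in *. nra. }
 assert (Dn : exp (Re s * x) <= 2 * exp m * Cmod (1 + Cexp (x, y))%C).
 { assert (L := exp_ineq1_le x). assert (L' := exp_ineq1_le (- x)). assert (Q := exp_pos m).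
  destruct Hx as [[Hx ->]|[Hx ->]].
  - rewrite Rabs_pos_eq in G by lra.
   replace (Re s * x) with ((Re s - 1) * x + x) by ring. rewrite exp_plus. nra.
  - assert (E : exp x * exp (- x) = 1).
   { apply exp_mul_opp. ring. }
   assert (exp x <= / 2) by (generalize (exp_pos x); nra).
   rewrite Rabs_left in G by lra. nra. }
 apply Rmult_le_reg_r with (Cmod (1 + Cexp (x, y))%C); auto.
 unfold Rdiv. rewrite Rmult_assoc, Rinv_l, Rmult_1_r by lra.
 eapply Rle_trans; [apply exp_le; exact Rx|]. rewrite exp_plus, (Rmult_assoc (exp _)).
 apply Rmult_le_compat_l; [left; apply exp_pos|lra].
Qed.

(* Integrating [(e^(sw) - c0 e^w) / (1 + e^w)], which is regular at [i PI], around
  [[-X, X] x [0, 2 PI]]: the top side_term is [e^(2 i PI s)] times the bottom one for the first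
  term, while for the second one they cancel and only the right side_term, close to [2 i PI],
  survives. *)
Lemma Beta_int_formula (s : C) : 0 < Re s < 1 ->
 (Beta_int s * (1 - Cexp (s * (RtoC (2 * PI) * Ci))) =
  RtoC (2 * PI) * Ci * Cexp ((s - 1) * (RtoC PI * Ci)))%C.
Proof.
 intros Hs. assert (PI0 := PI_RGT_0).
 set (q := Cexp (s * (RtoC (2 * PI) * Ci))%C).
 set (c0 := Cexp ((s - 1) * (RtoC PI * Ci))%C).
 destruct (strip_margin s Hs) as (d & Hd & d1 & d2).
 assert (Main : forall X, 1 < X -> bnd (strip_fun s) (- X) X 0 (2 * PI) =
  (c0 * bnd (strip_fun 1) (- X) X 0 (2 * PI))%C).
 { intros X HX.
  assert (H1 : forall z, on_bd (Ccont (strip_fun z)) (- X) X 0 (2 * PI)).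
  { intros z w A B D. apply hol_cont, hol_strip_fun. lra. }
  apply Ceq_minus. rewrite <- bnd_scal, <- bnd_minus; auto; try lra.
  2:{ intros w A B D. apply Ccont_mult; [apply Ccont_const|now apply H1]. }
  rewrite (bnd_ext _ (fun w => (Cexp (s * w) - c0 * Cexp w) / (1 + Cexp w))%C); try lra.
  2:{ intros w A B D. unfold strip_fun. rewrite Cmult_1_l. field.
    apply one_plus_Cexp_neq_0. lra. }
  assert (Ep : ((0, PI) : C) = (RtoC PI * Ci)%C) by (apply C_eq; simpl; ring).
  apply bnd_quotient with (0, PI) (- (1))%C; simpl; try lra.
  - intros w A B. holo.
  - intros w A B. holo.
  - intros w A B E. now apply one_plus_Cexp_zero.
  - rewrite Ep. unfold c0. rewrite <- Cexp_plus.
   replace ((s - 1) * (RtoC PI * Ci) + RtoC PI * Ci)%C with (s * (RtoC PI * Ci))%C by ring. ring.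
  - rewrite Ep, Cexp_Ci_PI. ring.
  - rewrite Ep. eapply cdiff_eq; [|apply cdiff_plus; [apply cdiff_const|apply cdiff_Cexp]].
   rewrite Cexp_Ci_PI. ring.
  - intros E. apply (f_equal Re) in E. simpl in E. lra. }
 assert (I := is_CIg_Beta_int s Hs).
 set (K := fun z => 4 * PI * exp (2 * PI * Rabs (Im z))).
 apply Ceq_minus.
 apply (Cmod_small_0 _ (Cmod (1 - q)%C + (2 * K s + Cmod c0 * (K 0 + K 1)))). intros e He.
 destruct (CIg_full_lim _ _ I e He) as (X1 & HX1 & L1).
 destruct (exp_small_p d 1 e Hd He) as [X3 L3].
 set (X := X1 + Rabs X3 + 1).
 assert (A3 := Rle_abs X3). assert (A4 := Rabs_pos X3).
 assert (HX : 1 < X) by (unfold X; lra).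
 specialize (L1 (- X) X ltac:(unfold X; lra) ltac:(unfold X; lra)).
 specialize (L3 X ltac:(unfold X; lra)). rewrite Rmult_1_l in L3.
 specialize (Main X HX). clearbody X.
 assert (V : forall z x m, (1 <= x /\ m = (Re z - 1) * x) \/ (x <= -1 /\ m = Re z * x) ->
  m <= - d * X -> Cmod (CI (fun y => strip_fun z (x, y)) 0 (2 * PI)) <= K z * e).
 { intros z x m Hx Hm. eapply Rle_trans; [apply (strip_CI_bound z x m Hx)|].
  apply Rmult_le_compat_l; [|apply exp_le in Hm; lra].
  apply Rmult_le_pos; [lra|left; apply exp_pos]. }
 assert (W1 := V s X _ ltac:(left; split; [lra|reflexivity]) ltac:(nra)).
 assert (W2 := V s (- X) _ ltac:(right; split; [lra|reflexivity]) ltac:(nra)).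
 assert (W3 := V 1 (- X) _ ltac:(right; split; [lra|reflexivity]) ltac:(simpl; nra)).
 assert (W4 := V 0 X _ ltac:(left; split; [lra|reflexivity]) ltac:(simpl; nra)).
 assert (R2 : CI (fun y => strip_fun 1 (X, y)) 0 (2 * PI) =
  (RtoC (2 * PI) - CI (fun y => strip_fun 0 (X, y)) 0 (2 * PI))%C).
 { apply is_CI_unique.
  replace (RtoC (2 * PI)) with (RtoC (2 * PI - 0) * 1)%C by (rewrite Rminus_0_r; ring).
  eapply is_CI_ext; [|apply is_CI_minus; [apply is_CI_const|apply is_CI_CI, ex_strip_CI; lra]].
  intros t. cbv beta. unfold strip_fun. rewrite Cmult_0_l, Cexp_0, Cmult_1_l. field.
  apply one_plus_Cexp_neq_0. simpl. lra. }
 assert (H1b : CI (fun x => strip_fun s (x, 0)) (- X) X = CI (fun u => beta_ker u * Cexp (s * u))%C (- X) X).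
 { apply CI_ext. intros t _. unfold strip_fun, beta_ker. change ((t, 0) : C) with (RtoC t).
  unfold Cdiv. ring. }
 assert (Per : forall z t, strip_fun z (t, 2 * PI) =
  (Cexp (z * (RtoC (2 * PI) * Ci)) * strip_fun z (t, 0%R))%C).
 { intros z t. unfold strip_fun. rewrite (Cexp_shift_2PI z t).
  replace (Cexp (t, 2 * PI)) with (Cexp (t, 0)).
  2:{ assert (E := Cexp_shift_2PI 1 t). rewrite !Cmult_1_l, Cexp_2PI, Cmult_1_l in E.
    symmetry. exact E. }
  unfold Cdiv. change ((t, 0) : C) with (RtoC t). ring. }
 assert (Ex0 : forall z, ex_CI (fun x => strip_fun z (x, 0)) (- X) X).
 { intros z. apply ex_CI_cont. intros x _. apply rcont_hor, hol_cont, hol_strip_fun. simpl. auto. }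
 assert (Ht : forall z, CI (fun x => strip_fun z (x, 2 * PI)) (- X) X =
  (Cexp (z * (RtoC (2 * PI) * Ci)) * CI (fun x => strip_fun z (x, 0%R)) (- X) X)%C).
 { intros z. rewrite <- CI_scal by apply Ex0. apply CI_ext. intros t _. apply Per. }
 unfold bnd in Main. rewrite !Ht, H1b, Cmult_1_l, Cexp_2PI, Cmult_1_l, R2 in Main. fold q in Main.
 set (b := CI (fun u => beta_ker u * Cexp (s * u))%C (- X) X) in *.
 set (v1 := CI (fun y => strip_fun s (X, y)) 0 (2 * PI)) in *.
 set (v2 := CI (fun y => strip_fun s (- X, y)) 0 (2 * PI)) in *.
 set (u1 := CI (fun y => strip_fun 0 (X, y)) 0 (2 * PI)) in *.
 set (u2 := CI (fun y => strip_fun 1 (- X, y)) 0 (2 * PI)) in *.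
 assert (E : (Beta_int s * (1 - q) - RtoC (2 * PI) * Ci * c0 =
  - ((b - Beta_int s) * (1 - q)) + Ci * (v2 - v1 - c0 * (u1 + u2)))%C).
 { assert (E0 : (b * (1 - q) = Ci * (v2 - v1) + c0 * (Ci * (RtoC (2 * PI) - u1 - u2)))%C).
  { replace (b * (1 - q))%C with ((b + Ci * v1 - q * b - Ci * v2) + Ci * (v2 - v1))%C by ring.
   rewrite Main. ring. }
  replace ((b - Beta_int s) * (1 - q))%C with (b * (1 - q) - Beta_int s * (1 - q))%C by ring.
  rewrite E0. ring. }
 rewrite E. eapply Rle_trans; [apply Cmod_triangle|].
 rewrite Cmod_opp, !Cmod_mult, Cmod_Ci.
 assert (T1 := Cmod_triangle_minus (v2 - v1)%C (c0 * (u1 + u2))%C).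
 rewrite Cmod_mult in T1.
 assert (T2 := Cmod_triangle_minus v2 v1). assert (T3 := Cmod_triangle u1 u2).
 assert (P1 := Cmod_ge_0 c0). assert (P2 := Cmod_ge_0 (1 - q)%C). nra.
Qed.

Definition two_i_sin_pi (s : C) : C :=
 (Cexp (s * (RtoC PI * Ci)) - Cexp (- (s * (RtoC PI * Ci))))%C.

Lemma reflection_strip (s : C) : 0 < Re s < 1 ->
 (Gamma_int s 1 * Gamma_int (1 - s) 1 * two_i_sin_pi s = RtoC (2 * PI) * Ci)%C.
Proof.
 intros Hs. rewrite Gamma_int_Beta_int by auto. assert (E := Beta_int_formula s Hs).
 replace (s * (RtoC (2 * PI) * Ci))%C with (s * (RtoC PI * Ci) + s * (RtoC PI * Ci))%C in E
  by (rewrite RtoC_mult; ring).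
 replace ((s - 1) * (RtoC PI * Ci))%C with (s * (RtoC PI * Ci) - RtoC PI * Ci)%C in E by ring.
 rewrite Cexp_plus, Cexp_minus, Cexp_Ci_PI in E. unfold two_i_sin_pi. rewrite Cexp_opp.
 set (x := Cexp (s * (RtoC PI * Ci))%C) in *.
 assert (Hx : x <> 0) by apply Cexp_neq_0.
 replace (Beta_int s * (x - / x))%C with (- (Beta_int s * (1 - x * x)) / x)%C by (field; auto).
 rewrite E. field. auto.
Qed.

(** * The gamma function *)

Definition not_pole (s : C) : Prop := forall n : nat, s <> (- (INR n))%C.

Lemma not_pole_Im (s : C) : Im s <> 0 -> not_pole s.
Proof. intros H n E. apply H. rewrite E. simpl. ring. Qed.

Lemma not_pole_Re (s : C) : 0 < Re s -> not_pole s.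
Proof. intros H n E. rewrite E in H. simpl in H. generalize (pos_INR n). lra. Qed.

Lemma not_pole_neq (s : C) (n : nat) : not_pole s -> (s + (INR n))%C <> 0.
Proof.
 intros H E. apply (H n). replace s with ((s + (INR n)) - (INR n))%C by ring.
 rewrite E. ring.
Qed.

Fixpoint rising (s : C) (n : nat) : C :=
 match n with O => RtoC 1 | S k => (rising s k * (s + (INR k)))%C end.

Lemma rising_neq_0 s n : not_pole s -> rising s n <> 0.
Proof.
 intros H. induction n as [|n IH]; simpl; [apply C1_nz|].
 apply Cmult_neq_0; auto. now apply not_pole_neq.
Qed.

Lemma hol_rising n s : hol (fun z => rising z n) s.
Proof. induction n as [|n IH]; simpl; holo. exact IH. Qed.

Definition Gamma_n (n : nat) (s : C) : C := (Gamma_int (s + (INR n)) 1 / rising s n)%C.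

Definition shift_of (s : C) : nat := Z.to_nat (up (- Re s)).
Definition Gamma_ext (s : C) : C := Gamma_n (shift_of s) s.

Lemma shift_of_pos s : 0 < Re s + INR (shift_of s).
Proof.
 unfold shift_of. destruct (archimed (- Re s)) as [A _].
 destruct (Z_le_gt_dec 0 (up (- Re s))) as [L|L].
 - rewrite INR_IZR_INZ, Z2Nat.id by auto. lra.
 - assert (IZR (up (- Re s)) <= 0) by (apply IZR_le; lia).
  generalize (pos_INR (Z.to_nat (up (- Re s)))). lra.
Qed.

Lemma Gamma_n_S n s : not_pole s -> 0 < Re s + INR n -> Gamma_n (S n) s = Gamma_n n s.
Proof.
 intros Hs Hn. unfold Gamma_n. rewrite S_INR, RtoC_plus.
 replace (s + ((INR n) + 1))%C with ((s + (INR n)) + 1)%C by ring.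
 rewrite Gamma_int_succ by (simpl; fold (Re s); lra).
 simpl rising. field. split; [now apply rising_neq_0|now apply not_pole_neq].
Qed.

Lemma Gamma_n_eq n s : not_pole s -> 0 < Re s + INR n -> Gamma_n n s = Gamma_ext s.
Proof.
 intros Hs Hn.
 assert (H : forall k m, 0 < Re s + INR m -> Gamma_n (m + k) s = Gamma_n m s).
 { induction k as [|k IH]; intros m Hm; [now rewrite Nat.add_0_r|].
  rewrite Nat.add_succ_r, Gamma_n_S; auto.
  rewrite plus_INR. generalize (pos_INR k). lra. }
 unfold Gamma_ext. assert (Hp := shift_of_pos s).
 rewrite <- (H (shift_of s) n Hn), Nat.add_comm. now apply H.
Qed.

Lemma Gamma_ext_int s : 0 < Re s -> Gamma_ext s = Gamma_int s 1.
Proof.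
 intros Hs. rewrite <- (Gamma_n_eq 0).
 - unfold Gamma_n. simpl. rewrite Cplus_0_r. field.
 - now apply not_pole_Re.
 - simpl. lra.
Qed.

Lemma Gamma_ext_fact (n : nat) : Gamma_ext (INR (n + 1)) = (INR (fact n)).
Proof.
 rewrite Gamma_ext_int; [apply Gamma_int_fact|]. unfold Re. simpl fst. apply lt_0_INR. lia.
Qed.

Lemma not_pole_near (s : C) : not_pole s ->
 exists r, 0 < r /\ forall w, Cmod (w - s)%C < r -> not_pole w.
Proof.
 intros Hs. set (N := S (shift_of s)).
 assert (H : forall n, exists r, 0 < r /\ forall w, Cmod (w - s)%C < r ->
  forall k, (k < n)%nat -> w <> (- (INR k))%C).
 { induction n as [|n (r & Hr & IH)].
  - exists 1. split; [lra|]. intros w _ k Hk. lia.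
  - assert (P := Cmod_pos _ (not_pole_neq s n Hs)).
   exists (Rmin r (Cmod (s + (INR n))%C)). split; [now apply Rmin_glb_lt|].
   intros w Hw k Hk E. destruct (Nat.eq_dec k n) as [->|Nk].
   + assert (H := Rlt_le_trans _ _ _ Hw (Rmin_r _ _)). rewrite E in H.
    rewrite <- Cmod_opp in H.
    replace (- (- (INR n) - s))%C with (s + (INR n))%C in H by ring. lra.
   + assert (H := Rlt_le_trans _ _ _ Hw (Rmin_l _ _)). apply (IH w H k); auto. lia. }
 destruct (H N) as (r & Hr & HN).
 exists (Rmin r 1). split; [apply Rmin_glb_lt; lra|]. intros w Hw k E.
 assert (H1 := Rlt_le_trans _ _ _ Hw (Rmin_l _ _)).
 assert (H2 := Rlt_le_trans _ _ _ Hw (Rmin_r _ _)).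
 destruct (lt_dec k N) as [L|L]; [now apply (HN w H1 k)|].
 assert (A := Re_le_Cmod (w - s)%C). rewrite E in A. simpl in A. fold (Re s) in A.
 rewrite <- E in A. assert (B := shift_of_pos s). apply not_lt, le_INR in L.
 unfold N in L. rewrite S_INR in L. unfold Rabs in A. destruct Rcase_abs in A; lra.
Qed.

Lemma hol_Gamma_ext s : not_pole s -> hol Gamma_ext s.
Proof.
 intros Hs. set (n := S (shift_of s)). assert (Hp := shift_of_pos s).
 destruct (not_pole_near s Hs) as (r & Hr & Hw).
 apply hol_ext_loc with (Gamma_n n) (Rmin r 1); [apply Rmin_glb_lt; lra| |].
 - intros w H. apply Gamma_n_eq.
  + apply Hw. eapply Rlt_le_trans; [exact H|apply Rmin_l].
  + assert (H2 := Rlt_le_trans _ _ _ H (Rmin_r _ _)).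
   assert (A := Re_le_Cmod (w - s)%C). simpl in A. fold (Re s) (Re w) in A.
   unfold n. rewrite S_INR. unfold Rabs in A. destruct Rcase_abs in A; lra.
 - unfold Gamma_n. apply hol_div; [now apply rising_neq_0| |apply hol_rising].
  apply (hol_comp (fun z => Gamma_int z 1) (fun z => z + (INR n))%C); [holo|].
  apply Gamma_int_laplace; [|simpl; lra]. change (0 < Re s + INR (S (shift_of s))). rewrite S_INR. lra.
Qed.

Lemma is_RInt_gen_Gamma_int (s : C) : 0 < Re s ->
 is_CIg (fun t : R => (Cexp ((s - 1) * (ln t)) * (exp (- t)))%C)
  (at_right 0) pinf (Gamma_int s 1).
Proof.
 intros Hs. apply is_CIg_eps; tc. intros eps He.
 destruct (CIg_full_lim _ _ (is_CIg_Gamma_int s 1 Hs ltac:(simpl; lra)) eps He) as (X & HX & H).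
 exists (fun t => 0 < t /\ ln t < - X) (fun t => exp X < t).
 - exists (mkposreal (exp (- X)) (exp_pos _)). intros t Ht Ht0. split; auto.
  assert (L : t < exp (- X)).
  { assert (A := Ht). unfold ball in A; simpl in A. unfold AbsRing_ball, abs, minus, plus, opp in A.
   simpl in A. rewrite Rabs_pos_eq in A; lra. }
  rewrite <- (ln_exp (- X)). now apply ln_increasing.
 - now exists (exp X).
 - intros a b [Ha La] Hb. simpl.
  assert (Lb : X < ln b).
  { rewrite <- (ln_exp X). apply ln_increasing; auto. apply exp_pos. }
  assert (Hb0 : 0 < b) by (generalize (exp_pos X); lra).
  exists (CI (fun u => gamma_ker 1 u * Cexp (s * u))%C (ln a) (ln b)). split; [|now apply H].
  assert (Hm : forall t, Rmin a b <= t -> 0 < t).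
  { intros t Ht. apply Rlt_le_trans with (Rmin a b); auto. now apply Rmin_glb_lt. }
  apply (is_RInt_ext (V := C_R_NormedModule)
   (fun t => scal (/ t) (gamma_ker 1 (ln t) * Cexp (s * (ln t)))%C)).
  { intros t Ht. assert (Ht0 : 0 < t) by (apply Hm; lra).
   rewrite scal_R_Cmult. unfold gamma_ker. rewrite Cexp_R, exp_ln, Cmult_1_l by auto.
   replace (- t)%C with (RtoC (- t)) by (now rewrite RtoC_opp). rewrite Cexp_R.
   replace ((s - 1) * (ln t))%C with (s * (ln t) - (ln t))%C by ring.
   rewrite Cexp_minus, Cexp_R, exp_ln by auto. rewrite RtoC_inv by lra. 
   assert (RtoC t <> 0) by (intros E; apply RtoC_inj in E; lra).
   match goal with |- ?x = ?y => change (@eq C x y) end. field. auto. }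
  apply (@is_RInt_comp C_R_CompleteNormedModule (fun u => gamma_ker 1 u * Cexp (s * u))%C ln Rinv).
  + intros x _. apply rcont_mult; [apply gamma_ker_cont|].
   apply (rcont_hol (fun z => Cexp (s * z))%C). holo.
  + intros x [Hx _]. assert (Hx0 := Hm x Hx). split.
   * apply is_derive_Reals. now apply derivable_pt_lim_ln.
   * apply cont_by_derive. auto_derive. lra.
Qed.

Lemma continuation_spec (D U : C -> Prop) (val : C -> C -> Prop) :
 (exists F, holomorphic_on D F /\ forall s, U s -> val s (F s)) ->
 holomorphic_on D (analytic_continuation D U val) /\
 forall s, U s -> val s (analytic_continuation D U val s).
Proof.
 intros H. unfold analytic_continuation.
 exact (epsilon_spec (inhabits (fun _ : C => RtoC 0))
  (fun F => holomorphic_on D F /\ forall s, U s -> val s (F s)) H).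
Qed.

Lemma Gamma_Gamma_ext s : not_pole s -> Gamma s = Gamma_ext s.
Proof.
 intros Hs.
 assert (S : holomorphic_on (fun s => forall n : nat, s <> (- (INR n))%C) Gamma /\
  forall s, 0 < Re s ->
   is_CIg (fun t : R => (Cexp ((s - 1) * (ln t)) * (exp (- t)))%C)
     (at_right 0) pinf (Gamma s)).
 { apply (continuation_spec (fun s => forall n : nat, s <> (- (INR n))%C) (fun s => 0 < Re s)
   (fun s v => is_CIg (fun t : R => (Cexp ((s - 1) * (ln t)) * (exp (- t)))%C)
     (at_right 0) pinf v)).
  exists Gamma_ext. split.
  - intros z Hz. apply hol_ex_derive. now apply hol_Gamma_ext.
  - intros z Hz. rewrite Gamma_ext_int by auto. now apply is_RInt_gen_Gamma_int. }
 destruct S as [S1 S2].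
 assert (HG : forall z, not_pole z -> hol Gamma z) by (intros z Hz; apply hol_ex_derive; now apply S1).
 apply (continuation_unique Gamma Gamma_ext 1 2); auto; try lra.
 - intros z Hz. apply HG. now apply not_pole_Im.
 - intros z Hz. apply hol_Gamma_ext. now apply not_pole_Im.
 - intros z Hz _. rewrite Gamma_ext_int by lra.
  assert (Hz0 : 0 < Re z) by lra.
  rewrite <- (CIg_unique _ (at_right 0) pinf _ (S2 z Hz0)).
  apply CIg_unique; tc. now apply is_RInt_gen_Gamma_int.
 - now apply hol_Gamma_ext.
Qed.

Lemma reflection (s : C) : not_pole s -> not_pole (1 - s)%C ->
 (Gamma_ext s * Gamma_ext (1 - s) * two_i_sin_pi s = RtoC (2 * PI) * Ci)%C.
Proof.
 intros H1 H2.
 assert (HF : forall z, not_pole z -> not_pole (1 - z)%C ->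
  hol (fun z => Gamma_ext z * Gamma_ext (1 - z) * two_i_sin_pi z)%C z).
 { intros z A B. unfold two_i_sin_pi. apply hol_mult; [apply hol_mult; [now apply hol_Gamma_ext|]|holo].
  apply (hol_comp Gamma_ext (fun z => 1 - z)%C); [holo|now apply hol_Gamma_ext]. }
 apply (continuation_unique (fun z => Gamma_ext z * Gamma_ext (1 - z) * two_i_sin_pi z)%C
  (fun _ => RtoC (2 * PI) * Ci)%C 0 1); auto; try lra; try (intros; apply hol_const).
 - intros z Hz. apply HF; apply not_pole_Im; auto. simpl. fold (Im z). lra.
 - intros z Hz _. rewrite !Gamma_ext_int; [now apply reflection_strip|simpl; fold (Re z); lra|lra].
Qed.

Lemma RtoC_neq_0 (x : R) : x <> 0 -> RtoC x <> 0.
Proof. intros H E. apply H. now apply RtoC_inj. Qed.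

Lemma two_pi_i_neq_0 : (RtoC (2 * PI) * Ci)%C <> 0.
Proof.
 apply Cmult_neq_0; [|apply Ci_nz]. apply RtoC_neq_0. generalize PI_RGT_0. lra.
Qed.

Lemma Gamma_ext_neq_0 (s : C) : not_pole s -> Gamma_ext s <> 0.
Proof.
 intros Hs E. destruct (classic (not_pole (1 - s)%C)) as [H|H].
 - assert (R := reflection s Hs H). rewrite E in R. apply two_pi_i_neq_0.
  rewrite <- R. ring.
 - apply not_all_ex_not in H. destruct H as [n Hn]. apply NNPP in Hn.
  assert (Es : s = (INR (n + 1))).
  { replace s with (1 - (1 - s))%C by ring. rewrite Hn, plus_INR, RtoC_plus. simpl. ring. }
  rewrite Es, Gamma_ext_fact in E. apply RtoC_inj in E. now apply (INR_fact_neq_0 n).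
Qed.

(** * The Hurwitz series *)

Definition hurwitz_ker (a : C) (u : R) : C := (gamma_ker a u / (1 - gamma_ker 1 u))%C.
Definition hurwitz_int (s a : C) : C := CIg (fun u => hurwitz_ker a u * Cexp (s * u))%C minf pinf.

Lemma gamma_ker_1_R u : gamma_ker 1 u = (exp (- exp u)).
Proof.
 unfold gamma_ker. rewrite Cexp_R, Cmult_1_l, <- RtoC_opp. apply Cexp_R.
Qed.

Lemma exp_neg_exp_lt u : exp (- exp u) < 1.
Proof. rewrite <- exp_0. apply exp_increasing. generalize (exp_pos u). lra. Qed.

Lemma one_minus_gamma_ker u : (1 - gamma_ker 1 u)%C <> 0.
Proof.
 rewrite gamma_ker_1_R, <- RtoC_minus. apply RtoC_neq_0. generalize (exp_neg_exp_lt u). lra.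
Qed.

Lemma hurwitz_ker_cont a x : rcont (hurwitz_ker a) x.
Proof.
 apply (rcont_hol (fun z => Cexp (- (a * Cexp z)) / (1 - Cexp (- (1 * Cexp z))))%C).
 apply hol_div; [|holo|holo]. apply (one_minus_gamma_ker x).
Qed.

Lemma Cmod_hurwitz_ker a u : Cmod (hurwitz_ker a u) <= exp (- Re a * exp u) * (1 + exp (- u)).
Proof.
 unfold hurwitz_ker. rewrite Cmod_div by apply one_minus_gamma_ker. rewrite Cmod_gamma_ker.
 apply Rmult_le_compat_l; [left; apply exp_pos|].
 assert (H := exp_neg_exp_lt u).
 rewrite gamma_ker_1_R, <- RtoC_minus, Cmod_R, Rabs_pos_eq by lra.
 set (x := exp u) in *. assert (Hx : 0 < x) by apply exp_pos.
 assert (Ex : x * exp (- u) = 1).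
 { apply exp_mul_opp. ring. }
 assert (E : exp x * exp (- x) = 1).
 { apply exp_mul_opp. ring. }
 assert (L := exp_ineq1_le x). assert (P' := exp_pos (- u)).
 apply Rmult_le_reg_r with (1 - exp (- x)); [lra|]. rewrite Rinv_l by lra.
 apply Rmult_le_reg_l with x; auto. nra.
Qed.

Lemma Cmod_hurwitz_ker_exp a u A : Cmod (hurwitz_ker a u) * exp (A * u) <=
 exp (A * u - Re a * exp u) + exp ((A - 1) * u - Re a * exp u).
Proof.
 apply Rle_trans with (exp (- Re a * exp u) * (1 + exp (- u)) * exp (A * u)).
 - apply Rmult_le_compat_r; [left; apply exp_pos|apply Cmod_hurwitz_ker].
 - right. replace (A * u - Re a * exp u) with (- Re a * exp u + A * u) by ring.
  replace ((A - 1) * u - Re a * exp u) with (- Re a * exp u + (- u + A * u)) by ring.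
  rewrite !exp_plus. ring.
Qed.

Lemma hurwitz_ker_bound (a : C) (A : R) : 1 < A -> 0 < Re a ->
 exists M, forall u, Cmod (hurwitz_ker a u) * exp (A * u) <= M.
Proof.
 intros HA Ha.
 destruct (exp_exp_full A (Re a)) as (M1 & P1 & H1); [lra..|].
 destruct (exp_exp_full (A - 1) (Re a)) as (M2 & P2 & H2); [lra..|].
 exists (M1 + M2). intros u. eapply Rle_trans; [apply Cmod_hurwitz_ker_exp|].
 specialize (H1 u). specialize (H2 u). lra.
Qed.

Lemma hurwitz_int_laplace (s a : C) : 1 < Re s -> 0 < Re a ->
 ex_CIg (fun u => hurwitz_ker a u * Cexp (s * u))%C minf pinf /\ hol (fun z => hurwitz_int z a) s.
Proof.
 intros Hs Ha. set (c := (Re s - 1) / 8).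
 destruct (hurwitz_ker_bound a (Re s + 4 * c)) as [M1 H1]; [unfold c; lra|auto|].
 destruct (hurwitz_ker_bound a (Re s - 4 * c)) as [M2 H2]; [unfold c; lra|auto|].
 destruct (laplace_full (hurwitz_ker a) s c (Rmax M1 M2)) as (E1 & _ & E2).
 - unfold c; lra.
 - apply hurwitz_ker_cont.
 - intros u. eapply Rle_trans; [apply H1|apply Rmax_l].
 - intros u. eapply Rle_trans; [apply H2|apply Rmax_r].
 - split; auto. eexists. exact E2.
Qed.

Lemma is_CIg_hurwitz_int (s a : C) : 1 < Re s -> 0 < Re a ->
 is_CIg (fun u => hurwitz_ker a u * Cexp (s * u))%C minf pinf (hurwitz_int s a).
Proof. intros Hs Ha. apply CIg_correct; tc. now apply hurwitz_int_laplace. Qed.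

Lemma hurwitz_int_step (s a : C) : 1 < Re s -> 0 < Re a ->
 hurwitz_int s a = (Gamma_int s a + hurwitz_int s (a + 1))%C.
Proof.
 intros Hs Ha.
 assert (Ha1 : 0 < Re (a + 1)%C) by (simpl; fold (Re a); lra).
 apply CIg_unique; tc.
 assert (I : is_CIg (fun u => gamma_ker a u * Cexp (s * u) + hurwitz_ker (a + 1) u * Cexp (s * u))%C
  minf pinf (Gamma_int s a + hurwitz_int s (a + 1))%C).
 { apply is_CIg_plus; tc; [apply is_CIg_Gamma_int; lra|now apply is_CIg_hurwitz_int]. }
 eapply is_CIg_ext; [tc..| |exact I].
 intros u. cbv beta. unfold hurwitz_ker.
 rewrite gker_add. field. apply one_minus_gamma_ker.
Qed.

Lemma hurwitz_int_sum (s a : C) : 1 < Re s -> 0 < Re a -> forall N : nat,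
 hurwitz_int s a = (Gamma_int s 1 * sum_n (fun n => Cpower ((INR n) + a) (- s)) N
  + hurwitz_int s (a + (INR (S N))))%C.
Proof.
 intros Hs Ha.
 assert (Hp : forall n, 0 < Re (a + (INR n))%C).
 { intros n. simpl. fold (Re a). generalize (pos_INR n). lra. }
 assert (Hg : forall n, Gamma_int s (a + (INR n)) = (Gamma_int s 1 * Cpower ((INR n) + a) (- s))%C).
 { intros n. rewrite Gamma_int_scale by (auto; lra). unfold Cpower. now rewrite (Cplus_comm a). }
 assert (Hn : forall n, (a + (INR n) + 1)%C = (a + (INR (S n)))%C).
 { intros n. rewrite S_INR, RtoC_plus. ring. }
 induction N as [|N IH].
 - rewrite sum_O, <- Hg, <- Hn. simpl INR. rewrite !Cplus_0_r. now apply hurwitz_int_step.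
 - rewrite sum_Sn. change plus with Cplus. rewrite Cmult_plus_distr_l, <- Hg, IH at 1.
  rewrite (hurwitz_int_step s (a + (INR (S N)))%C) by auto. rewrite Hn. ring.
Qed.

Lemma ln_scaled_le (y d : R) : 0 < y -> 0 <= d <= 1 -> d * ln y <= y.
Proof.
 intros Hy Hd. assert (L : ln y <= y).
 { rewrite <- (ln_exp y) at 2. destruct (Rle_lt_or_eq_dec y (exp y) (exp_ge_id y)) as [H|H].
  - left. now apply ln_increasing.
  - rewrite <- H. lra. }
 destruct (Rle_dec 0 (ln y)); nra.
Qed.

Lemma hurwitz_int_tail (s a : C) : 1 < Re s -> 0 < Re a ->
 exists K d, 0 < d /\ forall N : nat, (0 < N)%nat ->
  Cmod (hurwitz_int s (a + (INR N))%C) <= K * exp (- (d * ln (INR N))).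
Proof.
 intros Hs Ha. set (c := (Re s - 1) / 4). set (d := Rmin 1 c).
 assert (Hc : 0 < c) by (unfold c; lra).
 assert (Hd : 0 < d) by (apply Rmin_glb_lt; lra).
 assert (d1 : d <= 1) by apply Rmin_l. assert (d2 : d <= c) by apply Rmin_r.
 destruct (hurwitz_ker_bound a (Re s + c - d)) as [M1 H1]; [unfold c in *; lra|auto|].
 destruct (hurwitz_ker_bound a (Re s + - c - d)) as [M2 H2]; [unfold c in *; lra|auto|].
 exists (4 * Rmax M1 M2 / c), d. split; auto. intros N HN.
 assert (HN0 : 0 < INR N) by now apply lt_0_INR.
 assert (Ha' : 0 < Re (a + INR N)%C) by (simpl; fold (Re a); lra).
 set (x := exp (- (d * ln (INR N)))). assert (Hx : 0 < x) by apply exp_pos.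
 assert (B : exp_decay (fun u => hurwitz_ker (a + INR N) u * Cexp (s * u))%C c (Rmax M1 M2 * x)).
 { intros u e He. unfold hurwitz_ker. rewrite gker_add.
  replace (gamma_ker a u * gamma_ker (INR N) u / (1 - gamma_ker 1 u))%C with (hurwitz_ker a u * gamma_ker (INR N) u)%C
   by (unfold hurwitz_ker, Cdiv; ring).
  rewrite !Cmod_mult, Cmod_gamma_ker, Cmod_Cexp, Re_mult_R, !Rmult_assoc, <- !exp_plus.
  assert (P := exp_pos u).
  assert (E := ln_scaled_le (INR N * exp u) d ltac:(nra) ltac:(lra)).
  rewrite ln_mult, ln_exp in E by lra.
  apply Rle_trans with (Cmod (hurwitz_ker a u) * exp ((Re s + e - d) * u) * x).
  - unfold x. rewrite Rmult_assoc, <- exp_plus. apply Rmult_le_compat_l; [apply Cmod_ge_0|].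
   apply exp_le. simpl. lra.
  - apply Rmult_le_compat_r; [lra|]. destruct He as [-> | ->].
   + eapply Rle_trans; [apply H1|apply Rmax_l].
   + eapply Rle_trans; [apply H2|apply Rmax_r]. }
 replace (4 * Rmax M1 M2 / c * x) with (4 * (Rmax M1 M2 * x) / c) by (field; lra).
 exact (CIg_full_bound _ c (Rmax M1 M2 * x) _ Hc B (is_CIg_hurwitz_int s (a + INR N)%C Hs Ha')).
Qed.

Lemma hurwitz_int_series (s a : C) : 1 < Re s -> 0 < Re a ->
 @is_series C_AbsRing C_NormedModule (fun n : nat => Cpower ((INR n) + a) (- s)%C)
  (hurwitz_int s a / Gamma_int s 1)%C.
Proof.
 intros Hs Ha.
 assert (G0 : Gamma_int s 1 <> 0).
 { rewrite <- Gamma_ext_int by lra. apply Gamma_ext_neq_0, not_pole_Re. lra. }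
 assert (Gp := Cmod_pos _ G0).
 destruct (hurwitz_int_tail s a Hs Ha) as (K & d & Hd & HK).
 assert (HLim : forall e, 0 < e -> exists N0, forall N, (N0 <= N)%nat ->
  Cmod (sum_n (fun n => Cpower ((INR n) + a) (- s)%C) N - hurwitz_int s a / Gamma_int s 1)%C < e).
 { intros e He. destruct (exp_small_p d (K / Cmod (Gamma_int s 1)) e Hd He) as [X HX].
  destruct (INR_unbounded (exp X)) as [N0 HN0].
  exists N0. intros N HN. rewrite (hurwitz_int_sum s a Hs Ha N).
  match goal with |- Cmod (?x - _)%C < _ => set (S := x) end.
  replace (S - (Gamma_int s 1 * S + hurwitz_int s (a + (INR (Datatypes.S N)))) / Gamma_int s 1)%C with
   (- (hurwitz_int s (a + (INR (Datatypes.S N))) / Gamma_int s 1))%C by (field; auto).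
  rewrite Cmod_opp, Cmod_div by auto.
  specialize (HK (Datatypes.S N) ltac:(lia)).
  assert (HL : X < ln (INR (Datatypes.S N))).
  { rewrite <- (ln_exp X). apply ln_increasing; [apply exp_pos|].
   eapply Rlt_le_trans; [exact HN0|]. apply le_INR. lia. }
  specialize (HX _ HL). cbv beta in HX.
  replace (- d * ln (INR (Datatypes.S N))) with (- (d * ln (INR (Datatypes.S N)))) in HX by ring.
  eapply Rle_lt_trans; [|exact HX]. unfold Rdiv.
  rewrite (Rmult_comm K), Rmult_assoc, Rmult_comm.
  apply Rmult_le_compat_l; [left; now apply Rinv_0_lt_compat|exact HK]. }
 intros P [eps HP]. destruct (HLim eps (cond_pos eps)) as [N0 HN].
 exists N0. intros N HN'. apply HP. specialize (HN N HN'). split.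
 - eapply Rle_lt_trans; [|exact HN].
  apply (Re_le_Cmod (sum_n (fun n => Cpower ((INR n) + a) (- s)%C) N - hurwitz_int s a / Gamma_int s 1)%C).
 - eapply Rle_lt_trans; [|exact HN].
  apply (Im_le_Cmod (sum_n (fun n => Cpower ((INR n) + a) (- s)%C) N - hurwitz_int s a / Gamma_int s 1)%C).
Qed.

(** * The Hankel contour in logarithmic coordinates *)

Lemma Cexp_eq_1 (z : C) : Cexp z = 1 -> Cmod z < 2 * PI -> z = 0.
Proof.
 intros E Hz.
 assert (M := Cmod_Cexp z). rewrite E, Cmod_1 in M.
 assert (R0 : Re z = 0) by (apply exp_inv; rewrite exp_0; auto).
 assert (C0 : cos (Im z) = 1).
 { apply (f_equal Re) in E. unfold Cexp in E. rewrite R0, exp_0 in E. simpl in E. lra. }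
 assert (HI := Im_le_Cmod z).
 apply C_eq; simpl; auto.
 destruct (Req_dec (Im z) 0) as [|N]; auto. exfalso.
 assert (E2 : cos (Rabs (Im z)) = 1).
 { unfold Rabs. destruct Rcase_abs; auto. now rewrite cos_neg. }
 apply Rabs_pos_lt in N. set (y := Rabs (Im z)) in *.
 replace y with (2 * (y / 2)) in E2 by field. rewrite cos_2a_sin in E2.
 assert (S : 0 < sin (y / 2)) by (apply sin_gt_0; lra). nra.
Qed.

Definition hankel_ker (a w : C) : C := (Cexp (a * Cexp w) / (1 - Cexp (Cexp w)))%C.

Lemma hankel_ker_den (w : C) : exp (Re w) < 2 * PI -> (1 - Cexp (Cexp w))%C <> 0.
Proof.
 intros Hw E. apply (Cexp_neq_0 w). apply Cexp_eq_1.
 - symmetry. now apply Ceq_minus.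
 - now rewrite Cmod_Cexp.
Qed.

Lemma hol_hankel_ker a w : exp (Re w) < 2 * PI -> hol (hankel_ker a) w.
Proof.
 intros Hw. unfold hankel_ker. apply hol_div; [now apply hankel_ker_den|holo|holo].
Qed.

Lemma Cexp_side (u phi : R) : phi = PI \/ phi = - PI -> Cexp (u, phi) = (- (exp u))%C.
Proof.
 intros H. unfold Cexp. apply C_eq; simpl.
 - destruct H as [-> | ->]; rewrite ?cos_neg, cos_PI; ring.
 - destruct H as [-> | ->]; rewrite ?sin_neg, sin_PI; ring.
Qed.

Lemma hankel_ker_side a u phi : phi = PI \/ phi = - PI -> hankel_ker a (u, phi) = hurwitz_ker a u.
Proof.
 intros H. unfold hankel_ker, hurwitz_ker, gamma_ker. rewrite Cexp_side by auto. rewrite <- (Cexp_R u).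
 f_equal; f_equal; [ring|f_equal; f_equal; ring].
Qed.

Definition arc_ker (a : C) (b theta : R) : C := hankel_ker a (b, theta).

Lemma arc_ker_cont a b x : exp b < 2 * PI -> rcont (arc_ker a b) x.
Proof.
 intros Hb. apply (rcont_ver (hankel_ker a) b x). apply hol_cont, hol_hankel_ker. exact Hb.
Qed.

Definition side_term (a s : C) (phi u : R) : C := (hurwitz_ker a u * Cexp (s * (u, phi)))%C.
Definition arc_term (a s : C) (b theta : R) : C := (arc_ker a b theta * Cexp (s * (b, theta)))%C.

Definition Hankel (a : C) (b : R) (s : C) : C :=
 (- CIg (side_term a s (- PI)%R) (at_point b) pinf
  + Ci * CIg (arc_term a s b) (at_point (- PI)%R) (at_point PI)
  + CIg (side_term a s PI) (at_point b) pinf)%C.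

Definition Hankel_log (a : C) (b : R) (s : C) : C :=
 (- CIg (fun u => side_term a s (- PI)%R u * (u, (- PI)%R)) (at_point b) pinf
  + Ci * CIg (fun t => arc_term a s b t * (b, t)) (at_point (- PI)%R) (at_point PI)
  + CIg (fun u => side_term a s PI u * (u, PI)) (at_point b) pinf)%C.

Lemma hurwitz_ker_half (a : C) (b A : R) : 0 < Re a ->
 exists M, forall u, b <= u -> Cmod (hurwitz_ker a u) * exp (A * u) <= M * exp (- (1) * u).
Proof.
 intros Ha.
 destruct (exp_exp_half A (Re a) b Ha) as (M1 & P1 & H1).
 destruct (exp_exp_half (A - 1) (Re a) b Ha) as (M2 & P2 & H2).
 exists (M1 + M2). intros u Hu. eapply Rle_trans; [apply Cmod_hurwitz_ker_exp|].
 specialize (H1 u Hu). specialize (H2 u Hu). lra.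
Qed.

Lemma side_facts (a s : C) (b phi : R) : 0 < Re a ->
 ex_CIg (side_term a s phi) (at_point b) pinf /\
 ex_CIg (fun u => side_term a s phi u * (u, phi))%C (at_point b) pinf /\
 cdiff (fun z => CIg (side_term a z phi) (at_point b) pinf) s
  (CIg (fun u => side_term a s phi u * (u, phi))%C (at_point b) pinf).
Proof.
 intros Ha. apply (laplace_half (hurwitz_ker a) s b phi).
 - apply hurwitz_ker_cont.
 - intros A. now apply hurwitz_ker_half.
Qed.

Lemma arc_facts (a s : C) (b : R) : exp b < 2 * PI ->
 ex_CIg (arc_term a s b) (at_point (- PI)%R) (at_point PI) /\
 ex_CIg (fun t => arc_term a s b t * (b, t))%C (at_point (- PI)%R) (at_point PI) /\
 cdiff (fun z => CIg (arc_term a z b) (at_point (- PI)%R) (at_point PI)) s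
  (CIg (fun t => arc_term a s b t * (b, t))%C (at_point (- PI)%R) (at_point PI)).
Proof.
 intros Hb. apply (param_compact (arc_ker a b) (fun t => (b, t)) s (- PI) PI).
 - generalize PI_RGT_0. lra.
 - intros x. now apply arc_ker_cont.
 - intros x. apply (rcont_ver (fun z => z)). apply Ccont_id.
Qed.

Lemma cdiff_Hankel (a s : C) (b : R) : 0 < Re a -> exp b < 2 * PI ->
 cdiff (Hankel a b) s (Hankel_log a b s).
Proof.
 intros Ha Hb. unfold Hankel, Hankel_log.
 assert (H1 := proj2 (proj2 (side_facts a s b (- PI) Ha))).
 assert (H2 := proj2 (proj2 (arc_facts a s b Hb))).
 assert (H3 := proj2 (proj2 (side_facts a s b PI Ha))).
 apply cdiff_plus; auto. apply cdiff_plus.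
 - apply cdiff_ext with (fun z => (- (1)) * CIg (side_term a z (- PI)%R) (at_point b) pinf)%C;
   [intros; ring|].
  eapply cdiff_eq; [|apply cdiff_mult; [apply cdiff_const|exact H1]].
  rewrite Cmult_0_l, Cplus_0_l. assert (E : forall x : C, (- (1) * x)%C = (- x)%C) by (intros; ring).
  apply E.
 - eapply cdiff_eq; [|apply cdiff_mult; [apply cdiff_const|exact H2]].
  now rewrite Cmult_0_l, Cplus_0_l.
Qed.

Lemma CIg_at_point (f : R -> C) (a b : R) : ex_CI f a b ->
 CIg f (at_point a) (at_point b) = CI f a b.
Proof.
 intros H. apply CIg_unique; tc.
 apply (proj2 (is_RInt_gen_at_point (V := C_R_NormedModule) f a b (CI f a b))). now apply is_CI_CI.
Qed.

Lemma one_minus_Cexp_lower (z : C) : Cmod z <= / 6 -> Cmod z / 2 <= Cmod (1 - Cexp z)%C.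
Proof.
 intros Hz. assert (B := Cexp_bound2 z).
 assert (E : exp (Cmod z) <= 3).
 { eapply Rle_trans; [|apply exp_le_3]. apply exp_le. lra. }
 assert (T := Cmod_triangle (1 - Cexp z)%C (Cexp z - 1 - z)%C).
 replace (1 - Cexp z + (Cexp z - 1 - z))%C with (- z)%C in T by ring. rewrite Cmod_opp in T.
 assert (P := Cmod_ge_0 z). assert (P' := exp_pos (Cmod z)).
 assert (Q : Cmod z ^ 2 * exp (Cmod z) <= Cmod z * / 2) by nra. lra.
Qed.

Lemma hankel_ker_bound (a s w : C) : exp (Re w) <= / 6 -> Rabs (Im w) <= PI ->
 Cmod (hankel_ker a w * Cexp (s * w))%C <=
  2 * exp (Cmod a + Rabs (Im s) * PI) * exp ((Re s - 1) * Re w).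
Proof.
 intros Hw Hi. unfold hankel_ker. assert (P := PI_4).
 assert (P3 : exp (Re w) < 2 * PI) by (generalize PI2_1; lra).
 rewrite Cmod_mult, Cmod_div by now apply hankel_ker_den. rewrite !Cmod_Cexp.
 assert (L := one_minus_Cexp_lower (Cexp w)). rewrite Cmod_Cexp in L. specialize (L Hw).
 assert (A : Re (a * Cexp w)%C <= Cmod a).
 { eapply Rle_trans; [apply Re_le|]. rewrite Cmod_mult, Cmod_Cexp.
  generalize (Cmod_ge_0 a). nra. }
 assert (B : Re (s * w)%C <= Re s * Re w + Rabs (Im s) * PI).
 { rewrite re_mult. assert (A1 := Rle_abs (- (Im s * Im w))). rewrite Rabs_Ropp, Rabs_mult in A1.
  assert (A2 := Rabs_pos (Im s)). nra. }
 assert (D : 0 < Cmod (1 - Cexp (Cexp w))%C) by (apply Cmod_pos, hankel_ker_den, P3).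
 apply Rmult_le_reg_r with (Cmod (1 - Cexp (Cexp w))%C); auto.
 replace (exp (Re (a * Cexp w)) / Cmod (1 - Cexp (Cexp w))%C * exp (Re (s * w)) *
  Cmod (1 - Cexp (Cexp w))%C) with (exp (Re (a * Cexp w)) * exp (Re (s * w))) by (field; lra).
 apply Rle_trans with (2 * exp (Cmod a + Rabs (Im s) * PI) * exp ((Re s - 1) * Re w) * (exp (Re w) / 2)).
 - rewrite <- exp_plus.
  replace (2 * exp (Cmod a + Rabs (Im s) * PI) * exp ((Re s - 1) * Re w) * (exp (Re w) / 2))
   with (exp (Cmod a + Rabs (Im s) * PI) * exp ((Re s - 1) * Re w) * exp (Re w)) by field.
  rewrite <- !exp_plus. apply exp_le. lra.
 - apply Rmult_le_compat_l; auto.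
  apply Rmult_le_pos; [|left; apply exp_pos]. generalize (exp_pos (Cmod a + Rabs (Im s) * PI)). lra.
Qed.

Lemma side_factor (a s : C) (phi u : R) :
 side_term a s phi u = (Cexp (s * (phi * Ci)) * (hurwitz_ker a u * Cexp (s * u)))%C.
Proof.
 unfold side_term. replace ((u, phi) : C) with (phi * Ci + u)%C by (apply C_eq; simpl; ring).
 rewrite Cmult_plus_distr_l, Cexp_plus. ring.
Qed.

(* Shrinking the circle to the origin: by Goursat on [[-X, b] x [-PI, PI]] the arc at
  Re w = b is traded for the two sides, up to an arc at Re w = -X that tends to 0. *)
Lemma Hankel_collapse (a s : C) (b : R) : 0 < Re a -> exp b < 2 * PI -> 1 < Re s ->
 Hankel a b s = (two_i_sin_pi s * hurwitz_int s a)%C.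
Proof.
 intros Ha Hb Hs. assert (PI0 := PI_RGT_0).
 set (f0 := fun u => (hurwitz_ker a u * Cexp (s * u))%C).
 set (cp := Cexp (s * (RtoC PI * Ci))%C). set (cm := Cexp (s * (RtoC (- PI)%R * Ci))%C).
 assert (Es : two_i_sin_pi s = (cp - cm)%C).
 { unfold two_i_sin_pi, cp, cm. f_equal. f_equal. f_equal. rewrite RtoC_opp. ring. }
 assert (F0c : forall x, rcont f0 x).
 { intros x. apply rcont_mult; [apply hurwitz_ker_cont|]. apply (rcont_hol (fun z => Cexp (s * z))%C). holo. }
 assert (Iex : forall phi, is_CIg (side_term a s phi) (at_point b) pinf (CIg (side_term a s phi) (at_point b) pinf)).
 { intros phi. apply CIg_correct; tc. exact (proj1 (side_facts a s b phi Ha)). }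
 assert (I0 : exists Lb, is_CIg f0 (at_point b) pinf Lb).
 { eexists. eapply is_CIg_ext; [tc..| |].
  2:{ apply (is_CIg_scal (/ cp)%C); tc. apply (Iex PI). }
  intros u. cbv beta. rewrite side_factor. fold cp (f0 u). field. apply Cexp_neq_0. }
 destruct I0 as [Lb I0].
 assert (Ip : CIg (side_term a s PI) (at_point b) pinf = (cp * Lb)%C).
 { apply CIg_unique; tc.
  eapply is_CIg_ext; [tc..| |apply (is_CIg_scal cp); [tc..|exact I0]].
  intros u. cbv beta. now rewrite side_factor. }
 assert (Im' : CIg (side_term a s (- PI)) (at_point b) pinf = (cm * Lb)%C).
 { apply CIg_unique; tc.
  eapply is_CIg_ext; [tc..| |apply (is_CIg_scal cm); [tc..|exact I0]].
  intros u. cbv beta. now rewrite side_factor. }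
 assert (Ecirc : CIg (arc_term a s b) (at_point (- PI)%R) (at_point PI) = CI (arc_term a s b) (- PI) PI).
 { apply CIg_at_point. apply (proj1 (ex_RInt_gen_at_point (V := C_R_CompleteNormedModule) (arc_term a s b) (- PI) PI)).
  apply (proj1 (arc_facts a s b Hb)). }
 assert (IJ := is_CIg_hurwitz_int s a Hs Ha). fold f0 in IJ.
 assert (Key : (Ci * CI (arc_term a s b) (- PI)%R PI = (cp - cm) * (hurwitz_int s a - Lb))%C).
 { set (g := fun w => (hankel_ker a w * Cexp (s * w))%C).
  assert (Hg : forall w, Re w <= b -> hol g w).
  { intros w Hw. unfold g. apply hol_mult; [|holo]. apply hol_hankel_ker.
   eapply Rle_lt_trans; [apply exp_le; exact Hw|exact Hb]. }
  set (K := 2 * exp (Cmod a + Rabs (Im s) * PI)).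
  apply Ceq_minus, (Cmod_small_0 _ (2 * Cmod (cp - cm)%C + 2 * PI)). intros e He.
  destruct (CIg_full_lim _ _ IJ e He) as (X1 & HX1 & L1).
  destruct (CIg_half_lim _ _ _ I0 e He) as (X2 & L2).
  destruct (exp_small_m (Re s - 1) K e) as [X3 L3]; [lra|auto|].
  set (X := X1 + Rabs X3 + Rabs b + 1 + ln 6). set (Y := X1 + Rabs X2 + Rabs b + 1).
  assert (A3 := Rle_abs (- X3)). rewrite Rabs_Ropp in A3. assert (A4 := Rabs_pos X3).
  assert (A5 := Rle_abs (- b)). rewrite Rabs_Ropp in A5. assert (A6 := Rabs_pos b).
  assert (A7 := Rle_abs X2). assert (A8 := Rabs_pos X2). assert (A9 := Rle_abs b).
  assert (L6 : 0 < ln 6) by (rewrite <- ln_1; apply ln_increasing; lra).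
  specialize (L1 (- X) Y ltac:(unfold X; lra) ltac:(unfold Y; lra)).
  specialize (L2 Y ltac:(unfold Y; lra)).
  specialize (L3 (- X) ltac:(unfold X; lra)). cbv beta in L3.
  assert (HXb : - X <= b) by (unfold X; lra).
  assert (G := goursat g (- X) b (- PI) PI HXb ltac:(lra) ltac:(intros w [_ Hw] _; now apply Hg)).
  unfold bnd in G.
  assert (Gs : forall phi, phi = PI \/ phi = - PI -> CI (fun x => g (x, phi)) (- X) b =
    (Cexp (s * (phi * Ci)) * CI f0 (- X) b)%C).
  { intros phi Hp. rewrite <- CI_scal by (apply ex_CI_cont; auto).
   apply CI_ext. intros t _. unfold g. rewrite hankel_ker_side by auto.
   change (hurwitz_ker a t * Cexp (s * (t, phi)))%C with (side_term a s phi t). now rewrite side_factor. }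
  rewrite !Gs in G by auto. fold cp cm in G.
  assert (V : Cmod (CI (fun y => g (- X, y)) (- PI) PI) <= (PI - - PI) * e).
  { apply CI_bound; [lra| |].
   - apply (ex_CI_ver g (- X) b (- PI) PI (- X)); try lra.
    intros w [_ Hw] _. now apply hol_cont, Hg.
   - intros y Hy. eapply Rle_trans; [|left; exact L3].
    apply (hankel_ker_bound a s ((- X)%R, y)); simpl.
    + rewrite <- (exp_ln 6) by lra. rewrite <- exp_Ropp. apply exp_le. unfold X. lra.
    + apply Rabs_le. lra. }
  change (fun y : R => g (b, y)) with (arc_term a s b) in G.
  assert (Ch : (CI f0 (- X) b + CI f0 b Y = CI f0 (- X) Y)%C) by (apply CI_Chasles; apply ex_CI_cont; auto).
  set (v := CI (fun y => g (- X, y)) (- PI) PI) in *.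
  set (q := CI f0 (- X) b) in *. set (r := CI f0 b Y) in *. set (t := CI f0 (- X) Y) in *.
  set (o := CI (arc_term a s b) (- PI) PI) in *.
  assert (E : (Ci * o - (cp - cm) * (hurwitz_int s a - Lb) =
   (cp - cm) * ((t - hurwitz_int s a) - (r - Lb)) + Ci * v)%C).
  { replace (Ci * o)%C with ((cm * q + Ci * o - cp * q - Ci * v) + (cp - cm) * q + Ci * v)%C by ring.
   rewrite G. rewrite <- Ch. ring. }
  rewrite E. eapply Rle_trans; [apply Cmod_triangle|]. rewrite !Cmod_mult, Cmod_Ci.
  assert (T := Cmod_triangle_minus (t - hurwitz_int s a)%C (r - Lb)%C).
  assert (P := Cmod_ge_0 (cp - cm)%C). nra. }
 unfold Hankel. rewrite Ip, Im', Ecirc, Key, Es. ring.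
Qed.

Lemma is_CIg_neg_exp (f h : R -> C) (eps : R) (l : C) : 0 < eps ->
 (forall x, rcont h x) -> (forall u, h u = (f (- exp u)%R * (exp u))%C) ->
 is_CIg h (at_point (ln eps)) pinf l ->
 is_CIg f (at_point (- eps)) minf (- l)%C /\ is_CIg f minf (at_point (- eps)) l.
Proof.
 intros He Hc Hh Il.
 assert (I1 : is_CIg f (at_point (- eps)) minf (- l)%C).
 { apply is_CIg_eps; tc. intros e Hee.
  destruct (CIg_half_lim _ _ _ Il e Hee) as (X & HX).
  exists (fun x => x = - eps) (fun x => x < - eps /\ x < - exp X).
  - now unfold at_point.
  - exists (Rmin (- eps) (- exp X)). intros x Hx. split.
   + eapply Rlt_le_trans; [exact Hx|apply Rmin_l].
   + eapply Rlt_le_trans; [exact Hx|apply Rmin_r].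
  - intros x0 x -> [H1 H2]. simpl.
   assert (HXx : X < ln (- x)).
   { rewrite <- (ln_exp X). apply ln_increasing; [apply exp_pos|lra]. }
   exists (- CI h (ln eps) (ln (- x)))%C. split.
   + apply is_CI_ext with (fun t => (- (1)) * (- (1) * f t))%C; [intros; ring|].
    replace (- CI h (ln eps) (ln (- x)))%C with (- (1) * CI h (ln eps) (ln (- x)))%C by ring.
    apply is_CI_scal.
    apply (is_RInt_ext (V := C_R_NormedModule) (fun t => scal (/ t) (h (ln (- t))))).
    { intros t Ht. rewrite Rmax_left in Ht by lra.
     rewrite scal_R_Cmult, Hh, exp_ln by lra. rewrite Ropp_involutive.
     rewrite RtoC_inv, RtoC_opp by lra. assert (RtoC t <> 0) by (apply RtoC_neq_0; lra).
     match goal with |- ?x = ?y => change (@eq C x y) end. field. auto. }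
    replace (ln eps) with (ln (- - eps)) by (f_equal; ring).
    apply (@is_RInt_comp C_R_CompleteNormedModule h (fun t => ln (- t)) Rinv).
    * intros t _. apply Hc.
    * intros t [_ Ht]. rewrite Rmax_left in Ht by lra. split.
     -- auto_derive; [lra|]. field. lra.
     -- apply cont_by_derive. auto_derive. lra.
   + replace (- CI h (ln eps) (ln (- x)) - - l)%C with (- (CI h (ln eps) (ln (- x)) - l))%C by ring.
    rewrite Cmod_opp. now apply HX. }
 split; auto.
 replace l with (- - l)%C by ring.
 apply (@is_RInt_gen_swap C_R_NormedModule); tc. exact I1.
Qed.

Lemma is_CIg_RInt_gen (f : R -> C) Fa Fb {FFa : ProperFilter Fa} {FFb : ProperFilter Fb} (l : C) :
 is_CIg f Fa Fb l -> @RInt_gen C_R_CompleteNormedModule f Fa Fb = l.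
Proof. intros H. rewrite CIg_RInt_gen. now apply CIg_unique. Qed.

(* [m] is the factor by which the integrand carries [Log z]: 1 or the logarithm itself. *)
Lemma hankel_int_sides (a s : C) (eps : R) (f : C -> C -> C) (m : C -> C) (lm lc lp : C) :
 0 < eps < 2 * PI -> (forall w, Ccont m w) ->
 (forall z l, f z l = (Cexp ((s - 1) * l) * Cexp (a * z) / (1 - Cexp z) * m l)%C) ->
 is_CIg (fun u => side_term a s (- PI)%R u * m (u, (- PI)%R))%C (at_point (ln eps)) pinf lm ->
 is_CIg (fun t => arc_term a s (ln eps) t * m (ln eps, t))%C (at_point (- PI)%R) (at_point PI) lc ->
 is_CIg (fun u => side_term a s PI u * m (u, PI))%C (at_point (ln eps)) pinf lp ->
 ex_hankel_int eps f /\ hankel_int eps f = (- lm + Ci * lc + lp)%C.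
Proof.
 intros Heps Hm Hf Im' Ic Ip.
 assert (Heb : exp (ln eps) = eps) by (apply exp_ln; lra).
 assert (Sc : forall phi x, rcont (fun u => - (1) * (side_term a s phi u * m (u, phi)))%C x).
 { intros phi x. apply rcont_mult; [apply rcont_const|]. apply rcont_mult.
  - unfold side_term. apply rcont_mult; [apply hurwitz_ker_cont|].
   apply (rcont_hor (fun w => Cexp (s * w))%C). apply hol_cont. holo.
  - now apply (rcont_hor m). }
 assert (Sub : forall phi u, phi = PI \/ phi = - PI ->
  (- (1) * (side_term a s phi u * m (u, phi)))%C =
  (f (RtoC (- exp u)) (ln (- - exp u)%R, phi) * (exp u))%C).
 { intros phi u Hp. rewrite Ropp_involutive, ln_exp, Hf. unfold side_term.
  rewrite <- (hankel_ker_side a u phi) by auto. unfold hankel_ker.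
  assert (E : Cexp (u, phi) = RtoC (- exp u)) by (rewrite Cexp_side by auto; now rewrite RtoC_opp).
  rewrite E.
  replace ((s - 1) * (u, phi))%C with (s * (u, phi) - (u, phi))%C by ring.
  rewrite Cexp_minus, E, RtoC_opp.
  assert (RtoC (exp u) <> 0) by (apply RtoC_neq_0; generalize (exp_pos u); lra).
  unfold Cdiv. set (d := (/ (1 - Cexp (- (exp u))))%C). field. auto. }
 destruct (is_CIg_neg_exp (hankel_lower f) (fun u => - (1) * (side_term a s (- PI)%R u * m (u, (- PI)%R)))%C
  eps (- (1) * lm)%C) as [_ L1]; try lra.
 { apply Sc. }
 { intros u. unfold hankel_lower. apply Sub. auto. }
 { apply is_CIg_scal; tc. exact Im'. }
 destruct (is_CIg_neg_exp (hankel_upper f) (fun u => - (1) * (side_term a s PI u * m (u, PI)))%C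
  eps (- (1) * lp)%C) as [L2 _]; try lra.
 { apply Sc. }
 { intros u. unfold hankel_upper. apply Sub. auto. }
 { apply is_CIg_scal; tc. exact Ip. }
 apply (proj1 (is_RInt_gen_at_point (V := C_R_NormedModule) _ (- PI) PI lc)) in Ic.
 assert (L3 : is_CI (hankel_circle eps f) (- PI) PI (Ci * lc)%C).
 { eapply is_CI_ext; [|apply is_CI_scal; exact Ic].
  intros t. cbv beta. unfold hankel_circle, arc_term, arc_ker, hankel_ker.
  assert (E : (eps * Cexp (Ci * t))%C = Cexp (ln eps, t)).
  { rewrite <- Heb at 1. rewrite <- Cexp_R, <- Cexp_plus. f_equal. apply C_eq; simpl; ring. }
  rewrite E. set (w := (ln eps, t) : C). rewrite Hf.
  replace ((s - 1) * w)%C with (s * w - w)%C by ring. rewrite Cexp_minus.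
  unfold Cdiv. set (d := (/ (1 - Cexp (Cexp w)))%C). field. apply Cexp_neq_0. }
 split.
 - split; [|split]; eexists; eassumption.
 - unfold hankel_int.
  rewrite (is_CIg_RInt_gen _ _ _ _ L1), (is_CIg_RInt_gen _ _ _ _ L2).
  rewrite (is_RInt_unique (V := C_R_CompleteNormedModule) _ _ _ _ L3). ring.
Qed.

Lemma hankel_int_Hankel (a s : C) (eps : R) (f : C -> C -> C) : 0 < Re a -> 0 < eps < 2 * PI ->
 (forall z l, f z l = (Cexp ((s - 1) * l) * Cexp (a * z) / (1 - Cexp z))%C) ->
 ex_hankel_int eps f /\ hankel_int eps f = Hankel a (ln eps) s.
Proof.
 intros Ha Heps Hf.
 assert (Heb : exp (ln eps) < 2 * PI) by (rewrite exp_ln; lra).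
 apply (hankel_int_sides a s eps f (fun _ => RtoC 1)); auto.
 - intros w. apply Ccont_const.
 - intros z l. rewrite Hf. ring.
 - eapply is_CIg_ext; [tc..| |apply CIg_correct; [tc..|]].
  2: apply (proj1 (side_facts a s (ln eps) (- PI) Ha)). intros; ring.
 - eapply is_CIg_ext; [tc..| |apply CIg_correct; [tc..|]].
  2: apply (proj1 (arc_facts a s (ln eps) Heb)). intros; ring.
 - eapply is_CIg_ext; [tc..| |apply CIg_correct; [tc..|]].
  2: apply (proj1 (side_facts a s (ln eps) PI Ha)). intros; ring.
Qed.

Lemma hankel_int_Hankel_log (a s : C) (eps : R) (f : C -> C -> C) : 0 < Re a -> 0 < eps < 2 * PI ->
 (forall z l, f z l = (Cexp ((s - 1) * l) * Cexp (a * z) / (1 - Cexp z) * l)%C) ->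
 ex_hankel_int eps f /\ hankel_int eps f = Hankel_log a (ln eps) s.
Proof.
 intros Ha Heps Hf.
 assert (Heb : exp (ln eps) < 2 * PI) by (rewrite exp_ln; lra).
 apply (hankel_int_sides a s eps f (fun l => l)); auto.
 - intros w. apply Ccont_id.
 - apply CIg_correct; [tc..|]. exact (proj1 (proj2 (side_facts a s (ln eps) (- PI) Ha))).
 - apply CIg_correct; [tc..|]. exact (proj1 (proj2 (arc_facts a s (ln eps) Heb))).
 - apply CIg_correct; [tc..|]. exact (proj1 (proj2 (side_facts a s (ln eps) PI Ha))).
Qed.

(** * The Hurwitz zeta function as a Hankel integral *)

Definition hank_zeta (a : C) (b : R) (s : C) : C :=
 (Gamma_ext (1 - s) / (RtoC (2 * PI) * Ci) * Hankel a b s)%C.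

Definition zeta_ext (a : C) (b : R) (s : C) : C :=
 if Rlt_dec 1 (Re s) then (hurwitz_int s a / Gamma_int s 1)%C else hank_zeta a b s.

Lemma Gamma_int_neq_0 s : 0 < Re s -> Gamma_int s 1 <> 0.
Proof. intros Hs. rewrite <- Gamma_ext_int by auto. now apply Gamma_ext_neq_0, not_pole_Re. Qed.

Lemma cdiff_Gamma_ext_refl (s : C) : not_pole (1 - s)%C ->
 exists g, cdiff Gamma_ext (1 - s)%C g /\ cdiff (fun z => Gamma_ext (1 - z)%C) s (- g)%C.
Proof.
 intros Hs. destruct (hol_Gamma_ext _ Hs) as [g Hg]. exists g. split; auto.
 assert (H1 : cdiff (fun z => 1 - z)%C s (- (1))%C).
 { apply cdiff_ext with (fun z => 1 + (- (1)) * z)%C; [intros; ring|].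
  eapply cdiff_eq; [|apply cdiff_plus; [apply cdiff_const|
   apply (cdiff_mult (fun _ => - (1))%C (fun z => z)); [apply cdiff_const|apply cdiff_id]]]. ring. }
 eapply cdiff_eq; [|apply (cdiff_comp Gamma_ext (fun z => 1 - z)%C); [exact H1|exact Hg]]. ring.
Qed.

Lemma hank_zeta_hurwitz_int (a : C) (b : R) (Ha : 0 < Re a) (Hb : exp b < 2 * PI) (s : C) : 1 < Re s -> not_pole (1 - s)%C ->
 hank_zeta a b s = (hurwitz_int s a / Gamma_int s 1)%C.
Proof.
 intros Hs Hp. unfold hank_zeta. rewrite Hankel_collapse by auto.
 assert (R := reflection s (not_pole_Re s ltac:(lra)) Hp).
 rewrite (Gamma_ext_int s) in R by lra.
 assert (N := two_pi_i_neq_0). assert (G := Gamma_int_neq_0 s ltac:(lra)).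
 replace (Gamma_ext (1 - s)) with (Gamma_int s 1 * Gamma_ext (1 - s) / Gamma_int s 1)%C by (field; auto).
 replace (Gamma_int s 1 * Gamma_ext (1 - s) / Gamma_int s 1 / (RtoC (2 * PI) * Ci) * (two_i_sin_pi s * hurwitz_int s a))%C with
  ((Gamma_int s 1 * Gamma_ext (1 - s) * two_i_sin_pi s) / Gamma_int s 1 / (RtoC (2 * PI) * Ci) * hurwitz_int s a)%C.
 2:{ unfold Cdiv. ring. }
 rewrite R. set (q := (RtoC (2 * PI) * Ci)%C) in *. field. auto.
Qed.

Lemma zeta_ext_hank (a : C) (b : R) (Ha : 0 < Re a) (Hb : exp b < 2 * PI) (s : C) : not_pole (1 - s)%C -> zeta_ext a b s = hank_zeta a b s.
Proof.
 intros Hp. unfold zeta_ext. destruct Rlt_dec; auto. symmetry. now apply hank_zeta_hurwitz_int.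
Qed.

Lemma not_pole_1_minus (s : C) : Re s <= 1 -> s <> 1 -> not_pole (1 - s)%C.
Proof.
 intros H N n E. apply N. assert (Es : s = (1 + (INR n))%C).
 { replace s with (1 - (1 - s))%C by ring. rewrite E. ring. }
 assert (n = 0%nat).
 { apply INR_eq. apply (f_equal Re) in Es. simpl in Es. fold (Re s) in Es.
  generalize (pos_INR n). simpl. lra. }
 subst n. rewrite Es. simpl. ring.
Qed.

Lemma near_1_minus (s : C) : not_pole (1 - s)%C ->
 exists r, 0 < r /\ forall w, Cmod (w - s)%C < r -> not_pole (1 - w)%C.
Proof.
 intros H. destruct (not_pole_near _ H) as (r & Hr & Hw). exists r. split; auto.
 intros w H'. apply Hw. replace (1 - w - (1 - s))%C with (- (w - s))%C by ring. now rewrite Cmod_opp.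
Qed.

Lemma hol_hank_zeta (a : C) (b : R) (Ha : 0 < Re a) (Hb : exp b < 2 * PI) (s : C) : not_pole (1 - s)%C -> hol (hank_zeta a b) s.
Proof.
 intros Hp. destruct (cdiff_Gamma_ext_refl s Hp) as (g & _ & Hg). unfold hank_zeta.
 apply hol_mult; [|eexists; now apply cdiff_Hankel].
 apply hol_div; [apply two_pi_i_neq_0|eexists; exact Hg|apply hol_const].
Qed.

Lemma hol_zeta_ext (a : C) (b : R) (Ha : 0 < Re a) (Hb : exp b < 2 * PI) (s : C) : s <> 1 -> hol (zeta_ext a b) s.
Proof.
 intros Hs1. destruct (Rlt_dec 1 (Re s)) as [L|L].
 - apply hol_ext_loc with (fun z => hurwitz_int z a / Gamma_int z 1)%C (Re s - 1); [lra| |].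
  + intros w Hw. unfold zeta_ext. destruct Rlt_dec as [|N]; auto. exfalso.
   assert (A := Re_le_Cmod (w - s)%C). simpl in A. fold (Re w) (Re s) in A.
   unfold Rabs in A. destruct Rcase_abs in A; lra.
  + apply hol_div; [apply Gamma_int_neq_0; lra|now apply hurwitz_int_laplace|apply Gamma_int_laplace; simpl; lra].
 - assert (Hp : not_pole (1 - s)%C) by (apply not_pole_1_minus; auto; lra).
  destruct (near_1_minus s Hp) as (r & Hr & Hw).
  apply hol_ext_loc with (hank_zeta a b) r; auto.
  + intros w H. symmetry. apply zeta_ext_hank; auto.
  + now apply hol_hank_zeta.
Qed.

Lemma zeta_ext_series (a : C) (b : R) (Ha : 0 < Re a) (s : C) : 1 < Re s ->
 @is_series C_AbsRing C_NormedModule (fun n : nat => Cpower ((INR n) + a) (- s)%C)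
  (zeta_ext a b s).
Proof.
 intros Hs. unfold zeta_ext. destruct Rlt_dec; [|tauto]. now apply hurwitz_int_series.
Qed.

Lemma hurwitz_zeta_ext (a : C) (b : R) (Ha : 0 < Re a) (Hb : exp b < 2 * PI) (s : C) : s <> 1 -> hurwitz_zeta s a = zeta_ext a b s.
Proof.
 intros Hs.
 set (F := analytic_continuation (fun s => s <> RtoC 1) (fun s => 1 < Re s)
  (fun s v => @is_series C_AbsRing C_NormedModule
     (fun n : nat => Cpower ((INR n) + a) (- s)%C) v)).
 assert (S : holomorphic_on (fun s => s <> RtoC 1) F /\ forall s, 1 < Re s ->
   @is_series C_AbsRing C_NormedModule
     (fun n : nat => Cpower ((INR n) + a) (- s)%C) (F s)).
 { apply (continuation_spec (fun s => s <> RtoC 1) (fun s => 1 < Re s)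
   (fun s v => @is_series C_AbsRing C_NormedModule
     (fun n : nat => Cpower ((INR n) + a) (- s)%C) v)).
  exists (zeta_ext a b). split.
  - intros z Hz. apply hol_ex_derive. now apply hol_zeta_ext.
  - intros z Hz. now apply zeta_ext_series. }
 destruct S as [S1 S2].
 assert (Im1 : forall z, Im z <> 0 -> z <> 1) by (intros z Hz E; apply Hz; now rewrite E).
 change (F s = zeta_ext a b s).
 apply (continuation_unique F (zeta_ext a b) 1 2); try lra.
 - intros z Hz. apply hol_ex_derive, S1. auto.
 - intros z Hz. apply hol_zeta_ext; auto.
 - intros z Hz _.
  exact (@filterlim_locally_unique nat C_AbsRing C_NormedModule eventually _ _ (F z) (zeta_ext a b z)
   (S2 z ltac:(lra)) (zeta_ext_series a b Ha z ltac:(lra))).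
 - apply hol_ex_derive, S1. auto.
 - now apply hol_zeta_ext.
Qed.

Lemma not_pole_refl_neq_1 (s : C) : not_pole (1 - s)%C -> s <> 1.
Proof. intros Hp E. apply (Hp 0%nat). rewrite E. simpl. ring. Qed.

Lemma hurwitz_zeta_Hankel (a : C) (b : R) (Ha : 0 < Re a) (Hb : exp b < 2 * PI) (s : C) : not_pole (1 - s)%C -> hurwitz_zeta s a = hank_zeta a b s.
Proof.
 intros Hp. rewrite (hurwitz_zeta_ext a b) by (auto; now apply not_pole_refl_neq_1). now apply zeta_ext_hank.
Qed.

Lemma hurwitz_zeta_deriv (a : C) (b : R) (Ha : 0 < Re a) (Hb : exp b < 2 * PI) (s : C) : not_pole (1 - s)%C ->
 (hurwitz_zeta' s a + digamma (1 - s) * hurwitz_zeta s a)%C =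
 (Gamma_ext (1 - s) / (RtoC (2 * PI) * Ci) * Hankel_log a b s)%C.
Proof.
 intros Hp. assert (N := two_pi_i_neq_0).
 destruct (cdiff_Gamma_ext_refl s Hp) as (g & Hg & Hg').
 destruct (near_1_minus s Hp) as (r & Hr & Hw).
 assert (D : cdiff (fun z => hurwitz_zeta z a) s
  ((- g * / (RtoC (2 * PI) * Ci) + Gamma_ext (1 - s) * 0) * Hankel a b s
   + Gamma_ext (1 - s) * / (RtoC (2 * PI) * Ci) * Hankel_log a b s)%C).
 { apply cdiff_ext_loc with (hank_zeta a b) r; auto.
  - intros w H. symmetry. apply hurwitz_zeta_Hankel; auto.
  - assert (D1 := cdiff_mult _ _ _ _ _ Hg' (cdiff_const (/ (RtoC (2 * PI) * Ci))%C s)).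
   exact (cdiff_mult _ _ _ _ _ D1 (cdiff_Hankel a s b Ha Hb)). }
 assert (DG : cdiff Gamma (1 - s)%C g).
 { destruct (not_pole_near _ Hp) as (r' & Hr' & Hw').
  apply cdiff_ext_loc with Gamma_ext r'; auto. intros w H. symmetry. apply Gamma_Gamma_ext. auto. }
 unfold hurwitz_zeta', digamma.
 rewrite (cdiff_C_derive _ _ _ D), (cdiff_C_derive _ _ _ DG), Gamma_Gamma_ext by auto.
 rewrite (hurwitz_zeta_Hankel a b) by auto. unfold hank_zeta.
 assert (G0 := Gamma_ext_neq_0 _ Hp). set (q := (RtoC (2 * PI) * Ci)%C) in *. field. auto.
Qed.

Lemma Cexp_nat_pi (m : nat) : Cexp ((INR m) * (RtoC PI * Ci))%C = RtoC ((-1) ^ m).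
Proof.
 induction m as [|m IH].
 - simpl INR. rewrite Cmult_0_l. apply Cexp_0.
 - rewrite S_INR, RtoC_plus, Cmult_plus_distr_r, Cexp_plus, IH, Cmult_1_l, Cexp_Ci_PI.
  rewrite <- tech_pow_Rmult, RtoC_mult. change (-1) with (- (1)). rewrite RtoC_opp. ring.
Qed.

(* At a positive integer the simple zero of [two_i_sin_pi] cancels the pole of [Gamma (1 - s)]. *)
Lemma Hankel_log_integer (a : C) (b : R) (m : nat) : 0 < Re a -> exp b < 2 * PI -> (1 < m)%nat ->
 Hankel_log a b (INR m) =
 (RtoC ((-1) ^ m) * (RtoC (2 * PI) * Ci) * hurwitz_int (INR m) a)%C.
Proof.
 intros Ha Hb Hm. set (s := RtoC (INR m)).
 assert (Hs : 1 < Re s).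
 { change (1 < INR m). change 1 with (INR 1). now apply lt_INR. }
 destruct (proj2 (hurwitz_int_laplace s a Hs Ha)) as [j Hj].
 assert (E := Cexp_nat_pi m). fold s in E.
 assert (Sq : (RtoC ((-1) ^ m) * RtoC ((-1) ^ m) = 1)%C).
 { rewrite <- RtoC_mult. f_equal. rewrite <- Rpow_mult_distr. replace (-1 * -1) with 1 by ring. apply pow1. }
 assert (E' : Cexp (- (s * (RtoC PI * Ci)))%C = RtoC ((-1) ^ m)).
 { rewrite Cexp_opp, E. set (x := RtoC ((-1) ^ m)) in *.
  assert (x <> 0) by (intros Z; rewrite Z in Sq; apply C1_nz; rewrite <- Sq; ring).
  transitivity (x * x * / x)%C; [rewrite Sq; ring|field; auto]. }
 assert (DS : cdiff two_i_sin_pi s (RtoC ((-1) ^ m) * (RtoC (2 * PI) * Ci))%C).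
 { unfold two_i_sin_pi. set (q := (RtoC PI * Ci)%C) in *.
  apply cdiff_ext with (fun z => Cexp (z * q) + (- (1)) * Cexp (- (1) * (z * q)))%C.
  { intros w. replace (- (w * q))%C with (- (1) * (w * q))%C by ring. ring. }
  eapply cdiff_eq; [|apply cdiff_plus].
  2:{ apply (cdiff_comp Cexp (fun z => z * q)%C); [apply cdiff_mult; [apply cdiff_id|apply cdiff_const]|
     apply cdiff_Cexp]. }
  2:{ apply cdiff_mult; [apply cdiff_const|].
    apply (cdiff_comp Cexp (fun z => - (1) * (z * q))%C);
     [apply cdiff_mult; [apply cdiff_const|apply cdiff_mult; [apply cdiff_id|apply cdiff_const]]|
     apply cdiff_Cexp]. }
  replace (- (1) * (s * q))%C with (- (s * q))%C by ring. rewrite E, E'. unfold q. 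
  rewrite RtoC_mult. ring. }
 assert (DH : cdiff (Hankel a b) s
  (RtoC ((-1) ^ m) * (RtoC (2 * PI) * Ci) * hurwitz_int s a + two_i_sin_pi s * j)%C).
 { apply cdiff_ext_loc with (fun z => two_i_sin_pi z * hurwitz_int z a)%C (Re s - 1); [lra| |].
  - intros w Hw. symmetry. apply Hankel_collapse; auto.
   assert (A := Re_le_Cmod (w - s)%C). simpl in A. change (Re s) with (INR m) in *. fold (Re w) in A.
   unfold Rabs in A. destruct Rcase_abs in A; lra.
  - exact (cdiff_mult _ _ _ _ _ DS Hj). }
 rewrite (cdiff_unique _ _ _ _ (cdiff_Hankel a s b Ha Hb) DH).
 unfold two_i_sin_pi. rewrite E, E'. ring.
Qed.

Lemma not_pole_nat_refl (n : nat) : not_pole (1 - - (INR n))%C.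
Proof.
 apply not_pole_Re. simpl. generalize (pos_INR n). lra.
Qed.

Lemma Gamma_ext_nat_refl (n : nat) : Gamma_ext (1 - - (INR n))%C = (INR (fact n)).
Proof.
 rewrite <- Gamma_ext_fact. f_equal. rewrite plus_INR, RtoC_plus. simpl. ring.
Qed.

Theorem lemma1 (a : C) (ha : 0 < Re a) (eps : R) (heps : 0 < eps < 2 * PI) :
 (forall n : nat,
   let f := fun z l : C =>
    (Cexp (- (INR (n + 1)) * l) / (1 - Cexp z) * Cexp (a * z))%C in
   ex_hankel_int eps f /\
   hurwitz_zeta (- (INR n))%C a =
    ((INR (fact n)) / (2 * PI * Ci) * hankel_int eps f)%C) /\
 (forall n : nat, (1 <= n)%nat ->
   let f := fun z l : C =>
    (Cexp ((INR n) * l) * l / (1 - Cexp z) * Cexp (a * z))%C in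
   ex_hankel_int eps f /\
   hurwitz_zeta (INR (n + 1)) a =
    (RtoC ((-1) ^ (n + 1)) / (2 * PI * Ci * (INR (fact n)))
    * hankel_int eps f)%C) /\
 (forall s : C, (forall k : nat, (1 <= k)%nat -> s <> (INR k)) ->
   let f := fun z l : C =>
    (Cexp ((s - 1) * l) * Cexp (a * z) * l / (1 - Cexp z))%C in
   ex_hankel_int eps f /\
   (hurwitz_zeta' s a + digamma (1 - s) * hurwitz_zeta s a)%C =
    (Gamma (1 - s) / (2 * PI * Ci) * hankel_int eps f)%C) /\
 (forall n : nat,
   let f := fun z l : C =>
    (Cexp ((- (INR n) - 1) * l) * Cexp (a * z) * l / (1 - Cexp z))%C in
   ex_hankel_int eps f /\
   (hurwitz_zeta' (- (INR n)) a
   + digamma (INR (n + 1)) * hurwitz_zeta (- (INR n)) a)%C =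
    ((INR (fact n)) / (2 * PI * Ci) * hankel_int eps f)%C).
Proof.
 assert (hb : exp (ln eps) < 2 * PI) by (rewrite exp_ln; lra).
 assert (E2 : (2 * PI * Ci)%C = (RtoC (2 * PI) * Ci)%C) by (now rewrite RtoC_mult).
 assert (N2 := two_pi_i_neq_0).
 assert (Hn1 : forall n, (1 - - (INR n))%C = (INR (n + 1))).
 { intros n. rewrite plus_INR, RtoC_plus. simpl. ring. }
 rewrite E2. split; [|split; [|split]].
 - intros n f.
  destruct (hankel_int_Hankel a (- (INR n))%C eps f) as [H1 H2]; auto.
  { intros z l. unfold f. replace (- (INR n) - 1)%C with (- (INR (n + 1)))%C.
   - unfold Cdiv. ring.
   - rewrite <- Hn1. ring. }
  split; auto. rewrite H2.
  rewrite (hurwitz_zeta_Hankel a (ln eps) ha hb) by apply not_pole_nat_refl.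
  unfold hank_zeta. now rewrite Gamma_ext_nat_refl.
 - intros n Hn f.
  destruct (hankel_int_Hankel_log a (INR (n + 1)) eps f) as [H1 H2]; auto.
  { intros z l. unfold f. replace ((INR (n + 1)) - 1)%C with (RtoC (INR n)).
   - unfold Cdiv. ring.
   - rewrite <- Hn1. ring. }
  split; auto. rewrite H2, Hankel_log_integer by (auto; lia).
  assert (Hs : 1 < Re (INR (n + 1))).
  { change (1 < INR (n + 1)). change 1 with (INR 1). apply lt_INR. lia. }
  rewrite (hurwitz_zeta_ext a (ln eps) ha hb).
  2:{ intros E. rewrite E in Hs. simpl in Hs. lra. }
  unfold zeta_ext. destruct Rlt_dec; [|tauto]. rewrite Gamma_int_fact.
  assert (Sq : (RtoC ((-1) ^ (n + 1)) * RtoC ((-1) ^ (n + 1)) = 1)%C).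
  { rewrite <- RtoC_mult. f_equal. rewrite <- Rpow_mult_distr.
   replace (-1 * -1) with 1 by ring. apply pow1. }
  assert (F0 : RtoC (INR (fact n)) <> 0) by apply RtoC_neq_0, INR_fact_neq_0.
  set (x := RtoC ((-1) ^ (n + 1))) in *. set (q := (RtoC (2 * PI) * Ci)%C) in *.
  set (J := hurwitz_int (INR (n + 1)) a). set (F := (INR (fact n))) in *.
  transitivity (x * x * J / F)%C; [rewrite Sq; field; auto|field; auto].
 - intros s Hs f.
  assert (Hp : not_pole (1 - s)%C).
  { intros k E. apply (Hs (S k)); [lia|].
   replace s with (1 - (1 - s))%C by ring. rewrite E, S_INR, RtoC_plus. ring. }
  destruct (hankel_int_Hankel_log a s eps f) as [H1 H2]; auto.
  { intros z l. unfold f, Cdiv. ring. }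
  split; auto. rewrite H2, Gamma_Gamma_ext by auto.
  now apply hurwitz_zeta_deriv.
 - intros n f.
  destruct (hankel_int_Hankel_log a (- (INR n))%C eps f) as [H1 H2]; auto.
  { intros z l. unfold f, Cdiv. ring. }
  split; auto. rewrite H2, <- Hn1, <- Gamma_ext_nat_refl.
  apply hurwitz_zeta_deriv; auto. apply not_pole_nat_refl.
Qed.
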